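(* Let $p\ge2$ be a fixed integer, let $(\eta_n)$ be a sequence in $\mathbb R^+=[0,\infty)$ that is $o(1)$, let $\xi>0$ be fixed, and let $f:\mathbb R\to\mathbb R^+$ be monotone increasing, twice differentiable at $0$, with $f(0)=f'(0)=1$. Let $\kappa_n=\sqrt p\,\eta_n\xi+o(\eta_n)$ as $n\to\infty$, and consider the sequence of parametric models $\mathcal P^{(n)}_{\eta_n,\xi,f}=\{{\rm P}^{(n)}_{\theta,\kappa_n,f}:\theta\in\mathcal S^{p-1}\}$. Write $\bar{\mathbf X}_n:=\frac1n\sum_{i=1}^n\mathbf X_{ni}$. Define $\nu_n$, $\Delta^{(n)}_{\theta,\xi}$ and $\Gamma_{\theta,\xi}$ as follows: - if $\sqrt n\,\eta_n\to\infty$ (beyond contiguity): $$\nu_n=\frac1{\sqrt n\,\eta_n},\quad \Delta^{(n)}_{\theta,\xi}:=\xi\sqrt{np}\,(\mathbf I_p-\theta\theta')\bar{\mathbf X}_n,\quad \Gamma_{\theta,\xi}:=\xi^2(\mathbf I_p-\theta\theta');$$ - if $\sqrt n\,\eta_n\to1$ (under contiguity): $$\nu_n\equiv1,\quad \Delta^{(n)}_{\theta,\xi}:=\xi\sqrt{np}\,\bar{\mathbf X}_n-\xi^2\theta,\quad \Gamma_{\theta,\xi}:=\xi^2\mathbf I_p;$$ - if $\sqrt n\,\eta_n=o(1)$ (under strict contiguity): $$\nu_n\equiv1,\quad \Delta^{(n)}_{\theta,\xi}:=\mathbf 0,\quad \Gamma_{\theta,\xi}:=\mathbf 0.$$ Let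 $\theta\in\mathcal S^{p-1}$ and let $(\tau_n)$ be a bounded sequence in $\mathbb R^p$ that is not $o(1)$ and such that $\theta+\nu_n\tau_n\in\mathcal S^{p-1}$ for any $n$. Then, in each of these three regimes, as $n\to\infty$ under ${\rm P}^{(n)}_{\theta,\kappa_n,f}$, $$\log\frac{d{\rm P}^{(n)}_{\theta+\nu_n\tau_n,\kappa_n,f}}{d{\rm P}^{(n)}_{\theta,\kappa_n,f}}=\tau_n'\Delta^{(n)}_{\theta,\xi}-\frac12\tau_n'\Gamma_{\theta,\xi}\tau_n+o_{\rm P}(1)\quad\text{and}\quad \Delta^{(n)}_{\theta,\xi}\stackrel{\mathcal D}{\to}\mathcal N_p(\mathbf 0,\Gamma_{\theta,\xi}).$$ In other words, $\mathcal P^{(n)}_{\eta_n,\xi,f}$ is locally asymptotically normal (LAN), with central sequence $\Delta^{(n)}_{\theta,\xi}$, Fisher information matrix $\Gamma_{\theta,\xi}$, and contiguity rate $\nu_n$.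
   Context: $\mathcal S^{p-1}=\{\mathbf x\in\mathbb R^p:\|\mathbf x\|=1\}$; a prime on vectors/matrices denotes transpose; $\mathbf I_p$ is the $p\times p$ identity matrix; $\stackrel{\mathcal D}{\to}$ is weak convergence; $o_{\rm P}(1)$ denotes convergence to zero in probability. Normal distributions may be singular (the zero covariance matrix gives a point mass). For $\theta\in\mathcal S^{p-1}$, $\kappa>0$ and $f:\mathbb R\to\mathbb R^+$ monotone increasing, twice differentiable at $0$ with $f(0)=f'(0)=1$, $\mathcal R(\theta,\kappa,f)$ denotes the distribution on $\mathcal S^{p-1}$ whose density with respect to the surface area measure is proportional to $\mathbf x\mapsto f(\kappa\,\mathbf x'\theta)$. ${\rm P}^{(n)}_{\theta,\kappa_n,f}$ denotes the hypothesis (joint law on $(\mathcal S^{p-1})^n$) under which $\mathbf X_{n1},\ldots,\mathbf X_{nn}$ are i.i.d. with distribution $\mathcal R(\theta,\kappa_n,f)$; for $\kappa_n=0$ it denotes i.i.d. sampling from the uniform distribution over $\mathcal S^{p-1}$. When $\sqrt n\,\eta_n\to\infty$, $\nu_n$ is understood for those (all large) $n$ with $\eta_n>0$. *)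

(* Defs.v *)
From HB Require Import structures.
From mathcomp Require Import all_boot all_order all_algebra.
From mathcomp Require Import all_classical all_reals all_analysis.
From mathcomp Require Import measurable_realfun.

Set Implicit Arguments.
Unset Strict Implicit.
Unset Printing Implicit Defensive.

Import Order.TTheory GRing.Theory Num.Theory.
Import numFieldNormedType.Exports.

Local Open Scope classical_set_scope.
Local Open Scope ring_scope.

(* Analogue of [distribution] for measures that need not be probabilities:
   bundling [f] lets the image measure be inferred as a measure. *)
Section image_measure.
Local Open Scope ereal_scope.
Context d d' (T : measurableType d) (T' : measurableType d') (R : realType).
Variables (mu : {measure set T -> \bar R}) (f : {mfun T >-> T'}).

Definition image_measure : set T' -> \bar R := pushforward mu f.

Let image_measure0 : image_measure set0 = 0.
Proof. by rewrite /image_measure /pushforward preimage_set0 measure0. Qed.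

Let image_measure_ge0 A : 0 <= image_measure A.
Proof. exact: measure_ge0. Qed.

Let image_measure_sigma_additive : semi_sigma_additive image_measure.
Proof.
exact: (@measure_semi_sigma_additive _ _ _
  (measure_function_pushforward__canonical__measure_function_Measure
     mu (measurable_funPT f))).
Qed.

HB.instance Definition _ := isMeasure.Build _ _ _ image_measure
  image_measure0 image_measure_ge0 image_measure_sigma_additive.

End image_measure.

Section power_measure.
Local Open Scope ereal_scope.
Context d (T : measurableType d) (R : realType).

Section step.
Context (n : nat).

Definition tuple_cons (z : T * n.-tuple T) : n.+1.-tuple T :=
  [the n.+1.-tuple T of z.1 :: z.2].

Definition tuple_uncons (t : n.+1.-tuple T) : T * n.-tuple T :=
  (tnth t ord0, [tuple of behead t]).

Let measurable_tuple_cons : measurable_fun setT tuple_cons.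
Proof. by apply: measurable_cons. Qed.

HB.instance Definition _ :=
  isMeasurableFun.Build _ _ _ _ tuple_cons measurable_tuple_cons.

Lemma measurable_tuple_uncons : measurable_fun setT tuple_uncons.
Proof.
apply/measurable_fun_pairP; split; first exact: measurable_tnth.
exact: measurable_behead.
Qed.

Lemma tuple_consK : cancel tuple_cons tuple_uncons.
Proof. by case=> x t; congr pair; apply/val_inj. Qed.

Context (mu : {sigma_finite_measure set T -> \bar R})
        (nu : {sigma_finite_measure set (n.-tuple T) -> \bar R}).

Definition cons_measure : set (n.+1.-tuple T) -> \bar R :=
  image_measure (mu \x nu) tuple_cons.

HB.instance Definition _ := Measure.on cons_measure.

Let cons_measure_sigma_finite : sigma_finite setT cons_measure.
Proof.
have /sigma_finiteP[F [FT ndF Foo]] := sigma_finiteT mu.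
have /sigma_finiteP[G [GT ndG Goo]] := sigma_finiteT nu.
exists (fun k => tuple_uncons @^-1` (F k `*` G k)).
  apply/esym; rewrite -subTset => t _.
  have [i _ Fi] : (\bigcup_k F k) (tuple_uncons t).1 by rewrite -FT.
  have [j _ Gj] : (\bigcup_k G k) (tuple_uncons t).2 by rewrite -GT.
  exists (maxn i j) => //; split.
    by move: Fi; exact/subsetPset/ndF/leq_maxl.
  by move: Gj; exact/subsetPset/ndG/leq_maxr.
move=> k; have [mF Flt] := Foo k; have [mG Glt] := Goo k; split.
  rewrite -[X in measurable X]setTI; apply: measurable_tuple_uncons => //.
  exact: measurableX.
rewrite /cons_measure /image_measure /pushforward -comp_preimage.
rewrite (_ : tuple_uncons \o tuple_cons = id); last first.
  by apply/funext => z /=; rewrite tuple_consK.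
rewrite preimage_id [ltLHS](product_measure1E mu nu mF mG).
by rewrite lte_mul_pinfty// ge0_fin_numE.
Qed.

HB.instance Definition _ :=
  Measure_isSigmaFinite.Build _ _ _ cons_measure cons_measure_sigma_finite.

End step.

Fixpoint power_measure (mu : {sigma_finite_measure set T -> \bar R}) (n : nat) :
    {sigma_finite_measure set (n.-tuple T) -> \bar R} :=
  match n with
  | 0 => \d_([tuple] : 0.-tuple T)
  | m.+1 => cons_measure mu (power_measure mu m)
  end.

End power_measure.

Section iid.
Local Open Scope ereal_scope.
Context d (T : measurableType d) (R : realType).

Definition iid_law (P : probability T R) (n : nat) : set (n.-tuple T) -> \bar R :=
  power_measure P n.

HB.instance Definition _ P n := Measure.on (@iid_law P n).

Let iid_law_setT P n : @iid_law P n setT = 1.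
Proof.
rewrite /iid_law; elim: n => [|n IHn] /=; first by rewrite diracT.
rewrite /cons_measure /image_measure /pushforward preimage_setT -setXTT.
rewrite [LHS](product_measure1E P (power_measure P n) measurableT measurableT).
by rewrite IHn mule1; exact: probability_setT.
Qed.

HB.instance Definition _ P n :=
  Measure_isProbability.Build _ _ _ (@iid_law P n) (@iid_law_setT P n).

End iid.

Section euclidean_space.
Context {R : realType} {p : nat}.
Implicit Types x y : 'cV[R]_p.

Definition dotv x y : R := (x^T *m y) 0 0.

(* The library norm of a matrix is the sup norm. *)
Definition enorm x : R := Num.sqrt (dotv x x).

Definition sphere : set 'cV[R]_p := [set x | enorm x = 1].

Lemma dotvE x y : dotv x y = \sum_i x i 0 * y i 0.
Proof. by rewrite /dotv mxE; apply: eq_bigr => i _; rewrite mxE. Qed.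

End euclidean_space.
Arguments sphere {R}.

Definition cV_display : measure_display.
Proof. exact: default_measure_display. Qed.

(* The sigma-algebra generated by the coordinates, i.e. the Borel one. *)
Section measurable_cV.
Context (R : realType) (p : nat).

Let coors (i : 'I_p) (x : 'cV[R]_p) : measurableTypeR R := x i 0.

Let cV_set0 : g_sigma_preimage coors set0.
Proof. exact: sigma_algebra0. Qed.

Let cV_setC A : g_sigma_preimage coors A -> g_sigma_preimage coors (~` A).
Proof. exact: sigma_algebraC. Qed.

Let cV_bigcup (F : _^nat) : (forall i, g_sigma_preimage coors (F i)) ->
  g_sigma_preimage coors (\bigcup_i (F i)).
Proof. exact: sigma_algebra_bigcup. Qed.

HB.instance Definition _ := @isMeasurable.Build cV_display 'cV[R]_p
  (g_sigma_preimage coors) cV_set0 cV_setC cV_bigcup.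

Lemma measurable_coord (i : 'I_p) :
  measurable_fun setT (fun x : 'cV[R]_p => x i 0 : measurableTypeR R).
Proof.
move=> _ Y mY; rewrite setTI; apply: sub_sigma_algebra => /=.
rewrite -bigcup_seq/=; exists i => /=; first by rewrite mem_index_enum.
by exists Y => //; rewrite setTI.
Qed.

Lemma measurable_fun_cVP d (T : measurableType d) (f : T -> 'cV[R]_p) :
  (forall i, measurable_fun setT (fun t => f t i 0 : measurableTypeR R)) ->
  measurable_fun setT f.
Proof.
move=> mf; apply: (@measurability _ _ _ _ _ _ (\big[setU/set0]_(i < p)
  preimage_set_system setT (coors i) measurable)); first by [].
move=> _ [A + <-]; rewrite -bigcup_seq/= => -[i _ [B mB <-]]; rewrite !setTI.
by rewrite -[X in measurable X]setTI; exact: (mf i).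
Qed.

End measurable_cV.

Section surface_area.
Context (R : realType) (p : nat).

Definition cV_of_tuple (t : p.-tuple (measurableTypeR R)) : 'cV[R]_p :=
  \col_i tnth t i.

Let measurable_cV_of_tuple : measurable_fun setT cV_of_tuple.
Proof.
apply: measurable_fun_cVP => i.
rewrite (_ : (fun _ => _) = (@tnth p (measurableTypeR R) ^~ i)).
  exact: measurable_tnth.
by apply/funext => t; rewrite mxE.
Qed.

HB.instance Definition _ :=
  isMeasurableFun.Build _ _ _ _ cV_of_tuple measurable_cV_of_tuple.

Definition lebesgue_cV : set 'cV[R]_p -> \bar R :=
  image_measure (power_measure lebesgue_measure p) cV_of_tuple.

HB.instance Definition _ := Measure.on lebesgue_cV.

Lemma measurable_dotv (y : 'cV[R]_p) : measurable_fun setT (dotv ^~ y).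
Proof.
under eq_fun do rewrite dotvE.
apply: measurable_sum => i; apply: measurable_funM; last exact: measurable_cst.
exact: measurable_coord.
Qed.

Lemma measurable_enorm : measurable_fun setT (@enorm R p).
Proof.
rewrite /enorm; apply: measurableT_comp.
  exact: continuous_measurable_fun (@sqrt_continuous R).
under eq_fun do rewrite dotvE.
by apply: measurable_sum => i; apply: measurable_funM; exact: measurable_coord.
Qed.

Definition radial_proj (x : 'cV[R]_p) : 'cV[R]_p := (enorm x)^-1 *: x.

Let measurable_radial_proj : measurable_fun setT radial_proj.
Proof.
apply: measurable_fun_cVP => i.
under eq_fun do rewrite mxE -powR_inv1 ?sqrtr_ge0//.
apply: measurable_funM; last exact: measurable_coord.
exact: (measurableT_comp (measurable_powR _) measurable_enorm).
Qed.

HB.instance Definition _ :=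
  isMeasurableFun.Build _ _ _ _ radial_proj measurable_radial_proj.

Definition punctured_ball : set 'cV[R]_p := [set x | 0 < enorm x <= 1].

Lemma measurable_punctured_ball : measurable punctured_ball.
Proof.
rewrite (_ : punctured_ball = @enorm R p @^-1` `]0, 1]%classic); last first.
  by apply/seteqP; split=> x /=; rewrite in_itv.
by rewrite -[X in measurable X]setTI; exact: measurable_enorm.
Qed.

(* Surface area measure of the unit sphere, from polar coordinates
   dx = r^(p-1) dr dsigma: the sector {r u | u \in A, 0 < r <= 1} over A has
   volume sigma(A) / p.  It is a measure on R^p carried by the sphere. *)
Definition surface_area (A : set 'cV[R]_p) : \bar R :=
  (p%:R%:E * lebesgue_cV (radial_proj @^-1` A `&` punctured_ball))%E.

Let surface_areaE : surface_area = mscale (p%:R)%:nng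
  (image_measure (mrestr lebesgue_cV measurable_punctured_ball) radial_proj).
Proof. by []. Qed.

Let surface_area0 : surface_area set0 = 0%E.
Proof. by rewrite surface_areaE measure0. Qed.

Let surface_area_ge0 A : (0 <= surface_area A)%E.
Proof. by rewrite surface_areaE; exact: measure_ge0. Qed.

Let surface_area_sigma_additive : semi_sigma_additive surface_area.
Proof. by rewrite surface_areaE; exact: measure_semi_sigma_additive. Qed.

HB.instance Definition _ := isMeasure.Build _ _ _ surface_area
  surface_area0 surface_area_ge0 surface_area_sigma_additive.

End surface_area.

(* Functions f : R -> [0, +oo[ that are increasing, in the weak sense. *)
Record angular_function (R : realType) := AngularFunction {
  angular_fun :> R -> R;
  angular_fun_ge0 : forall t, 0 <= angular_fun t;
  angular_fun_homo : {homo angular_fun : s t / s <= t}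
}.

Section rotationally_symmetric.
Local Open Scope ereal_scope.
Context (R : realType) (p : nat).
Variables (theta : 'cV[R]_p) (kappa : R) (f : angular_function R).

(* f(kappa x'theta) dsigma(x), not normalized *)
Definition angular_measure (A : set 'cV[R]_p) : \bar R :=
  \int[@surface_area R p]_(x in A) (f (kappa * dotv x theta))%:E.

Let measurable_density :
  measurable_fun setT (fun x : 'cV[R]_p => (f (kappa * dotv x theta))%:E).
Proof.
apply/measurable_EFinP; apply: measurableT_comp.
  by apply: nondecreasing_measurable => //; exact: angular_fun_homo.
by apply: measurable_funM; [exact: measurable_cst|exact: measurable_dotv].
Qed.

Let angular_measure0 : angular_measure set0 = 0.
Proof. exact: integral_set0. Qed.

Let angular_measure_ge0 A : 0 <= angular_measure A.
Proof. by apply: integral_ge0 => x _; rewrite lee_fin angular_fun_ge0. Qed.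

Let angular_measure_sigma_additive : semi_sigma_additive angular_measure.
Proof.
move=> F mF tF _; rewrite /angular_measure ge0_integral_bigcup//.
- by apply: is_cvg_ereal_nneg_natsum_cond => n _ _; exact: angular_measure_ge0.
- exact: measurable_funTS.
- by move=> x _; rewrite lee_fin angular_fun_ge0.
Qed.

HB.instance Definition _ := isMeasure.Build _ _ _ angular_measure
  angular_measure0 angular_measure_ge0 angular_measure_sigma_additive.

(* The point mass at theta is only the default value of [mnormalize] for a
   total mass 0 or +oo, which does not occur when f(0) = 1 and p >= 1. *)
Definition rotsym_law : probability 'cV[R]_p R :=
  mnormalize angular_measure \d_theta.

End rotationally_symmetric.

Section model.
Local Open Scope ereal_scope.
Local Open Scope charge_scope.
Context (R : realType) (p : nat).
Variables (kappa : R) (f : angular_function R) (n : nat).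

Definition joint_law (theta : 'cV[R]_p) : probability (n.-tuple 'cV[R]_p) R :=
  @iid_law _ _ R (rotsym_law theta kappa f) n.

(* When joint_law theta' is not absolutely continuous with respect to
   joint_law theta (possible only if f vanishes somewhere on
   [- kappa, kappa]), the library derivative, and hence the log-ratio, is the
   constant -oo. *)
Definition loglik_ratio (theta' theta : 'cV[R]_p) (x : n.-tuple 'cV[R]_p) :
    \bar R :=
  lne (('d (charge_of_finite_measure (joint_law theta')) '/d (joint_law theta)) x).

End model.

Section normal_law.
Context (R : realType) (p : nat).

Definition affine_cV (mu : 'cV[R]_p) (A : 'M[R]_p)
    (z : p.-tuple (measurableTypeR R)) : 'cV[R]_p := mu + A *m cV_of_tuple z.

Let measurable_affine_cV mu A : measurable_fun setT (affine_cV mu A).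
Proof.
apply: measurable_fun_cVP => i.
under eq_fun do rewrite mxE mxE.
apply: measurable_funD; first exact: measurable_cst.
apply: measurable_sum => j; apply: measurable_funM; first exact: measurable_cst.
under eq_fun do rewrite mxE.
exact: measurable_tnth.
Qed.

HB.instance Definition _ mu A :=
  isMeasurableFun.Build _ _ _ _ (affine_cV mu A) (@measurable_affine_cV mu A).

(* N_p(mu, Sigma) is the law of mu + A Z, with Z standard normal and
   A A' = Sigma; it does not depend on the choice of A. *)
Definition mvnormal (mu : 'cV[R]_p) (Sigma : 'M[R]_p) : probability 'cV[R]_p R :=
  distribution
    (@iid_law _ _ R (normal_prob 0 1) p)
    (affine_cV mu (xget 0 [set A | A *m A^T = Sigma])).

End normal_law.

Section asymptotics.
Local Open Scope ereal_scope.
Context (R : realType) (d : nat -> measure_display)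
  (T : forall n, measurableType (d n)) (P : forall n, probability (T n) R).

Definition is_oP1 (Y : forall n, T n -> \bar R) : Prop :=
  forall e : R, (0 < e)%R ->
    P n [set x | e%:E <= `|Y n x|] @[n --> \oo] --> 0.

Definition cvg_in_law p (X : forall n, T n -> 'cV[R]_p)
    (nu : probability 'cV[R]_p R) : Prop :=
  forall g : 'cV[R]_p -> R, continuous g -> bounded_fun g ->
    \int[P n]_x (g (X n x))%:E @[n --> \oo] --> \int[nu]_x (g x)%:E.

End asymptotics.

Inductive regime := beyond_contiguity | under_contiguity | strict_contiguity.

Section regimes.
Context (R : realType) (p : nat) (r : regime).

Definition in_regime (eta : R^nat) : Prop :=
  let u n := Num.sqrt n%:R * eta n in
  match r with
  | beyond_contiguity => u n @[n --> \oo] --> +oo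
  | under_contiguity => u n @[n --> \oo] --> (1 : R)
  | strict_contiguity => u n @[n --> \oo] --> (0 : R)
  end.

(* In the first regime this is 0 at the finitely many n with eta n = 0. *)
Definition contiguity_rate (eta : R^nat) (n : nat) : R :=
  match r with
  | beyond_contiguity => (Num.sqrt n%:R * eta n)^-1
  | under_contiguity | strict_contiguity => 1
  end.

Definition sample_mean n (x : n.-tuple 'cV[R]_p) : 'cV[R]_p :=
  n%:R^-1 *: \sum_(i < n) tnth x i.

Definition central_sequence (xi : R) (theta : 'cV[R]_p) (n : nat)
    (x : n.-tuple 'cV[R]_p) : 'cV[R]_p :=
  match r with
  | beyond_contiguity => (xi * Num.sqrt (n * p)%:R) *:
      ((1%:M - theta *m theta^T) *m sample_mean x)
  | under_contiguity => (xi * Num.sqrt (n * p)%:R) *: sample_mean x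
      - xi ^+ 2 *: theta
  | strict_contiguity => 0
  end.

Definition fisher_information (xi : R) (theta : 'cV[R]_p) : 'M[R]_p :=
  match r with
  | beyond_contiguity => xi ^+ 2 *: (1%:M - theta *m theta^T)
  | under_contiguity => xi ^+ 2 *: 1%:M
  | strict_contiguity => 0
  end.

End regimes.

(* Main.v *)
(* By rotation invariance the normalizing constant of R(theta, kappa, f) does not
   depend on theta, so with omega = theta + nu tau the log-likelihood ratio is the
   sum over the sample of ln(1 + D(X_i)), D(x) = f(kappa <x, omega>) / f(kappa <x, theta>) - 1.
   Here D has mean exactly 0, and D(x) = (1 + o(1)) kappa nu <x, tau> uniformly in x,
   because f is strictly differentiable at 0.  Expand ln(1 + D) = D - D^2/2 + O(D^3).
   By Chebyshev's inequality, the sum of D(X_i) differs from the centered linear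
   statistic of the regime by o_P(1) and the sum of D(X_i)^2 concentrates at its mean.
   The remaining deterministic terms follow from E[<X, u>^2] -> |u|^2 / p and
   E[X] = (kappa / p + o(kappa)) theta.  Beyond contiguity, |theta + nu tau| = 1 forces
   <theta, tau> = - nu |tau|^2 / 2 -> 0, hence the projection orthogonal to theta.

   Asymptotic normality is Lindeberg's replacement argument.  The Gaussian law is
   only used through its stability under (Z, Z') |-> a Z + b Z' and its moments, and
   the test functions are tensor products of cubic splines, which approximate every
   continuous function uniformly on boxes. *)
Require Import Defs.
From HB Require Import structures.
From mathcomp Require Import all_boot all_order all_algebra.
From mathcomp Require Import all_classical all_reals all_analysis.
From mathcomp Require Import measurable_realfun.
From mathcomp Require Import ring lra.

Set Implicit Arguments.
Unset Strict Implicit.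
Unset Printing Implicit Defensive.

Import Order.TTheory GRing.Theory Num.Theory.
Import numFieldNormedType.Exports.

Local Open Scope classical_set_scope.
Local Open Scope ring_scope.

(** Beyond contiguity [kappa n * nu n] is negligible with respect to [kappa n], so a Taylor
    expansion of f at 0, with its error o(kappa), says nothing about the difference of f at kappa
    x'omega and kappa x'theta. Strict differentiability bounds the error by a small multiple of the
    difference of the two arguments; the second derivative at 0 enters there, through the continuity
    of f' at 0. Dividing by f(kappa x'theta) requires f(- kappa) > 0, which is only available for
    large n, hence the many eventual statements. Since D is exactly centred, no second-order term of
    f has to be matched: the drift consists of half the mean of D^2 and of the centring of the
    linear statistic. The regimes are treated together through the matrix [score_proj], the scalar
    [score_shift] and the limit [rate_limit] of sqrt(n) kappa nu, and separate only in the last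
    limits. Independence is used only through the recursive structure of [power_measure]: statements
    on samples are proved by induction on the sample size and Fubini. Composing with [radial_proj]
    makes the functions of the sample bounded on all of R^p, so integrability reduces to [bmeas]. *)

Local Notation iid_ P n := (@iid_law _ _ _ P n).

(** * Lebesgue measure on R^p and the surface area measure *)

Section lebesgue_affine.
Local Open Scope ereal_scope.
Context {R : realType}.
Notation mu := (@lebesgue_measure R).

(** By uniqueness of Lebesgue measure the substitution only has to be checked on half-open
    intervals: the image measure under x -> a x + b, multiplied by a, gives each of them its
    length. *)
Lemma ge0_integral_lebesgue_affine (a b : R) (f : R -> \bar R) : (0 < a)%R ->
  measurable_fun setT f -> (forall x, 0 <= f x) ->
  \int[mu]_x f (a * x + b)%R = a^-1%:E * \int[mu]_x f x.
Proof.
move=> a0 mf f0.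
pose phi (x : measurableTypeR R) : measurableTypeR R := (a * x + b)%R.
have mphi : measurable_fun setT phi.
  apply: measurable_funD; last exact: measurable_cst.
  by apply: measurable_funM; [exact: measurable_cst|exact: measurable_id].
pose phim : {mfun measurableTypeR R >-> measurableTypeR R} :=
  HB.pack phi (isMeasurableFun.Build _ _ _ _ phi mphi).
pose a' : {nonneg R} := NngNum (ltW a0).
have E A : measurable A -> mu A = mscale a' (image_measure mu phim) A.
  apply: lebesgue_measure_unique => _ [[c d]] _ <-.
  transitivity (a%:E * mu (phi @^-1` [set` `]c, d]])); last by [].
  have -> : phi @^-1` [set` `]c, d]] = [set` `](c - b) / a, (d - b) / a]]%R.
    apply/seteqP; split=> x /=; rewrite !in_itv/= /phi ler_pdivlMr// ltr_pdivrMr//;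
      by rewrite ltrBlDr lerBrDr ![(x * a)%R]mulrC.
  rewrite !lebesgue_measure_itv/= !lte_fin.
  rewrite ltr_pM2r ?invr_gt0// ltrD2r; case: ifPn => _; last by rewrite mule0.
  rewrite -!EFinD -EFinM; congr EFin.
  by field; rewrite gt_eqF.
rewrite [X in _ * X](@eq_measure_integral _ _ _ _ (mscale a' (image_measure mu phim))); last first.
  by move=> A mA _; exact: E.
rewrite ge0_integral_mscale//=.
rewrite muleA -EFinM mulVf ?gt_eqF// mul1e.
by rewrite (@ge0_integral_pushforward _ _ _ _ _ phi mphi mu setT f)//= => x _.
Qed.

End lebesgue_affine.

Section power_measure_integral.
Local Open Scope ereal_scope.
Context d (T : measurableType d) (R : realType).
Implicit Types mu : {sigma_finite_measure set T -> \bar R}.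

Lemma ge0_integral_image_measure d1 d2 (T1 : measurableType d1)
    (T2 : measurableType d2) (mu : {measure set T1 -> \bar R})
    (phi : {mfun T1 >-> T2}) (f : T2 -> \bar R) :
  measurable_fun setT f -> (forall x, 0 <= f x) ->
  \int[image_measure mu phi]_y f y = \int[mu]_x f (phi x).
Proof.
move=> mf f0; rewrite (@ge0_integral_pushforward _ _ _ _ _ phi _ mu setT f)//.
Qed.

Lemma measurable_tuple_cons n : measurable_fun setT (@tuple_cons d T n).
Proof. exact: measurable_funPT. Qed.

(** Tonelli for the head and tail recursion that defines [power_measure]; it drives the later
    inductions on the dimension or on the sample size. *)
Lemma ge0_integral_power_measureS mu n (f : n.+1.-tuple T -> \bar R) :
  measurable_fun setT f -> (forall x, 0 <= f x) ->
  \int[power_measure mu n.+1]_t f t =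
  \int[mu]_x \int[power_measure mu n]_t f (tuple_cons (x, t)).
Proof.
move=> mf f0; rewrite [LHS](ge0_integral_image_measure _ _ mf f0).
rewrite (fubini_tonelli1 (fun z => f (tuple_cons z)))//.
by apply: measurableT_comp => //; exact: measurable_tuple_cons.
Qed.

Lemma integral_power_measure0 mu (f : 0.-tuple T -> \bar R) :
  \int[power_measure mu 0]_t f t = f [tuple].
Proof.
rewrite /= integral_dirac ?diracT ?mul1e//.
rewrite (_ : f = cst (f [tuple])); first exact: measurable_cst.
by apply/funext => t; rewrite tuple0.
Qed.

Lemma measurable_box n (I : set T) : measurable I ->
  measurable [set t : n.-tuple T | forall i, I (tnth t i)].
Proof.
move=> mI.
rewrite (_ : mkset _ = \bigcap_(i in [set: 'I_n]) ((@tnth n T ^~ i) @^-1` I)).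
  apply: fin_bigcap_measurable; first exact: finite_finset.
  move=> i _; rewrite -[X in measurable X]setTI; exact: measurable_tnth.
by apply/seteqP; split=> t /= h i; [move=> _|]; exact: h.
Qed.

Lemma power_measure_box mu n (I : set T) : measurable I ->
  power_measure mu n [set t | forall i, I (tnth t i)] = \prod_(i < n) mu I.
Proof.
move=> mI; elim: n => [|n IHn].
  rewrite big_ord0 /= diracE mem_set//=.
  by case.
rewrite big_ord_recl -IHn.
rewrite -[RHS](product_measure1E mu (power_measure mu n))//; last exact: measurable_box.
rewrite [LHS]/= /cons_measure /image_measure /pushforward.
congr (_ _); apply/seteqP; split=> -[x t] /=.
  move=> h; split; first exact: (h ord0).
  by move=> i; have := h (lift ord0 i); rewrite tnthS.
move=> [h1 h2] i; case: (unliftP ord0 i) => [j|] ->; last by [].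
by rewrite tnthS; exact: h2.
Qed.

Definition map_coords n (phi : 'I_n -> T -> T) (t : n.-tuple T) : n.-tuple T :=
  [tuple phi i (tnth t i) | i < n].

Lemma measurable_map_coords n (phi : 'I_n -> T -> T) :
  (forall i, measurable_fun setT (phi i)) -> measurable_fun setT (map_coords phi).
Proof.
move=> mphi; apply/measurable_fun_tnthP => i.
rewrite (_ : _ \o _ = fun t => phi i (tnth t i)).
  by apply: measurableT_comp => //; exact: measurable_tnth.
by apply/funext => t /=; rewrite tnth_mktuple.
Qed.

(** The tail is handled by induction for a fixed head, then the head by hypothesis. It serves for
    translations of R^p and for the change of sign of one Gaussian coordinate. *)
Lemma ge0_integral_map_coords mu n (phi : 'I_n -> T -> T) (f : n.-tuple T -> \bar R) :
  (forall i, measurable_fun setT (phi i)) ->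
  (forall i (h : T -> \bar R), measurable_fun setT h -> (forall x, 0 <= h x) ->
    \int[mu]_x h (phi i x) = \int[mu]_x h x) ->
  measurable_fun setT f -> (forall x, 0 <= f x) ->
  \int[power_measure mu n]_t f (map_coords phi t) = \int[power_measure mu n]_t f t.
Proof.
elim: n phi f => [|n IHn] phi f mphi phimu mf f0.
  by rewrite !integral_power_measure0; congr f; rewrite tuple0.
have mfp : measurable_fun setT (fun t => f (map_coords phi t)).
  by apply: measurableT_comp => //; exact: measurable_map_coords.
rewrite [RHS]ge0_integral_power_measureS//.
rewrite (ge0_integral_power_measureS mu mfp); last by move=> x; exact: f0.
have mf' x : measurable_fun setT (fun t => f (tuple_cons (x, t))).
  apply: measurableT_comp => //; apply: measurableT_comp; first exact: measurable_tuple_cons.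
  exact: measurable_pair1.
transitivity (\int[mu]_x \int[power_measure mu n]_t f (tuple_cons (phi ord0 x, t))).
  apply: eq_integral => x _.
  rewrite -[RHS](IHn (fun i => phi (lift ord0 i)) (fun t => f (tuple_cons (phi ord0 x, t))));
    [|by move=> i; exact: mphi|by move=> i; exact: phimu|exact: mf'|by move=> t; exact: f0].
  apply: eq_integral => t _; congr f; apply: eq_from_tnth => i.
  rewrite tnth_mktuple; case: (unliftP ord0 i) => [j|] ->; last by [].
  by rewrite !tnthS tnth_mktuple.
apply: (phimu ord0 (fun x => \int[power_measure mu n]_t f (tuple_cons (x, t)))).
- apply: (measurable_fun_fubini_tonelli_F (fun z => f (tuple_cons z))) => //.
  by apply: measurableT_comp => //; exact: measurable_tuple_cons.
- by move=> x; exact: integral_ge0.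
Qed.

End power_measure_integral.

(** * Translations, balls and orthogonal maps of R^p *)

Section cV.
Local Open Scope ereal_scope.
Context {R : realType}.

Notation lam n := (power_measure (@lebesgue_measure R) n).

Notation lamV p := (@lebesgue_cV R p).

Lemma measurable_cV_of_tuple p : measurable_fun setT (@cV_of_tuple R p).
Proof. exact: measurable_funPT. Qed.

Lemma ge0_integral_lebesgue_cV p (f : 'cV[R]_p -> \bar R) :
  measurable_fun setT f -> (forall x, 0 <= f x) ->
  \int[lamV p]_x f x = \int[lam p]_t f (cV_of_tuple t).
Proof. exact: ge0_integral_image_measure. Qed.

Lemma measurable_addv d (T : measurableType d) p (f g : T -> 'cV[R]_p) :
  measurable_fun setT f -> measurable_fun setT g ->
  measurable_fun setT (fun x => f x + g x)%R.
Proof.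
move=> mf mg; apply: measurable_fun_cVP => i.
under eq_fun do rewrite mxE.
by apply: measurable_funD; apply: (measurableT_comp (measurable_coord i)).
Qed.

Lemma measurable_mulmxv d (T : measurableType d) p q (A : 'M[R]_(q, p)) (f : T -> 'cV[R]_p) :
  measurable_fun setT f -> measurable_fun setT (fun x => A *m f x)%R.
Proof.
move=> mf; apply: measurable_fun_cVP => i.
under eq_fun do rewrite mxE.
apply: measurable_sum => j; apply: measurable_funM; first exact: measurable_cst.
by apply: (measurableT_comp (measurable_coord j)).
Qed.

Lemma measurable_scalev d (T : measurableType d) p (h : T -> R) (f : T -> 'cV[R]_p) :
  measurable_fun setT h -> measurable_fun setT f ->
  measurable_fun setT (fun x => h x *: f x)%R.
Proof.
move=> mh mf; apply: measurable_fun_cVP => i.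
under eq_fun do rewrite mxE.
apply: measurable_funM => //.
by apply: (measurableT_comp (measurable_coord i)).
Qed.

Lemma ge0_integral_lebesgue_cV_shift p (a : 'cV[R]_p) (f : 'cV[R]_p -> \bar R) :
  measurable_fun setT f -> (forall x, 0 <= f x) ->
  \int[lam p]_t f (cV_of_tuple t + a)%R = \int[lam p]_t f (cV_of_tuple t).
Proof.
move=> mf f0.
pose phi (i : 'I_p) (x : measurableTypeR R) : measurableTypeR R := (x + a i 0)%R.
rewrite -[RHS](@ge0_integral_map_coords _ _ _ _ _ phi (fun t => f (cV_of_tuple t)))//.
- apply: eq_integral => t _; congr f; apply/colP => i.
  by rewrite !mxE tnth_mktuple.
- by move=> i; apply: measurable_funD => //; exact: measurable_cst.
- move=> i h mh h0; have := @ge0_integral_lebesgue_affine R 1 (a i 0%R) h ltr01 mh h0.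
  by rewrite invr1 mul1e => <-; apply: eq_integral => x _; rewrite mul1r.
- by apply: measurableT_comp => //; exact: measurable_cV_of_tuple.
Qed.

Definition unit_ball p : set 'cV[R]_p := [set x | enorm x <= 1]%R.

Lemma measurable_unit_ball (p : nat) : measurable (@unit_ball p).
Proof.
rewrite (_ : @unit_ball p = @enorm R p @^-1` [set` `]-oo, 1%R]]); last first.
  by apply/seteqP; split=> x /=; rewrite in_itv.
by rewrite -[X in measurable X]setTI; exact: measurable_enorm.
Qed.

Lemma dotv_ge0 p (x : 'cV[R]_p) : (0 <= dotv x x)%R.
Proof. by rewrite dotvE sumr_ge0// => i _; rewrite -expr2 sqr_ge0. Qed.

Lemma enorm_sqr p (x : 'cV[R]_p) : (enorm x ^+ 2 = dotv x x)%R.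
Proof. by rewrite sqr_sqrtr// dotv_ge0. Qed.

Lemma enorm_ge0 p (x : 'cV[R]_p) : (0 <= enorm x)%R.
Proof. exact: sqrtr_ge0. Qed.

Lemma enorm_le1 p (x : 'cV[R]_p) : (enorm x <= 1)%R = (dotv x x <= 1)%R.
Proof. by rewrite -enorm_sqr -[in RHS](expr1n _ 2) ler_sqr ?nnegrE ?enorm_ge0. Qed.

Lemma coord_le_enorm p (x : 'cV[R]_p) i : (`|x i 0| <= enorm x)%R.
Proof.
rewrite -ler_sqr ?nnegrE ?enorm_ge0// enorm_sqr real_normK ?num_real// dotvE (bigD1 i)//= expr2.
by rewrite lerDl sumr_ge0// => j _; rewrite -expr2 sqr_ge0.
Qed.

Lemma lebesgue_cVE p B : lamV p B = lam p (@cV_of_tuple R p @^-1` B).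
Proof. by []. Qed.

(** The ball lies in the cube [-1, 1]^p, of volume 2^p. *)
Lemma lebesgue_ball_lty p : lamV p (@unit_ball p) < +oo.
Proof.
apply: (@le_lt_trans _ _ (lam p [set t | forall i, `[(-1)%R, 1%R]%classic (tnth t i)])).
  rewrite lebesgue_cVE; apply: le_measure; rewrite ?inE.
  - rewrite -[X in measurable X]setTI; apply: measurable_cV_of_tuple => //.
    exact: measurable_unit_ball.
  - exact: measurable_box.
  move=> t /= h i; rewrite in_itv/= -ler_norml.
  by have := coord_le_enorm (cV_of_tuple t) i; rewrite mxE => /le_trans; apply.
rewrite power_measure_box// (eq_bigr (fun=> 2%:E)); last first.
  move=> i _; transitivity (lebesgue_measure [set` `[(-1)%R, 1%R : R]]); first by [].
  rewrite lebesgue_measure_itv/= lte_fin ifT; last lra.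
  by rewrite -EFinD; congr EFin; lra.
by rewrite prodEFin ltry.
Qed.

(** The cube ]0, 1/p]^p lies inside: each squared coordinate is at most 1/p, and a positive first
    coordinate keeps the origin out. *)
Lemma lebesgue_punctured_ball_gt0 p : (0 < p)%N -> 0 < lamV p (@punctured_ball R p).
Proof.
move=> p0.
apply: (@lt_le_trans _ _ (lam p [set t | forall i, `]0%R, p%:R^-1%R]%classic (tnth t i)]));
  last first.
  rewrite lebesgue_cVE; apply: le_measure; rewrite ?inE.
  - exact: measurable_box.
  - rewrite -[X in measurable X]setTI; apply: measurable_cV_of_tuple => //.
    exact: measurable_punctured_ball.
  move=> t /= h; apply/andP; split.
    apply: lt_le_trans (coord_le_enorm _ (Ordinal p0)).
    have := h (Ordinal p0); rewrite in_itv/= mxE => /andP[h0 _].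
    by rewrite normr_gt0 gt_eqF.
  rewrite enorm_le1 dotvE.
  apply: (@le_trans _ _ (\sum_(i < p) p%:R^-1)%R).
    apply: ler_sum => i _; rewrite mxE.
    have := h i; rewrite in_itv/= => /andP[h0 h1].
    rewrite -[leRHS]mulr1; apply: ler_pM => //; [exact: ltW..|].
    by apply: le_trans h1 _; rewrite invf_le1 ?ltr0n// ler1n.
  by rewrite sumr_const card_ord -(mulr_natr p%:R^-1%R) mulVf// pnatr_eq0 -lt0n.
rewrite power_measure_box// (eq_bigr (fun=> (p%:R^-1)%:E)); last first.
  move=> i _; transitivity (lebesgue_measure [set` `]0%R, p%:R^-1%R : R]]); first by [].
  by rewrite lebesgue_measure_itv/= lte_fin invr_gt0 ltr0n p0 sube0.
by rewrite prodEFin lte_fin prodr_gt0// => i _; rewrite invr_gt0 ltr0n.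
Qed.

Lemma orthogonal_dotv p (O : 'M[R]_p) x y : (O^T *m O = 1%:M)%R ->
  dotv (O *m x)%R (O *m y)%R = dotv x y.
Proof. by move=> OO; rewrite /dotv trmx_mul mulmxA -(mulmxA x^T)%R OO mulmx1. Qed.

Lemma orthogonal_enorm p (O : 'M[R]_p) x : (O^T *m O = 1%:M)%R ->
  enorm (O *m x)%R = enorm x.
Proof. by move=> OO; rewrite /enorm orthogonal_dotv. Qed.

Lemma enormN p (x : 'cV[R]_p) : enorm (- x)%R = enorm x.
Proof.
rewrite /enorm !dotvE; congr Num.sqrt.
by apply: eq_bigr => i _; rewrite !mxE mulrNN.
Qed.

Lemma tonelli_swap d1 d2 (T1 : measurableType d1) (T2 : measurableType d2)
    (m1 : {sigma_finite_measure set T1 -> \bar R})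
    (m2 : {sigma_finite_measure set T2 -> \bar R}) (f : T1 -> T2 -> \bar R) :
  measurable_fun setT (fun z : T1 * T2 => f z.1 z.2) -> (forall x y, 0 <= f x y) ->
  \int[m1]_x \int[m2]_y f x y = \int[m2]_y \int[m1]_x f x y.
Proof. by move=> mf f0; exact: (fubini_tonelli (fun z => f z.1 z.2)). Qed.

(* With B the indicator of the unit ball, Tonelli and the substitutions
   t -> t + O^-1 s and s -> s - O t turn I(f o O) I(B) into I(f) I(B). *)
Lemma ge0_integral_lebesgue_cV_orthogonal p (O : 'M[R]_p) (f : 'cV[R]_p -> \bar R) :
  (0 < p)%N -> (O^T *m O = 1%:M)%R -> measurable_fun setT f -> (forall x, 0 <= f x) ->
  \int[lamV p]_x f (O *m x)%R = \int[lamV p]_x f x.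
Proof.
move=> p0 OO mf f0.
have OO' := mulmx1C OO.
pose B (x : 'cV[R]_p) : \bar R := (\1_(@unit_ball p) x)%:E.
have mB : measurable_fun setT B.
  by apply/measurable_EFinP; apply: measurable_indic; exact: (@measurable_unit_ball p).
have B0 x : 0 <= B x by rewrite lee_fin.
have BE x y : enorm x = enorm y -> B x = B y.
  by move=> xy; rewrite /B !indicE; have -> // : (x \in @unit_ball p) = (y \in @unit_ball p);
    apply/idP/idP; rewrite !inE/= /unit_ball/= xy.
have mcv := @measurable_cV_of_tuple p.
rewrite !ge0_integral_lebesgue_cV//; last first.
  by apply: measurableT_comp => //; exact: measurable_mulmxv.
set K := \int[lam p]_s B (cV_of_tuple s).
have KE : K = lamV p (@unit_ball p).
  rewrite /K -ge0_integral_lebesgue_cV//= integral_indic ?setIT//; exact: (@measurable_unit_ball p).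
(* I(B) is to be cancelled on both sides, so it must be neither 0 nor infinite. *)
have K0 : K != 0.
  rewrite gt_eqF// KE (lt_le_trans (lebesgue_punctured_ball_gt0 p0))//.
  apply: le_measure; rewrite ?inE; [exact: measurable_punctured_ball|exact: measurable_unit_ball|].
  by move=> x /= /andP[].
have Kfin : K \is a fin_num.
  by rewrite ge0_fin_numE ?KE ?measure_ge0// lebesgue_ball_lty.
have KK : K * ((fine K)^-1)%:E = 1.
  by rewrite -[in X in X * _](fineK Kfin) -EFinM divff// fine_eq0.
rewrite -[LHS]mule1 -[RHS]mule1 -KK !muleA; congr (_ * _).
have m1 : measurable_fun setT (fun z : (p.-tuple (measurableTypeR R)) * (p.-tuple
  (measurableTypeR R)) =>
    f (O *m cV_of_tuple z.1 + cV_of_tuple z.2)%R * B (cV_of_tuple z.2)).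
  apply: emeasurable_funM.
    apply: measurableT_comp => //; apply: measurable_addv.
      by apply: measurable_mulmxv; apply: measurableT_comp.
    by apply: measurableT_comp.
  by apply: measurableT_comp => //; apply: measurableT_comp.
have m2 : measurable_fun setT (fun z : (p.-tuple (measurableTypeR R)) * (p.-tuple
  (measurableTypeR R)) =>
    f (cV_of_tuple z.2) * B (- (cV_of_tuple z.1 + - (O^T *m cV_of_tuple z.2)))%R).
  apply: emeasurable_funM.
    by apply: measurableT_comp => //; apply: measurableT_comp.
  apply: measurableT_comp => //.
  have -> : (fun x : (p.-tuple (measurableTypeR R)) * (p.-tuple (measurableTypeR R)) =>
     - (cV_of_tuple x.1 - O^T *m cV_of_tuple x.2))%R =
     (fun x => O^T *m cV_of_tuple x.2 + (- 1%:M) *m cV_of_tuple x.1)%R.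
    by apply/funext => x; rewrite mulNmx mul1mx opprB.
  by apply: measurable_addv; apply: measurable_mulmxv; apply: measurableT_comp.
transitivity (\int[lam p]_s \int[lam p]_t (f (O *m cV_of_tuple t + cV_of_tuple s)%R * B
  (cV_of_tuple s))).
  rewrite -ge0_integralZr//; last 2 first.
  - by apply: measurableT_comp => //; apply: measurable_mulmxv.
  - exact: integral_ge0.
  transitivity (\int[lam p]_s \int[lam p]_t (f (O *m cV_of_tuple t)%R * B (cV_of_tuple s))).
    rewrite -(fubini_tonelli (fun z => f (O *m cV_of_tuple z.1)%R * B (cV_of_tuple z.2)))//=.
    - apply: eq_integral => t _; rewrite ge0_integralZl//.
      by apply: measurableT_comp.
    - apply: emeasurable_funM; last by apply: measurableT_comp => //; apply: measurableT_comp.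
      by apply: measurableT_comp => //; apply: measurable_mulmxv; apply: measurableT_comp.
    - by move=> z; rewrite mule_ge0.
  apply: eq_integral => s _.
  rewrite -(@ge0_integral_lebesgue_cV_shift p (O^T *m cV_of_tuple s)%R
    (fun x => f (O *m x)%R * B (cV_of_tuple s)))//.
  - by apply: eq_integral => t _; rewrite mulmxDr mulmxA OO' mul1mx.
  - apply: emeasurable_funM => //.
    by apply: measurableT_comp => //; apply: measurable_mulmxv.
  - by move=> z; rewrite mule_ge0.
transitivity (\int[lam p]_t \int[lam p]_s (f (cV_of_tuple s) * B (- (cV_of_tuple t + - (O^T *m
  cV_of_tuple s)))%R)).
  rewrite [LHS](_ : _ = \int[lam p]_t \int[lam p]_s
      (f (O *m cV_of_tuple t + cV_of_tuple s)%R * B (cV_of_tuple s))); last first.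
    apply/esym; apply: tonelli_swap; first exact: m1.
    by move=> t s; rewrite mule_ge0.
  apply: eq_integral => t _.
  rewrite -(@ge0_integral_lebesgue_cV_shift p (O *m cV_of_tuple t)%R
    (fun x => f x * B (- (cV_of_tuple t + - (O^T *m x)))%R)).
  - apply: eq_integral => s _; rewrite addrC; congr (_ * _).
    apply: BE; rewrite mulmxDr mulmxA OO mul1mx opprB addrK.
    by rewrite orthogonal_enorm// trmxK.
  - apply: emeasurable_funM => //; apply: measurableT_comp => //.
    have -> : (fun x => - (cV_of_tuple t - O^T *m x))%R =
     (fun x => O^T *m x + - cV_of_tuple t)%R by apply/funext => x; rewrite opprB.
    by apply: measurable_addv => //; apply: measurable_mulmxv.
  - by move=> z; rewrite mule_ge0.
rewrite tonelli_swap; [|exact: m2|by move=> t s; rewrite mule_ge0].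
rewrite -ge0_integralZr//; last 2 first.
- by apply: measurableT_comp.
- exact: integral_ge0.
apply: eq_integral => s _.
have mN : measurable_fun setT (fun x : 'cV[R]_p => - x)%R.
  rewrite (_ : (fun x => _) = (fun x => (- 1%:M) *m x)%R); first exact: measurable_mulmxv.
  by apply/funext => x; rewrite mulNmx mul1mx.
have mBN : measurable_fun setT (fun x : 'cV[R]_p => B (- x)%R) by apply: measurableT_comp.
transitivity (f (cV_of_tuple s) *
    \int[lam p]_t B (- (cV_of_tuple t + - (O^T *m cV_of_tuple s)))%R).
  apply: ge0_integralZl => [//||x _|]; [|exact: B0|exact: f0].
  apply: (measurableT_comp mBN).
  by apply: measurable_addv => //; exact: measurable_cst.
congr (_ * _); transitivity (\int[lam p]_t B (- cV_of_tuple t)%R).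
  apply: (ge0_integral_lebesgue_cV_shift (- (O^T *m cV_of_tuple s))%R mBN).
  by move=> x; exact: B0.
by apply: eq_integral => t _; apply: BE; rewrite enormN.
Qed.

End cV.

(** * Integration against a density *)

Section density.
Local Open Scope ereal_scope.
Context d (T : measurableType d) (R : realType).
Import HBNNSimple.

(** Simple functions and monotone convergence extend a density known on sets. It is applied to
    restricted measures, to [angular_measure] and to the standard normal law. *)
Lemma ge0_integral_density (mu nu : {measure set T -> \bar R}) (g : T -> R)
    (f : T -> \bar R) :
  measurable_fun setT g -> (forall x, 0 <= g x)%R ->
  (forall A, measurable A -> nu A = \int[mu]_(x in A) (g x)%:E) ->
  measurable_fun setT f -> (forall x, 0 <= f x) ->
  \int[nu]_x f x = \int[mu]_x (f x * (g x)%:E).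
Proof.
move=> mg g0 nuE mf f0.
have mEg : measurable_fun setT (EFin \o g) by exact/measurable_EFinP.
pose h := nnsfun_approx measurableT mf.
have hf x : (EFin \o h n) x @[n --> \oo] --> f x.
  by apply: cvg_nnsfun_approx.
have hnd x : {homo (fun n => (h n x)%:E) : n m / (n <= m)%N >-> n <= m}.
  by move=> a b ab; rewrite lee_fin; exact/lefP/nd_nnsfun_approx.
transitivity (lim (\int[nu]_x (h n x)%:E @[n --> \oo])).
  rewrite -monotone_convergence//; last 2 first.
  - by move=> n; exact/measurable_EFinP/measurable_funP.
  - by move=> n x _; rewrite lee_fin.
  by apply: eq_integral => x _; apply/esym/cvg_lim => //; exact: hf.
transitivity (lim (\int[mu]_x ((h n x)%:E * (g x)%:E) @[n --> \oo])); last first.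
  rewrite -monotone_convergence//; last 3 first.
  - move=> n; apply: emeasurable_funM => //.
    exact/measurable_EFinP/measurable_funP.
  - by move=> n x _; rewrite mule_ge0 ?lee_fin.
  - by move=> x _ a b ab; rewrite lee_wpmul2r ?lee_fin//; have := hnd x _ _ ab; rewrite lee_fin.
  apply: eq_integral => x _; apply/cvg_lim => //.
  by apply: cvgeZr => //; exact: hf.
congr (lim (_ @ \oo)); apply/funext => n.
rewrite integralT_nnsfun sintegralE.
transitivity (\int[mu]_x
   (\sum_(y \in range (h n)) (y * \1_(h n @^-1` [set y]) x)%:E * (g x)%:E)); last first.
  apply: eq_integral => t tE; rewrite -ge0_mule_fsuml; last first.
    by move=> y; rewrite nnfun_muleindic_ge0.
  by rewrite fsumEFin// -fimfunE.
rewrite ge0_integral_fsum//; last 2 first.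
- move=> y; apply: emeasurable_funM => //.
  by apply/measurable_EFinP; apply: measurable_funM => //; exact: measurable_indic.
- by move=> y x _; rewrite mule_ge0 ?nnfun_muleindic_ge0 ?lee_fin.
apply: eq_fsbigr => y; rewrite inE => -[x _ yE].
have y0 : (0 <= y)%R by rewrite -yE.
rewrite nuE//.
under [RHS]eq_integral do rewrite EFinM -muleA.
rewrite ge0_integralZl//; last 2 first.
- apply: emeasurable_funM => //.
  by apply/measurable_EFinP; exact: measurable_indic.
- by move=> t _; rewrite mule_ge0 ?lee_fin.
congr (_ * _); rewrite integral_mkcond; apply: eq_integral => t _.
by rewrite muleC epatch_indic.
Qed.

Lemma ge0_integral_mrestr (mu : {measure set T -> \bar R}) (D : set T)
    (mD : measurable D) (f : T -> \bar R) :
  measurable_fun setT f -> (forall x, 0 <= f x) ->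
  \int[mrestr mu mD]_x f x = \int[mu]_(x in D) f x.
Proof.
move=> mf f0; rewrite (@ge0_integral_density mu (mrestr mu mD) (\1_D : T -> R))//.
- by rewrite [RHS]integral_mkcond; apply: eq_integral => t _; rewrite epatch_indic.
- by move=> A mA; rewrite integral_indic// setIC.
Qed.

End density.

(** * The surface area measure: support, total mass, rotation invariance *)

Section surface.
Local Open Scope ereal_scope.
Context {R : realType} (p : nat).
Notation sigma := (@surface_area R p).

Lemma measurable_radial_proj : measurable_fun setT (@radial_proj R p).
Proof. exact: measurable_funPT. Qed.

Lemma ge0_integral_surface_area (f : 'cV[R]_p -> \bar R) :
  measurable_fun setT f -> (forall x, 0 <= f x) ->
  \int[sigma]_x f x =
    p%:R%:E * \int[@lebesgue_cV R p]_(x in @punctured_ball R p) f (radial_proj x).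
Proof.
move=> mf f0.
rewrite (@eq_measure_integral _ _ _ _ (mscale (NngNum (ler0n R p))
  (image_measure (mrestr (@lebesgue_cV R p) (@measurable_punctured_ball R p)) (@radial_proj R
    p))))//.
rewrite ge0_integral_mscale//= ge0_integral_image_measure//.
rewrite ge0_integral_mrestr//.
by apply: measurableT_comp => //; exact: measurable_radial_proj.
Qed.

Lemma enormZ (a : R) (x : 'cV[R]_p) : enorm (a *: x)%R = (`|a| * enorm x)%R.
Proof.
rewrite /enorm -sqrtr_sqr -sqrtrM ?sqr_ge0// !dotvE mulr_sumr; congr Num.sqrt.
by apply: eq_bigr => i _; rewrite !mxE; ring.
Qed.

(** Only an inequality, because the origin is included: with 0^-1 = 0, [radial_proj] maps 0 to 0. *)
Lemma enorm_radial_proj_le1 (x : 'cV[R]_p) : (enorm (radial_proj x) <= 1)%R.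
Proof.
rewrite /radial_proj enormZ ger0_norm ?invr_ge0 ?enorm_ge0//.
by have [->|/mulVf ->//] := eqVneq (enorm x) 0%R; rewrite mulr0 ler01.
Qed.

Lemma radial_proj_sphere (x : 'cV[R]_p) : sphere p x -> radial_proj x = x.
Proof. by rewrite /sphere/= /radial_proj => ->; rewrite invr1 scale1r. Qed.

Lemma sphere_radial_proj (x : 'cV[R]_p) : (0 < enorm x)%R -> sphere p (radial_proj x).
Proof.
move=> x0; rewrite /sphere/= /radial_proj enormZ ger0_norm ?invr_ge0 ?enorm_ge0//.
by rewrite mulVf// gt_eqF.
Qed.

Lemma measurable_sphere : measurable (@sphere R p).
Proof.
rewrite (_ : sphere p = @enorm R p @^-1` [set 1%R]); last by [].
by rewrite -[X in measurable X]setTI; exact: measurable_enorm.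
Qed.

(** In polar form the invariance comes from Lebesgue measure: an orthogonal map commutes with
    [radial_proj] and preserves the punctured ball. *)
Lemma surface_area_orthogonal (O : 'M[R]_p) (f : 'cV[R]_p -> \bar R) :
  (0 < p)%N -> (O^T *m O = 1%:M)%R -> measurable_fun setT f -> (forall x, 0 <= f x) ->
  \int[sigma]_x f (O *m x)%R = \int[sigma]_x f x.
Proof.
move=> p0 OO mf f0.
have mfO : measurable_fun setT (fun x => f (O *m x)%R).
  by apply: measurableT_comp => //; exact: measurable_mulmxv.
rewrite !ge0_integral_surface_area//; congr (_ * _).
rewrite [LHS]integral_mkcond [RHS]integral_mkcond.
rewrite -[RHS](ge0_integral_lebesgue_cV_orthogonal p0 OO); last 2 first.
- apply/(measurable_restrictT _ _).1; first exact: measurable_punctured_ball.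
  by apply/measurable_funTS/measurableT_comp => //; exact: measurable_radial_proj.
- by move=> x; exact: erestrict_ge0.
apply: eq_integral => x _; rewrite !patchE.
have -> : ((O *m x)%R \in @punctured_ball R p) = (x \in @punctured_ball R p).
  by apply/idP/idP; rewrite !inE/= /punctured_ball/= orthogonal_enorm.
case: ifP => // _; congr f.
by rewrite /radial_proj orthogonal_enorm// scalemxAr.
Qed.

(** Removing the origin from the ball is what makes this true: it is the only point that
    [radial_proj] does not send to the sphere. *)
Lemma surface_area_notin_sphere : sigma (~` sphere p) = 0.
Proof.
rewrite /surface_area (_ : _ `&` _ = set0) ?measure0 ?mule0//.
by apply/seteqP; split=> x //= -[h] /andP[x0 _]; apply: h; exact: sphere_radial_proj.
Qed.

Lemma surface_area_gt0 : (0 < p)%N -> 0 < sigma setT.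
Proof.
move=> p0; rewrite /surface_area preimage_setT setTI.
by apply: mule_gt0; [rewrite lte_fin ltr0n|exact: lebesgue_punctured_ball_gt0].
Qed.

Lemma surface_area_lty : sigma setT < +oo.
Proof.
rewrite /surface_area preimage_setT setTI lte_mul_pinfty ?lee_fin//.
apply: le_lt_trans (lebesgue_ball_lty p).
apply: le_measure; rewrite ?inE; [exact: measurable_punctured_ball|exact: measurable_unit_ball|].
by move=> x /= /andP[].
Qed.

End surface.

(** * Bounded random variables and i.i.d. samples *)

Section bounded_measurable.
Context d (T : measurableType d) (R : realType).
Implicit Types (h g : T -> R) (P : probability T R).

(** The bound holds at every point, not almost everywhere. Such functions form an algebra, are
    integrable for every probability and have bounded measurable partial integrals, so integrability
    conditions become closure properties. *)
Definition bmeas h := measurable_fun setT h /\ exists C : R, forall x, `|h x| <= C.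

Lemma bmeas_cst c : bmeas (fun=> c).
Proof. by split; [exact: measurable_cst|exists `|c|]. Qed.

Lemma bmeasD h g : bmeas h -> bmeas g -> bmeas (fun x => h x + g x).
Proof.
move=> [mh [C hC]] [mg [D gD]]; split; first exact: measurable_funD.
by exists (C + D) => x; rewrite (le_trans (ler_normD _ _))// lerD.
Qed.

Lemma bmeasM h g : bmeas h -> bmeas g -> bmeas (fun x => h x * g x).
Proof.
move=> [mh [C hC]] [mg [D gD]]; split; first exact: measurable_funM.
by exists (C * D) => x; rewrite normrM ler_pM.
Qed.

Lemma bmeasN h : bmeas h -> bmeas (fun x => - h x).
Proof.
move=> [mh [C hC]]; split; first exact: measurableT_comp.
by exists C => x; rewrite normrN.
Qed.

Lemma bmeasB h g : bmeas h -> bmeas g -> bmeas (fun x => h x - g x).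
Proof. by move=> bh bg; apply: bmeasD => //; exact: bmeasN. Qed.

Lemma bmeasX h n : bmeas h -> bmeas (fun x => h x ^+ n).
Proof.
move=> [mh [C hC]]; split; first exact: measurable_funX.
by exists (C ^+ n) => x; rewrite normrX lerXn2r// nnegrE// (le_trans _ (hC x)).
Qed.

Lemma bmeas_sum I (s : seq I) (h : I -> T -> R) :
  (forall i, bmeas (h i)) -> bmeas (fun x => \sum_(i <- s) h i x).
Proof.
move=> bh; elim: s => [|i s IHs].
  by under eq_fun do rewrite big_nil; exact: bmeas_cst.
by under eq_fun do rewrite big_cons; exact: bmeasD.
Qed.

Lemma bmeas_integrable P h : bmeas h -> P.-integrable setT (EFin \o h).
Proof.
move=> [mh [C hC]]; apply: measurable_bounded_integrable => //.
  by apply: (le_lt_trans (probability_le1 P measurableT)); exact: ltry.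
by exists C; split; [exact: num_real|move=> M CM x _; exact: (le_trans (hC x) (ltW CM))].
Qed.

Lemma EFin_Rintegral P h : bmeas h -> (\int[P]_x h x)%:E = (\int[P]_x (h x)%:E)%E.
Proof.
move=> bh; have ih := bmeas_integrable P bh; rewrite /Rintegral fineK//.
exact: integrable_fin_num.
Qed.

Lemma Rintegral_prob_cst P c : \int[P]_x c = c.
Proof. by rewrite Rintegral_cst// (congr1 fine (probability_setT P)) mulr1. Qed.

Lemma RintegralD_bm P h g : bmeas h -> bmeas g ->
  \int[P]_x (h x + g x) = \int[P]_x h x + \int[P]_x g x.
Proof. by move=> bh bg; rewrite RintegralD//; exact: bmeas_integrable. Qed.

Lemma RintegralB_bm P h g : bmeas h -> bmeas g ->
  \int[P]_x (h x - g x) = \int[P]_x h x - \int[P]_x g x.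
Proof. by move=> bh bg; rewrite RintegralB//; exact: bmeas_integrable. Qed.

Lemma RintegralZl_bm P h c : bmeas h ->
  \int[P]_x (c * h x) = c * \int[P]_x h x.
Proof. by move=> bh; rewrite RintegralZl//; exact: bmeas_integrable. Qed.

Lemma RintegralN_bm P h : bmeas h -> \int[P]_x (- h x) = - \int[P]_x h x.
Proof.
move=> bh; under eq_Rintegral do rewrite -mulN1r.
by rewrite RintegralZl_bm// mulN1r.
Qed.

Lemma Rintegral_sum_bm P I (s : seq I) (h : I -> T -> R) :
  (forall i, bmeas (h i)) ->
  \int[P]_x (\sum_(i <- s) h i x) = \sum_(i <- s) \int[P]_x h i x.
Proof.
move=> bh; elim: s => [|i s IHs].
  by under eq_Rintegral do rewrite big_nil; rewrite Rintegral_prob_cst big_nil.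
under eq_Rintegral do rewrite big_cons.
by rewrite RintegralD_bm// ?IHs ?big_cons//; exact: bmeas_sum.
Qed.

Lemma le_Rintegral_bm P h g : bmeas h -> bmeas g -> (forall x, h x <= g x) ->
  \int[P]_x h x <= \int[P]_x g x.
Proof. by move=> bh bg hg; apply: le_Rintegral => //; exact: bmeas_integrable. Qed.

Lemma addC_Rintegral P h c : bmeas h -> \int[P]_x h x + c = \int[P]_x (h x + c).
Proof.
by move=> bh; rewrite RintegralD_bm ?Rintegral_prob_cst//; exact: bmeas_cst.
Qed.

Lemma bmeas_norm h : bmeas h -> bmeas (fun x => `|h x|).
Proof.
move=> [mh [C hC]]; split; first exact: measurableT_comp.
by exists C => x; rewrite normr_id.
Qed.

Lemma le_norm_Rintegral_bm P h : bmeas h -> `|\int[P]_x h x| <= \int[P]_x `|h x|.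
Proof. by move=> bh; apply: le_normr_Rintegral => //; exact: bmeas_integrable. Qed.

Lemma norm_Rintegral_le P h C : bmeas h -> (forall x, `|h x| <= C) ->
  `|\int[P]_x h x| <= C.
Proof.
move=> bh hC; apply: (le_trans (le_norm_Rintegral_bm P bh)).
rewrite -[leRHS](Rintegral_prob_cst P C); apply: le_Rintegral_bm => //.
- exact: bmeas_norm.
- exact: bmeas_cst.
Qed.

Lemma chebyshev_bm P h e : bmeas h -> 0 < e ->
  (P [set x | e%:E <= `|(h x)%:E|] <= ((e ^+ 2)^-1 * \int[P]_x h x ^+ 2)%:E)%E.
Proof.
move=> bh e0; have e20 : 0 < e ^+ 2 by rewrite exprn_gt0.
rewrite EFinM lee_pdivlMl// EFin_Rintegral; last exact: bmeasX.
have := @le_integral_comp_abse _ _ _ P setT measurableT (EFin \o h) e (fun x => x * x)%E.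
rewrite setTI => /= /(_ _ _ _ _ e0) H; apply: (le_trans (H _ _ _ _)).
- exact: emeasurable_funM.
- by move=> r r0; rewrite mule_ge0.
- move=> x y; rewrite !inE/= !in_itv/= !andbT => x0 y0 xy.
  by rewrite lee_pmul.
- by apply/measurable_EFinP; exact: bh.1.
- rewrite le_eqVlt; apply/orP; left; apply/eqP; apply: eq_integral => x _.
  by rewrite -EFinM -expr2 real_normK// num_real.
Qed.

End bounded_measurable.

Lemma bmeas_comp d1 d2 (T1 : measurableType d1) (T2 : measurableType d2) (R : realType)
   (phi : T1 -> T2) (h : T2 -> R) :
  measurable_fun setT phi -> bmeas h -> bmeas (fun x => h (phi x)).
Proof.
move=> mphi [mh [C hC]]; split; first exact: measurableT_comp.
by exists C.
Qed.

Section fubini_bounded.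
Context d1 d2 (T1 : measurableType d1) (T2 : measurableType d2) (R : realType).

Lemma bmeas_section1 (h : T1 -> T2 -> R) : bmeas (fun z => h z.1 z.2) ->
  forall x, bmeas (h x).
Proof.
move=> bh x; apply: (bmeas_comp (phi := fun y => (x, y)) _ bh).
exact: measurable_pair1.
Qed.

Lemma bmeas_section2 (h : T1 -> T2 -> R) : bmeas (fun z => h z.1 z.2) ->
  forall y, bmeas (h ^~ y).
Proof.
move=> bh x; apply: (bmeas_comp (phi := fun y => (y, x)) _ bh).
exact: measurable_pair2.
Qed.

(** Adding the bound [C] makes the integrand nonnegative, so that Tonelli applies, and under a
    probability the added constant integrates to itself. The same device recurs below whenever a
    result for nonnegative functions is carried over to bounded ones. *)
Lemma bmeas_Rintegral (Q : probability T2 R) (h : T1 -> T2 -> R) : bmeas (fun z => h z.1 z.2) ->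
  bmeas (fun x => \int[Q]_y h x y).
Proof.
move=> bh; have bs := bmeas_section1 bh; have [mh [C hC]] := bh.
split; last first.
  exists C => x; apply: norm_Rintegral_le => // y; exact: (hC (x, y)).
have -> : (fun x => \int[Q]_y h x y) = (fun x => \int[Q]_y (h x y + C) - C).
  apply/funext => x; rewrite RintegralD_bm//; last exact: bmeas_cst.
  by rewrite Rintegral_prob_cst addrK.
apply: measurable_funB; last exact: measurable_cst.
apply/measurable_EFinP.
rewrite (_ : _ \o _ = fun x => (\int[Q]_y (h x y + C)%:E)%E); last first.
  by apply/funext => x /=; rewrite EFin_Rintegral//; apply: bmeasD => //; exact: bmeas_cst.
apply: (measurable_fun_fubini_tonelli_F (fun z => (h z.1 z.2 + C)%:E)).
  by apply/measurable_EFinP; apply: measurable_funD => //; exact: measurable_cst.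
by move=> z; rewrite lee_fin -lerBlDr sub0r; have := hC z; rewrite ler_norml => /andP[].
Qed.

End fubini_bounded.

Lemma Rintegral_swap d1 d2 (T1 : measurableType d1) (T2 : measurableType d2)
    (R : realType) (P : probability T1 R) (Q : probability T2 R) (h : T1 -> T2 ->
      R) : bmeas (fun z => h z.1 z.2) ->
  \int[P]_x (\int[Q]_y h x y) = \int[Q]_y (\int[P]_x h x y).
Proof.
move=> bh; have bs1 := bmeas_section1 bh; have bs2 := bmeas_section2 bh.
have [mh [C hC]] := bh.
have bC1 := bmeas_cst T1 C; have bC2 := bmeas_cst T2 C.
have bi1 := bmeas_Rintegral Q bh.
have bi2 : bmeas (fun y => \int[P]_x h x y).
  apply: (@bmeas_Rintegral _ _ T2 T1 _ P (fun y x => h x y)).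
  apply: (bmeas_comp (phi := fun z => (z.2, z.1)) _ bh).
  by apply/measurable_fun_pairP; split; [exact: measurable_snd|exact: measurable_fst].
apply: (@addIr _ C); apply: EFin_inj.
rewrite !addC_Rintegral// !EFin_Rintegral//; [|exact: bmeasD..].
transitivity (\int[P]_x \int[Q]_y (h x y + C)%:E)%E.
  apply: eq_integral => x _; rewrite -EFin_Rintegral; last exact: bmeasD.
  by rewrite RintegralD_bm// Rintegral_prob_cst.
rewrite tonelli_swap; last 2 first.
- by apply/measurable_EFinP; apply: measurable_funD => //; exact: measurable_cst.
- by move=> x y; rewrite lee_fin -lerBlDr sub0r; have := hC (x, y); rewrite ler_norml => /andP[].
apply: eq_integral => y _; rewrite -EFin_Rintegral; last exact: bmeasD.
by rewrite RintegralD_bm// Rintegral_prob_cst.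
Qed.

(** * Sums over an i.i.d. sample *)

Section iid_bounded.
Context d (T : measurableType d) (R : realType) (P : probability T R).

Lemma measurable_tuple_cons_pair n :
  measurable_fun setT (fun z : T * n.-tuple T => tuple_cons (z.1, z.2)).
Proof.
rewrite (_ : (fun _ => _) = @tuple_cons d T n); first exact: measurable_tuple_cons.
by apply/funext => -[].
Qed.

Lemma bmeas_tuple_cons n (h : n.+1.-tuple T -> R) : bmeas h ->
  bmeas (fun z => h (tuple_cons (z.1, z.2))).
Proof. by apply: bmeas_comp; exact: measurable_tuple_cons_pair. Qed.

Lemma Rintegral_iidS n (h : n.+1.-tuple T -> R) : bmeas h ->
  \int[iid_ P (n.+1)]_t h t =
  \int[P]_x (\int[iid_ P n]_t h (tuple_cons (x, t))).
Proof.
move=> bh; have [mh [C hC]] := bh.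
have bt := bmeas_tuple_cons bh.
have bs x : bmeas (fun t => h (tuple_cons (x, t)))
  by exact: (bmeas_section1 (h := fun x t => h (tuple_cons (x, t))) bt x).
have bi := bmeas_Rintegral (iid_ P n : probability _ R) (h := fun x t => h (tuple_cons (x, t))) bt.
have bC := bmeas_cst _ C.
apply: (@addIr _ C); apply: EFin_inj.
rewrite !addC_Rintegral// !EFin_Rintegral//; [|exact: bmeasD..].
rewrite [LHS](@ge0_integral_power_measureS _ T R P n (fun t => (h t + C)%:E)); last 2 first.
- by apply/measurable_EFinP; apply: measurable_funD => //; exact: measurable_cst.
- by move=> x; rewrite lee_fin -lerBlDr sub0r; have := hC x; rewrite ler_norml => /andP[].
apply: eq_integral => x _.
transitivity (\int[iid_ P n]_t (h (tuple_cons (x, t)) + C)%:E)%E; first by [].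
rewrite -EFin_Rintegral; last exact: bmeasD.
by rewrite RintegralD_bm// Rintegral_prob_cst.
Qed.

Lemma Rintegral_iid0 (h : 0.-tuple T -> R) : \int[iid_ P 0]_t h t = h [tuple].
Proof.
rewrite /Rintegral; transitivity (fine (\int[power_measure P 0]_t (h t)%:E)); first by [].
by rewrite integral_power_measure0.
Qed.

Lemma bmeas_tnth n (psi : T -> R) (i : 'I_n) : bmeas psi ->
  bmeas (fun t : n.-tuple T => psi (tnth t i)).
Proof. by apply: bmeas_comp; exact: measurable_tnth. Qed.

Lemma bmeas_sum_tnth n (psi : T -> R) : bmeas psi ->
  bmeas (fun t : n.-tuple T => \sum_(i < n) psi (tnth t i)).
Proof. by move=> bpsi; apply: bmeas_sum => i; exact: bmeas_tnth. Qed.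

Lemma sum_tuple_cons (V : nmodType) n (psi : T -> V) x (t : n.-tuple T) :
  \sum_(i < n.+1) psi (tnth (tuple_cons (x, t)) i) =
  psi x + \sum_(i < n) psi (tnth t i).
Proof.
rewrite big_ord_recl; congr (_ + _).
by apply: eq_bigr => i _; rewrite tnthS; congr (psi (tnth _ _)); apply/val_inj.
Qed.

Lemma Rintegral_iid_sum0 n (psi : T -> R) : bmeas psi -> \int[P]_x psi x = 0 ->
  \int[iid_ P n]_t (\sum_(i < n) psi (tnth t i)) = 0.
Proof.
move=> bpsi psi0; elim: n => [|n IHn].
  by rewrite Rintegral_iid0 big_ord0.
rewrite Rintegral_iidS; last exact: bmeas_sum_tnth.
under eq_Rintegral do under eq_Rintegral do rewrite sum_tuple_cons.
under eq_Rintegral.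
  move=> x _; rewrite RintegralD_bm; [|exact: bmeas_cst|exact: bmeas_sum_tnth].
  rewrite Rintegral_prob_cst IHn addr0; over.
by [].
Qed.

(** By induction: splitting off the first observation, the cross term vanishes because the sum over
    the remaining ones is centred. *)
Lemma Rintegral_iid_sum_sqr n (psi : T -> R) : bmeas psi -> \int[P]_x psi x = 0 ->
  \int[iid_ P n]_t (\sum_(i < n) psi (tnth t i)) ^+ 2 =
  n%:R * \int[P]_x psi x ^+ 2.
Proof.
move=> bpsi psi0; elim: n => [|n IHn].
  by rewrite Rintegral_iid0 big_ord0 expr0n mul0r.
have bS := @bmeas_sum_tnth n _ bpsi.
rewrite Rintegral_iidS; last exact/bmeasX/bmeas_sum_tnth.
under eq_Rintegral.
  move=> x _.
  under eq_Rintegral do rewrite sum_tuple_cons sqrrD -mulrnAl.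
  rewrite RintegralD_bm; [|apply: bmeasD; [exact: bmeas_cst|]|exact: bmeasX]; last first.
    by apply: bmeasM => //; exact: bmeas_cst.
  rewrite RintegralD_bm; [|exact: bmeas_cst|by apply: bmeasM => //; exact: bmeas_cst].
  rewrite Rintegral_prob_cst RintegralZl_bm// Rintegral_iid_sum0// mulr0 addr0 IHn.
  over.
rewrite RintegralD_bm; [|exact: bmeasX|exact: bmeas_cst].
by rewrite Rintegral_prob_cst -natr1 mulrDl mul1r addrC.
Qed.

Lemma chebyshev_iid n (psi : T -> R) e : bmeas psi -> \int[P]_x psi x = 0 -> 0 < e ->
  (iid_ P n [set t | e%:E <= `|(\sum_(i < n) psi (tnth t i))%:E|] <=
   ((e ^+ 2)^-1 * (n%:R * \int[P]_x psi x ^+ 2))%:E)%E.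
Proof.
move=> bpsi psi0 e0; rewrite -Rintegral_iid_sum_sqr//.
by apply: chebyshev_bm => //; exact: bmeas_sum_tnth.
Qed.

End iid_bounded.

(** * Rotationally symmetric laws and their likelihood ratios *)

Section dotv.
Context {R : realType} {p : nat}.
Implicit Types x y z : 'cV[R]_p.

Lemma dotvC x y : dotv x y = dotv y x.
Proof. by rewrite !dotvE; apply: eq_bigr => i _; rewrite mulrC. Qed.

Lemma dotvDl x y z : dotv (x + y) z = dotv x z + dotv y z.
Proof. by rewrite !dotvE -big_split; apply: eq_bigr => i _; rewrite mxE mulrDl. Qed.

Lemma dotvDr x y z : dotv z (x + y) = dotv z x + dotv z y.
Proof. by rewrite dotvC dotvDl ![dotv _ z]dotvC. Qed.

Lemma dotvZl a x y : dotv (a *: x) y = a * dotv x y.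
Proof. by rewrite !dotvE mulr_sumr; apply: eq_bigr => i _; rewrite mxE mulrA. Qed.

Lemma dotvZr a x y : dotv x (a *: y) = a * dotv x y.
Proof. by rewrite dotvC dotvZl dotvC. Qed.

Lemma dotvNl x y : dotv (- x) y = - dotv x y.
Proof. by rewrite -scaleN1r dotvZl mulN1r. Qed.

Lemma dotvNr x y : dotv x (- y) = - dotv x y.
Proof. by rewrite dotvC dotvNl dotvC. Qed.

Lemma dotvBl x y z : dotv (x - y) z = dotv x z - dotv y z.
Proof. by rewrite dotvDl dotvNl. Qed.

Lemma dotvBr x y z : dotv z (x - y) = dotv z x - dotv z y.
Proof. by rewrite dotvDr dotvNr. Qed.

Lemma dotv0l x : dotv 0 x = 0.
Proof. by rewrite -(scale0r 0) dotvZl mul0r. Qed.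

Lemma dotv0r x : dotv x 0 = 0.
Proof. by rewrite dotvC dotv0l. Qed.

Lemma dotv_suml n (F : 'I_n -> 'cV[R]_p) y :
  dotv (\sum_(i < n) F i) y = \sum_(i < n) dotv (F i) y.
Proof.
elim/big_ind2 : _ => //; first by rewrite dotv0l.
by move=> ? ? ? ? <- <-; rewrite dotvDl.
Qed.

Lemma dotv_mulmxl (A : 'M[R]_p) x y : dotv (A *m x) y = dotv x (A^T *m y).
Proof. by rewrite /dotv trmx_mul mulmxA. Qed.

Lemma dotv_eq0 x : (dotv x x == 0) = (x == 0).
Proof.
apply/eqP/eqP => [|->]; last by rewrite dotv0l.
rewrite dotvE => /psumr_eq0P H; apply/colP => i; rewrite mxE.
have /eqP : x i 0 * x i 0 = 0 by apply: H => // j _; rewrite -expr2 sqr_ge0.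
by rewrite -expr2 sqrf_eq0 => /eqP.
Qed.

Lemma cauchy_schwarz x y : `|dotv x y| <= enorm x * enorm y.
Proof.
have [y0|y0] := eqVneq y 0.
  by rewrite y0 dotv0r normr0 mulr_ge0 ?enorm_ge0.
have yy : 0 < dotv y y by rewrite lt0r dotv_eq0 y0 dotv_ge0.
rewrite -ler_sqr ?nnegrE ?mulr_ge0 ?enorm_ge0// exprMn !enorm_sqr.
rewrite real_normK ?num_real//.
have := dotv_ge0 (dotv y y *: x - dotv x y *: y).
rewrite !(dotvBl, dotvBr) !(dotvZl, dotvZr) (dotvC y x).
set a := dotv x x; set b := dotv y y; set c := dotv x y => H.
have : 0 <= b * (a * b - c ^+ 2) by move: H; congr (0 <= _); ring.
by rewrite pmulr_rge0// subr_ge0.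
Qed.

Lemma enorm1_dotv x : enorm x = 1 -> dotv x x = 1.
Proof. by rewrite -enorm_sqr => ->; rewrite expr1n. Qed.

Definition householder v : 'M[R]_p := 1%:M - (2 / dotv v v) *: (v *m v^T).

Lemma householder_mul v x : householder v *m x = x - (2 * dotv v x / dotv v v) *: v.
Proof.
rewrite /householder mulmxBl mul1mx -scalemxAl -mulmxA; congr (_ - _).
rewrite (mx11_scalar (v^T *m x)) mul_mx_scalar scalerA; congr (_ *: _).
by rewrite /dotv; ring.
Qed.

Lemma householder_orthogonal v : v != 0 -> (householder v)^T *m householder v = 1%:M.
Proof.
move=> v0; have vv : dotv v v != 0 by rewrite dotv_eq0.
have -> : (householder v)^T = householder v.
  by rewrite /householder linearB/= linearZ/= trmx1 trmx_mul trmxK.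
have NN : (v *m v^T) *m (v *m v^T) = dotv v v *: (v *m v^T).
  rewrite mulmxA -(mulmxA v) (mx11_scalar (v^T *m v)) mul_mx_scalar.
  by rewrite -scalemxAl.
rewrite /householder mulmxBl mul1mx mulmxBr mulmx1 -!scalemxAl -!scalemxAr NN.
rewrite !scalerA (_ : 2 / _ * _ * _ = 2 / dotv v v + 2 / dotv v v); last by field.
by rewrite scalerDl opprB addrK subrK.
Qed.

(** Two distinct unit vectors are exchanged by the reflection along their difference. This
    transitivity makes the total mass independent of theta and equalizes the second moments of the
    uniform law. *)
Lemma reflection_exists x y : enorm x = 1 -> enorm y = 1 ->
  exists O : 'M[R]_p, O^T *m O = 1%:M /\ O *m x = y.
Proof.
move=> x1 y1; have [<-|xy] := eqVneq x y.
  by exists 1%:M; rewrite trmx1 !mul1mx.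
have v0 : x - y != 0 by rewrite subr_eq0.
exists (householder (x - y)); split; first exact: householder_orthogonal.
rewrite householder_mul (_ : _ / _ = 1) ?scale1r ?subKr//.
have : dotv (x - y) (x - y) != 0 by rewrite dotv_eq0.
rewrite !(dotvBl, dotvBr) (dotvC y x) !enorm1_dotv// => H.
by rewrite [X in X / _](_ : _ = 1 - dotv x y - (dotv x y - 1)) ?divff//; ring.
Qed.

Lemma flip_exists x u : dotv u x = 0 -> u != 0 ->
  exists O : 'M[R]_p, [/\ O^T *m O = 1%:M, O *m x = x & O *m u = - u].
Proof.
move=> ux u0; exists (householder u); split; first exact: householder_orthogonal.
  by rewrite householder_mul ux mulr0 mul0r scale0r subr0.
rewrite householder_mul mulfK ?dotv_eq0// scaler_nat mulr2n.
by rewrite opprD addrA subrr add0r.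
Qed.

Lemma radial_proj_orthogonal (O : 'M[R]_p) x : O^T *m O = 1%:M ->
  radial_proj (O *m x) = O *m radial_proj x.
Proof. by move=> OO; rewrite /radial_proj orthogonal_enorm// scalemxAr. Qed.

Lemma dotv_radial_proj_le x u : `|dotv (radial_proj x) u| <= enorm u.
Proof.
apply: (le_trans (cauchy_schwarz _ _)).
by rewrite ler_piMl ?enorm_ge0// enorm_radial_proj_le1.
Qed.

Lemma bmeas_dotv_radial_proj u : bmeas (fun x : 'cV[R]_p => dotv (radial_proj x) u).
Proof.
split; last by exists (enorm u) => x; exact: dotv_radial_proj_le.
exact: (measurableT_comp (measurable_dotv u) (@measurable_radial_proj R p)).
Qed.

End dotv.

Section rotsym.
Context {R : realType} (p : nat) (p_gt0 : (0 < p)%N) (f : angular_function R).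
Variables (kappa : R) (kappa_ge0 : 0 <= kappa) (f_gt0 : 0 < f (- kappa)).
Notation V := 'cV[R]_p.
Notation sigma := (@surface_area R p).
Implicit Types theta : V.

(* [radial_proj] is the identity on the sphere, which carries the law; composing
   with it makes the density bounded and bounded away from 0 on all of R^p. *)
Definition angular_weight theta (x : V) : R := f (kappa * dotv (radial_proj x) theta).

Lemma measurable_angular theta : measurable_fun setT (fun x : V => f (kappa * dotv x theta)).
Proof.
apply: measurableT_comp.
  by apply: nondecreasing_measurable => //; exact: angular_fun_homo.
by apply: measurable_funM; [exact: measurable_cst|exact: measurable_dotv].
Qed.

Lemma kappa_dotv_radial_proj theta x : enorm theta = 1 ->
  - kappa <= kappa * dotv (radial_proj x) theta <= kappa.
Proof.
move=> t1; have := dotv_radial_proj_le x theta; rewrite t1 ler_norml => /andP[h1 h2].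
by apply/andP; split; rewrite ?ler_piMr// -mulrN1 ler_wpM2l.
Qed.

(** Monotonicity of f reduces positivity on [- kappa, kappa] to the value at the left end point. *)
Lemma angular_weight_gt0 theta x : enorm theta = 1 -> 0 < angular_weight theta x.
Proof.
move=> t1; have /andP[h1 h2] := kappa_dotv_radial_proj x t1.
by apply: (lt_le_trans f_gt0); exact: angular_fun_homo.
Qed.

Lemma angular_weight_le theta x : enorm theta = 1 -> angular_weight theta x <= f kappa.
Proof.
move=> t1; have /andP[h1 h2] := kappa_dotv_radial_proj x t1.
exact: angular_fun_homo.
Qed.

Lemma bmeas_angular_weight theta : enorm theta = 1 -> bmeas (angular_weight theta).
Proof.
move=> t1; split.
  exact: (measurableT_comp (measurable_angular theta) (@measurable_radial_proj R p)).
by exists (f kappa) => x; rewrite ger0_norm ?angular_weight_le// ltW ?angular_weight_gt0.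
Qed.

(** The integrand is given two arguments so that [radial_proj] can be inserted in chosen occurrences
    of the variable only: in the weight, but not in the function integrated against it. *)
Lemma ae_eq_surface_area_radial_proj (h : V -> V -> \bar R) :
  (forall x, 0 <= h x x)%E -> (forall x, 0 <= h x (radial_proj x))%E ->
  measurable_fun setT (fun x => h x x) ->
  measurable_fun setT (fun x => h x (radial_proj x)) ->
  (\int[sigma]_x h x x = \int[sigma]_x h x (radial_proj x))%E.
Proof.
move=> h0 h0' mh mh'; apply: ge0_ae_eq_integral => //.
exists (~` sphere p); split.
- by apply: measurableC; exact: measurable_sphere.
- exact: surface_area_notin_sphere.
- move=> x /= H xs; apply: H => _; by rewrite radial_proj_sphere.
Qed.

Definition angular_mass theta : R := fine (angular_measure theta kappa f setT).

Lemma angular_massE theta : angular_measure theta kappa f setT =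
  (\int[sigma]_x (angular_weight theta x)%:E)%E.
Proof.
apply: (ae_eq_surface_area_radial_proj (h := fun _ x => (f (kappa * dotv x theta))%:E)).
- by move=> x; rewrite lee_fin angular_fun_ge0.
- by move=> x; rewrite lee_fin angular_fun_ge0.
- by apply/measurable_EFinP; exact: measurable_angular.
- apply/measurable_EFinP.
  exact: (measurableT_comp (measurable_angular theta) (@measurable_radial_proj R p)).
Qed.

Lemma angular_mass_fin theta : enorm theta = 1 ->
  (0 < angular_measure theta kappa f setT < +oo)%E.
Proof.
move=> t1; have [mw _] := bmeas_angular_weight t1.
have mEw : measurable_fun setT (EFin \o angular_weight theta) by exact/measurable_EFinP.
rewrite angular_massE; apply/andP; split.
  apply: (@lt_le_trans _ _ (\int[sigma]_x (f (- kappa))%:E)%E).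
    rewrite integral_cst//; apply: mule_gt0; first by rewrite lte_fin.
    exact: surface_area_gt0.
  apply: ge0_le_integral => //.
  - by move=> x _; rewrite lee_fin ltW.
  - move=> x _; rewrite lee_fin.
    by have /andP[h1 h2] := kappa_dotv_radial_proj x t1; exact: angular_fun_homo.
apply: (@le_lt_trans _ _ (\int[sigma]_x (f kappa)%:E)%E).
  apply: ge0_le_integral => //.
  - by move=> x _; rewrite lee_fin ltW// angular_weight_gt0.
  - by move=> x _; rewrite lee_fin angular_weight_le.
rewrite integral_cst// lte_mul_pinfty ?lee_fin ?angular_fun_ge0//.
exact: surface_area_lty.
Qed.

Lemma angular_mass_gt0 theta : enorm theta = 1 -> 0 < angular_mass theta.
Proof. by move=> t1; apply: fine_gt0; exact: angular_mass_fin. Qed.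

Lemma ge0_integral_rotsym_law theta (h : V -> \bar R) : enorm theta = 1 ->
  measurable_fun setT h -> (forall x, 0 <= h x)%E ->
  (\int[rotsym_law theta kappa f]_x h x =
   (angular_mass theta)^-1%:E * \int[sigma]_x (h x * (angular_weight theta x)%:E))%E.
Proof.
move=> t1 mh h0; have /andP[m0 moo] := angular_mass_fin t1.
have c0 : 0 <= (angular_mass theta)^-1 by rewrite invr_ge0 ltW// angular_mass_gt0.
rewrite (@eq_measure_integral _ _ _ _ (mscale (NngNum c0) (angular_measure theta kappa f)));
  last first.
  move=> A mA _; rewrite /rotsym_law /mnormalize/= /mnormalize.
  (* The mass is positive and finite, so [mnormalize] does not fall back on the point mass. *)
  rewrite ifF; last by apply/negbTE; rewrite negb_or gt_eqF//= lt_eqF.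
  by rewrite muleC.
rewrite ge0_integral_mscale//=; congr (_ * _)%E.
rewrite (@ge0_integral_density _ _ _ sigma (angular_measure theta kappa f)
  (fun x => f (kappa * dotv x theta)))//.
- apply: (ae_eq_surface_area_radial_proj (h := fun x y => (h x * (f (kappa * dotv y theta))%:E)%E)).
  + by move=> x; rewrite mule_ge0// lee_fin angular_fun_ge0.
  + by move=> x; rewrite mule_ge0// lee_fin angular_fun_ge0.
  + by apply: emeasurable_funM => //; apply/measurable_EFinP; exact: measurable_angular.
  + apply: emeasurable_funM => //; apply/measurable_EFinP.
    exact: (measurableT_comp (measurable_angular theta) (@measurable_radial_proj R p)).
- exact: measurable_angular.
- by move=> x; rewrite angular_fun_ge0.
Qed.

Lemma rotsym_law_notin_sphere theta : enorm theta = 1 ->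
  rotsym_law theta kappa f (~` sphere p) = 0%E.
Proof.
move=> t1; have /andP[m0 moo] := angular_mass_fin t1.
rewrite /rotsym_law /mnormalize/= /mnormalize.
rewrite ifF; last by apply/negbTE; rewrite negb_or gt_eqF//= lt_eqF.
apply/eqP; rewrite mule_eq0; apply/orP; left; apply/eqP.
apply: null_set_integral => //.
- by apply: measurableC; exact: measurable_sphere.
- by apply: measurable_funTS; apply/measurable_EFinP; exact: measurable_angular.
- exact: surface_area_notin_sphere.
Qed.

Lemma angular_weight_orthogonal (O : 'M[R]_p) theta x : O^T *m O = 1%:M ->
  angular_weight (O *m theta) (O *m x) = angular_weight theta x.
Proof.
by move=> OO; rewrite /angular_weight radial_proj_orthogonal// orthogonal_dotv.
Qed.

Lemma angular_mass_indep theta theta' : enorm theta = 1 -> enorm theta' = 1 ->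
  angular_mass theta' = angular_mass theta.
Proof.
move=> t1 t1'; have [A [OO At]] := reflection_exists t1 t1'; rewrite -At.
rewrite /angular_mass !angular_massE; congr fine.
rewrite -(surface_area_orthogonal p_gt0 OO); last 2 first.
- by apply/measurable_EFinP; exact: (bmeas_angular_weight (etrans (orthogonal_enorm _ OO) t1)).1.
- move=> x; rewrite lee_fin ltW// angular_weight_gt0//.
  by rewrite orthogonal_enorm.
by apply: eq_integral => x _; rewrite angular_weight_orthogonal.
Qed.

Lemma ge0_integral_rotsym_orthogonal theta (O : 'M[R]_p) (h : V -> \bar R) :
  enorm theta = 1 -> O^T *m O = 1%:M -> O *m theta = theta ->
  measurable_fun setT h -> (forall x, 0 <= h x)%E ->
  (\int[rotsym_law theta kappa f]_x h (O *m x)%R =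
   \int[rotsym_law theta kappa f]_x h x)%E.
Proof.
move=> t1 OO Ot mh h0; have mw := (bmeas_angular_weight t1).1.
rewrite !ge0_integral_rotsym_law//; last first.
  by apply: measurableT_comp => //; exact: measurable_mulmxv.
congr (_ * _)%E.
rewrite -[RHS](surface_area_orthogonal p_gt0 OO); last 2 first.
- by apply: emeasurable_funM => //; exact/measurable_EFinP.
- by move=> x; rewrite mule_ge0// lee_fin ltW// angular_weight_gt0.
by apply: eq_integral => x _; rewrite -[in RHS]Ot angular_weight_orthogonal.
Qed.

Definition angular_ratio theta' theta x : R :=
  angular_weight theta' x / angular_weight theta x.

Lemma angular_ratio_gt0 theta' theta x : enorm theta' = 1 -> enorm theta = 1 ->
  0 < angular_ratio theta' theta x.
Proof. by move=> *; rewrite divr_gt0// angular_weight_gt0. Qed.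

Lemma measurable_angular_ratio theta' theta : enorm theta' = 1 -> enorm theta = 1 ->
  measurable_fun setT (angular_ratio theta' theta).
Proof.
move=> t1' t1; rewrite /angular_ratio.
rewrite (_ : (fun _ => _) = fun x => angular_weight theta' x * angular_weight theta x `^ (-1));
  last first.
  by apply/funext => x; rewrite powR_inv1// ltW// angular_weight_gt0.
apply: measurable_funM; first exact: (bmeas_angular_weight t1').1.
exact: (measurableT_comp (measurable_powR _) (bmeas_angular_weight t1).1).
Qed.

Lemma ge0_integral_angular_ratio theta' theta (h : V -> \bar R) :
  enorm theta' = 1 -> enorm theta = 1 ->
  measurable_fun setT h -> (forall x, 0 <= h x)%E ->
  (\int[rotsym_law theta' kappa f]_x h x =
   \int[rotsym_law theta kappa f]_x (h x * (angular_ratio theta' theta x)%:E))%E.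
Proof.
move=> t1' t1 mh h0.
have mr : measurable_fun setT (EFin \o angular_ratio theta' theta).
  by apply/measurable_EFinP; exact: measurable_angular_ratio.
rewrite !ge0_integral_rotsym_law//; last 2 first.
- exact: emeasurable_funM.
- by move=> x; rewrite mule_ge0// lee_fin ltW// angular_ratio_gt0.
rewrite (angular_mass_indep t1 t1'); congr (_ * _)%E.
apply: eq_integral => x _; rewrite -muleA -EFinM; congr (_ * _%:E)%E.
by rewrite /angular_ratio divfK// gt_eqF// angular_weight_gt0.
Qed.

End rotsym.

(** * Product densities and the Radon-Nikodym derivative *)

Section iid_density.
Local Open Scope ereal_scope.
Context d (T : measurableType d) (R : realType) (P Q : probability T R) (r : T -> R).
Hypotheses (mr : measurable_fun setT r) (r0 : forall x, (0 <= r x)%R).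
Hypothesis QE : forall h : T -> \bar R, measurable_fun setT h -> (forall x, 0 <= h x) ->
  \int[Q]_x h x = \int[P]_x (h x * (r x)%:E).

Lemma measurable_prod_tnth n : measurable_fun setT
  (fun t : n.-tuple T => (\prod_(i < n) r (tnth t i))%R).
Proof.
apply: measurable_prod => i _.
by apply: (measurableT_comp mr); exact: measurable_tnth.
Qed.

Lemma prod_tnth_ge0 n (t : n.-tuple T) : (0 <= \prod_(i < n) r (tnth t i))%R.
Proof. by apply: prodr_ge0. Qed.

Lemma ge0_integral_iid_density n (h : n.-tuple T -> \bar R) :
  measurable_fun setT h -> (forall x, 0 <= h x) ->
  \int[iid_ Q n]_t h t = \int[iid_ P n]_t (h t * (\prod_(i < n) r (tnth t i))%:E).
Proof.
elim: n h => [|n IHn] h mh h0.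
  rewrite [LHS](integral_power_measure0 Q) [RHS](integral_power_measure0 P).
  by rewrite big_ord0 mule1.
have mr' : measurable_fun setT (EFin \o r) by exact/measurable_EFinP.
have mhc : measurable_fun setT (fun z => h (tuple_cons (z.1, z.2))).
  by apply: measurableT_comp => //; exact: measurable_tuple_cons_pair.
have mhx x : measurable_fun setT (fun t => h (tuple_cons (x, t))).
  exact: (measurableT_comp mhc (measurable_pair1 x)).
have mp m : measurable_fun setT (fun t : m.-tuple T => (\prod_(i < m) r (tnth t i))%:E).
  by apply/measurable_EFinP; exact: measurable_prod_tnth.
rewrite [LHS](ge0_integral_power_measureS Q mh h0).
rewrite [RHS](ge0_integral_power_measureS P); last 2 first.
- by apply: emeasurable_funM => //; exact: mp.
- by move=> t; rewrite mule_ge0// lee_fin prod_tnth_ge0.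
rewrite QE; last 2 first.
- exact: (measurable_fun_fubini_tonelli_F (fun z => h (tuple_cons (z.1, z.2)))).
- by move=> x; exact: integral_ge0.
apply: eq_integral => x _.
rewrite [X in X * _](IHn (fun t => h (tuple_cons (x, t))))//.
rewrite -ge0_integralZr//; last 3 first.
- by apply: emeasurable_funM => //; exact: mp.
- by move=> t _; rewrite mule_ge0// lee_fin prod_tnth_ge0.
- by rewrite lee_fin.
apply: eq_integral => t _; rewrite -muleA -EFinM; congr (_ * _%:E).
rewrite mulrC [RHS]big_ord_recl; congr (_ * _)%R.
by apply: eq_bigr => i _; rewrite tnthS; congr (r (tnth _ _)); apply/val_inj.
Qed.

End iid_density.

Lemma iid_ae_forall d (T : measurableType d) (R : realType) (P : probability T R) n
    (A : set T) : measurable A -> P A = 1%E ->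
  iid_ P n [set t | forall i, A (tnth t i)] = 1%E.
Proof.
move=> mA PA; rewrite [LHS](power_measure_box P n mA).
by rewrite (eq_bigr (fun=> 1%E)) ?big1_eq// => i _; exact: PA.
Qed.

Section loglik.
Local Open Scope charge_scope.
Context {R : realType} (p : nat) (p_gt0 : (0 < p)%N) (f : angular_function R).
Variables (kappa : R) (kappa_ge0 : 0 <= kappa) (f_gt0 : 0 < f (- kappa)).
Notation V := 'cV[R]_p.
Implicit Types theta : V.

Lemma rotsym_law_sphere theta : enorm theta = 1 ->
  rotsym_law theta kappa f (sphere p) = 1%E.
Proof.
move=> t1; have mS := @measurable_sphere R p.
have := rotsym_law_notin_sphere p_gt0 kappa_ge0 f_gt0 t1.
rewrite probability_setC// => /eqP; rewrite sube_eq//.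
by rewrite add0e => /eqP <-.
Qed.

Definition all_on_sphere n : set (n.-tuple V) := [set t | forall i, sphere p (tnth t i)].

Lemma measurable_all_on_sphere n : measurable (@all_on_sphere n).
Proof. by apply: (@measurable_box _ V n (sphere p)); exact: measurable_sphere. Qed.

Lemma joint_law_all_on_sphere n theta : enorm theta = 1 ->
  joint_law kappa f n theta (@all_on_sphere n) = 1%E.
Proof.
by move=> t1; apply: iid_ae_forall; [exact: measurable_sphere|exact: rotsym_law_sphere].
Qed.

Lemma joint_law_density n theta' theta (h : n.-tuple V -> \bar R) :
  enorm theta' = 1 -> enorm theta = 1 ->
  measurable_fun setT h -> (forall x, 0 <= h x)%E ->
  (\int[joint_law kappa f n theta']_t h t = \int[joint_law kappa f n theta]_t
    (h t * (\prod_(i < n) angular_ratio f kappa theta' theta (tnth t i))%:E))%E.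
Proof.
move=> t1' t1 mh h0.
have mr := measurable_angular_ratio kappa_ge0 f_gt0 t1' t1.
have r0 x : 0 <= angular_ratio f kappa theta' theta x by rewrite ltW// angular_ratio_gt0.
have E g : measurable_fun setT g -> (forall x, 0 <= g x)%E ->
    (\int[rotsym_law theta' kappa f]_x g x = \int[rotsym_law theta kappa f]_x
      (g x * (angular_ratio f kappa theta' theta x)%:E))%E.
  by move=> mg g0; exact: ge0_integral_angular_ratio.
exact: (ge0_integral_iid_density mr r0 E mh h0).
Qed.

Lemma joint_law_density_set n theta' theta (A : set (n.-tuple V)) :
  enorm theta' = 1 -> enorm theta = 1 -> measurable A ->
  (joint_law kappa f n theta' A = \int[joint_law kappa f n theta]_(t in A)
    (\prod_(i < n) angular_ratio f kappa theta' theta (tnth t i))%:E)%E.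
Proof.
move=> t1' t1 mA; set P := joint_law kappa f n theta; set Q := joint_law kappa f n theta'.
transitivity (\int[Q]_x (\1_A x)%:E)%E; first by rewrite integral_indic// setIT.
rewrite (joint_law_density t1' t1); [|by apply/measurable_EFinP; exact: measurable_indic|by []].
rewrite [RHS]integral_mkcond; apply: eq_integral => t _.
by rewrite epatch_indic muleC.
Qed.

Lemma measurable_prod_angular_ratio n theta' theta : enorm theta' = 1 -> enorm theta = 1 ->
  measurable_fun setT (fun t : n.-tuple V =>
    (\prod_(i < n) angular_ratio f kappa theta' theta (tnth t i))%:E).
Proof.
move=> t1' t1; apply/measurable_EFinP; apply: measurable_prod_tnth.
exact: measurable_angular_ratio.
Qed.

Lemma joint_law_dominates n theta' theta : enorm theta' = 1 -> enorm theta = 1 ->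
  joint_law kappa f n theta' `<< joint_law kappa f n theta.
Proof.
move=> t1' t1; apply/null_content_dominatesP => A mA PA; rewrite (joint_law_density_set t1' t1 mA).
apply: null_set_integral => //; apply: measurable_funTS.
exact: measurable_prod_angular_ratio.
Qed.

(** The library derivative is known only up to null sets. It is identified with the product of the
    ratios because both have the same integral over every measurable set; positivity of the ratios
    then turns the logarithm of the product into a finite sum. *)
Lemma ae_loglik_ratio n theta' theta : enorm theta' = 1 -> enorm theta = 1 ->
  {ae joint_law kappa f n theta, forall x, loglik_ratio kappa f theta' theta x =
    (\sum_(i < n) ln (angular_ratio f kappa theta' theta (tnth x i)))%:E}.
Proof.
move=> t1' t1.
set P := joint_law kappa f n theta; set Q := joint_law kappa f n theta'.
pose r := angular_ratio f kappa theta' theta.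
pose pr (t : n.-tuple V) : R := \prod_(i < n) r (tnth t i).
have r0 x : 0 < r x by exact: angular_ratio_gt0.
have mpr : measurable_fun setT (EFin \o pr) by exact: measurable_prod_angular_ratio.
have pr0 t : (0 <= (pr t)%:E)%E by rewrite lee_fin prodr_ge0// => i _; exact/ltW.
have dom : Q `<< P by exact: joint_law_dominates.
have H : ae_eq P setT ('d (charge_of_finite_measure Q) '/d P) (EFin \o pr).
  apply: integral_ae_eq => //.
    exact: Radon_Nikodym_integrable.
  move=> E _ mE; rewrite -Radon_Nikodym_integral//; exact: joint_law_density_set.
apply: filterS H => t /= /(_ I) H.
rewrite /loglik_ratio H lne_EFin; last by apply: prodr_gt0 => i _; exact: r0.
congr EFin; rewrite /pr.
suff [] : 0 < \prod_(i < n) r (tnth t i) /\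
  ln (\prod_(i < n) r (tnth t i)) = \sum_(i < n) ln (r (tnth t i)) by [].
elim/big_rec2 : _ => [|i y1 y2 _ [y20 <-]]; first by rewrite ln1.
by rewrite mulr_gt0// lnM ?posrE.
Qed.

Lemma measurable_loglik_ratio n theta' theta : enorm theta' = 1 -> enorm theta = 1 ->
  measurable_fun setT (@loglik_ratio R p kappa f n theta' theta).
Proof.
move=> t1' t1; have dom := @joint_law_dominates n _ _ t1' t1.
pose g := 'd (charge_of_finite_measure (joint_law kappa f n theta')) '/d (joint_law kappa f n
  theta).
have ig : (joint_law kappa f n theta).-integrable setT g by apply: Radon_Nikodym_integrable.
have mg : measurable_fun setT g by exact: (measurable_int _ ig).
have mfg : measurable_fun setT (fine \o g).
  apply/measurable_EFinP; rewrite (_ : EFin \o (fine \o g) = g)//.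
  by apply/funext => x /=; rewrite fineK//; exact: Radon_Nikodym_fin_num.
(* The derivative is finite everywhere but is known to be positive only almost everywhere, so the
   branch at -oo has to be kept. *)
rewrite (_ : loglik_ratio _ _ _ _ = fun x =>
    if fine (g x) <= 0 then -oo%E else (ln (fine (g x)))%:E); last first.
  apply/funext => x; rewrite /loglik_ratio -/g -[in LHS](fineK (x := g x))//.
  exact: Radon_Nikodym_fin_num.
apply: measurable_fun_ifT; last 2 first.
- exact: measurable_cst.
- by apply/measurable_EFinP; exact: (measurableT_comp (@measurable_ln R) mfg).
- by apply: measurable_fun_ler => //; exact: measurable_cst.
Qed.

End loglik.

Section bounded_change_of_law.
Context d (T : measurableType d) (R : realType) (Q : probability T R).

(** One interface for changes of variable (g = 1) and changes of density (phi = id): an identity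
    proved for nonnegative functions passes to bounded signed ones. *)
Lemma bmeas_ge0_integral_transfer d' (T' : measurableType d') (P' : probability T' R)
   (phi : T' -> T) (g : T' -> R) (h : T -> R) :
  measurable_fun setT phi -> bmeas g -> (forall x, 0 <= g x) ->
  (forall h : T -> \bar R, measurable_fun setT h -> (forall x, 0 <= h x)%E ->
    (\int[Q]_x h x = \int[P']_x (h (phi x) * (g x)%:E))%E) ->
  bmeas h -> \int[Q]_x h x = \int[P']_x (h (phi x) * g x).
Proof.
move=> mphi bg g0 QE bh; have [mh [C hC]] := bh.
have bhp := bmeas_comp mphi bh.
have bhg := bmeasM bhp bg.
(* The hypothesis at the constant 1 says that g has integral 1, so adding [C] to h shifts both sides
   by the same amount. *)
have Cg : \int[P']_x (C * g x) = C.
  have : (\int[Q]_x (1 : R))%R = 1 by rewrite Rintegral_prob_cst.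
  rewrite {1}/Rintegral QE// => H.
  rewrite RintegralZl_bm// (_ : \int[P']_x g x = 1) ?mulr1// -[RHS]H.
  by congr fine; apply: eq_integral => x _; exact/esym/mul1e.
apply: (@addIr _ C); rewrite -[X in _ = _ + X]Cg -RintegralD_bm//; last first.
  by apply: bmeasM => //; exact: bmeas_cst.
rewrite addC_Rintegral//; apply: EFin_inj; rewrite !EFin_Rintegral; last 2 first.
- by apply: bmeasD => //; apply: bmeasM => //; exact: bmeas_cst.
- by apply: bmeasD => //; exact: bmeas_cst.
rewrite QE.
- by apply: eq_integral => x _; rewrite -EFinM mulrDl.
- by apply/measurable_EFinP; apply: measurable_funD => //; exact: measurable_cst.
- by move=> x; rewrite lee_fin -lerBlDr sub0r; have := hC x; rewrite ler_norml => /andP[].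
Qed.

End bounded_change_of_law.

(** * First and second moments of the rotationally symmetric laws *)

Section rotsym_moments.
Context {R : realType} (p : nat) (p_gt0 : (0 < p)%N) (f : angular_function R).
Hypothesis f0 : f 0 = 1.
Variables (kappa : R) (kappa_ge0 : 0 <= kappa) (f_gt0 : 0 < f (- kappa)).
Notation V := 'cV[R]_p.
Variables (theta : V) (theta1 : enorm theta = 1).
Notation P := (rotsym_law theta kappa f).
Notation U := (rotsym_law theta 0 f).
Notation w := (angular_weight f kappa theta).

Let f0_gt0 : 0 < f (- 0).
Proof. by rewrite oppr0 f0. Qed.

Let w0 x : angular_weight f 0 theta x = 1.
Proof. by rewrite /angular_weight mul0r. Qed.

Lemma Rintegral_rotsym_orthogonal (A : 'M[R]_p) (h : V -> R) :
  A^T *m A = 1%:M -> A *m theta = theta -> bmeas h ->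
  \int[P]_x h (A *m x) = \int[P]_x h x.
Proof.
move=> AA At bh; have b1 := @bmeas_cst _ V R 1.
have mA : measurable_fun setT (fun x : V => A *m x) by exact: measurable_mulmxv.
have -> : \int[P]_x h (A *m x) = \int[P]_x (h (A *m x) * 1).
  by apply: eq_Rintegral => x _; rewrite mulr1.
apply/esym; apply: (bmeas_ge0_integral_transfer mA b1 _ _ bh) => // g mg g0.
rewrite -(ge0_integral_rotsym_orthogonal p_gt0 kappa_ge0 f_gt0 theta1 AA At)//.
by apply: eq_integral => x _; rewrite mule1.
Qed.

Lemma Rintegral_uniform_orthogonal (A : 'M[R]_p) (h : V -> R) :
  A^T *m A = 1%:M -> bmeas h ->
  \int[U]_x h (A *m x) = \int[U]_x h x.
Proof.
move=> AA bh; have b1 := @bmeas_cst _ V R 1.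
have mA : measurable_fun setT (fun x : V => A *m x) by exact: measurable_mulmxv.
have -> : \int[U]_x h (A *m x) = \int[U]_x (h (A *m x) * 1).
  by apply: eq_Rintegral => x _; rewrite mulr1.
apply/esym; apply: (bmeas_ge0_integral_transfer mA b1 _ _ bh) => // g mg g0.
under [RHS]eq_integral do rewrite mule1.
rewrite !ge0_integral_rotsym_law//; last by apply: measurableT_comp.
congr (_ * _)%E.
under eq_integral do rewrite w0 mule1.
under [RHS]eq_integral do rewrite w0 mule1.
by rewrite (surface_area_orthogonal p_gt0 AA).
Qed.

(** Bayes' formula, written without a quotient. [U] is the uniform law on the sphere: at kappa = 0
    the weight is f(0) = 1. *)
Lemma Rintegral_rotsym_uniform (h : V -> R) : bmeas h ->
  \int[P]_x h x * \int[U]_x w x = \int[U]_x (h x * w x).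
Proof.
have bw := bmeas_angular_weight kappa_ge0 f_gt0 theta1.
pose c := angular_mass f 0 theta / angular_mass f kappa theta.
have m0 : 0 < angular_mass f 0 theta by exact: angular_mass_gt0.
have m1 : 0 < angular_mass f kappa theta by exact: angular_mass_gt0.
have c0 : 0 < c by rewrite divr_gt0.
have H g : bmeas g -> \int[P]_x g x = c * \int[U]_x (g x * w x).
  move=> bg; rewrite -RintegralZl_bm; last exact: bmeasM.
  transitivity (\int[U]_x (g x * (c * w x))); last first.
    by apply: eq_Rintegral => x _; rewrite mulrCA.
  have bcw : bmeas (fun x => c * w x) by apply: bmeasM => //; exact: bmeas_cst.
  apply: (bmeas_ge0_integral_transfer (@measurable_id _ V setT) bcw _ _ bg).
    by move=> x; rewrite mulr_ge0// ltW// angular_weight_gt0.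
  move=> k mk k0.
  have mw : measurable_fun setT (fun x => (w x)%:E) by apply/measurable_EFinP; exact: bw.1.
  rewrite !ge0_integral_rotsym_law//; last 2 first.
  - apply: emeasurable_funM => //; apply/measurable_EFinP; exact: bcw.1.
  - by move=> x; rewrite mule_ge0// lee_fin mulr_ge0 ?(ltW c0)// ltW// angular_weight_gt0.
  under [in RHS]eq_integral do rewrite w0 mule1 EFinM muleCA.
  rewrite ge0_integralZl//; last 3 first.
  - by apply: emeasurable_funM.
  - by move=> x _; rewrite mule_ge0// lee_fin ltW// angular_weight_gt0.
  - by rewrite lee_fin ltW.
  rewrite muleA -EFinM; congr (_%:E * _)%E.
  by rewrite /c mulrA mulVf ?mul1r// gt_eqF.
move=> bh; rewrite H//.
have := H _ (@bmeas_cst _ V R 1); rewrite Rintegral_prob_cst.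
under eq_Rintegral do rewrite mul1r.
move=> H1; rewrite -[RHS]mul1r [in RHS]H1; ring.
Qed.

(* The reflection along [u] fixes [theta] and changes the sign of the integrand. *)
Lemma rotsym_mean_orth u : dotv u theta = 0 ->
  \int[P]_x dotv (radial_proj x) u = 0.
Proof.
move=> ut; have [->|u0] := eqVneq u 0.
  by under eq_Rintegral do rewrite dotv0r; rewrite Rintegral_prob_cst.
have [A [AA At Au]] := flip_exists ut u0.
have bu := bmeas_dotv_radial_proj u.
have := Rintegral_rotsym_orthogonal AA At bu.
under eq_Rintegral.
  move=> x _; rewrite radial_proj_orthogonal// -[X in dotv _ X]opprK -Au dotvNr orthogonal_dotv//.
  over.
by rewrite RintegralN_bm// => /eqP; rewrite eqNr => /eqP.
Qed.

(** The component of u orthogonal to theta contributes nothing, by [rotsym_mean_orth]. *)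
Lemma rotsym_mean u : \int[P]_x dotv (radial_proj x) u =
  dotv u theta * \int[P]_x dotv (radial_proj x) theta.
Proof.
have := @rotsym_mean_orth (u - dotv u theta *: theta).
rewrite dotvBl dotvZl enorm1_dotv// mulr1 subrr => /(_ erefl).
under eq_Rintegral do rewrite dotvBr dotvZr.
rewrite RintegralB_bm ?RintegralZl_bm; last 3 first.
- exact: bmeas_dotv_radial_proj.
- exact: bmeas_dotv_radial_proj.
- by apply: bmeasM; [exact: bmeas_cst|exact: bmeas_dotv_radial_proj].
by move/eqP; rewrite subr_eq0 => /eqP.
Qed.

(** The antipodal map preserves the uniform law. *)
Lemma uniform_mean u : \int[U]_x dotv (radial_proj x) u = 0.
Proof.
have bu := bmeas_dotv_radial_proj u.
have NN : (- 1%:M)^T *m (- 1%:M) = 1%:M :> 'M[R]_p.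
  have -> : (- 1%:M)^T = - 1%:M :> 'M[R]_p by apply/matrixP => i j; rewrite !mxE eq_sym.
  by rewrite mulNmx mulmxN opprK mul1mx.
have := Rintegral_uniform_orthogonal NN bu.
under eq_Rintegral do rewrite radial_proj_orthogonal// mulNmx mul1mx dotvNl.
by rewrite RintegralN_bm// => /eqP; rewrite eqNr => /eqP.
Qed.

Lemma uniform_sqr_unit u v : enorm u = 1 -> enorm v = 1 ->
  \int[U]_x dotv (radial_proj x) u ^+ 2 = \int[U]_x dotv (radial_proj x) v ^+ 2.
Proof.
move=> u1 v1; have [A [AA <-]] := reflection_exists u1 v1.
have bu : bmeas (fun x => dotv (radial_proj x) (A *m u) ^+ 2).
  by apply: bmeasX; exact: bmeas_dotv_radial_proj.
rewrite -(Rintegral_uniform_orthogonal AA bu); apply: eq_Rintegral => x _.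
by rewrite radial_proj_orthogonal// orthogonal_dotv.
Qed.

(** All unit vectors give the same second moment, and those of the p basis vectors add up to 1
    because |x| = 1 almost surely; the general case follows by scaling. *)
Lemma uniform_sqr u : \int[U]_x dotv (radial_proj x) u ^+ 2 = dotv u u / p%:R.
Proof.
pose e (i : 'I_p) : V := delta_mx i 0.
have ee i x : dotv x (e i) = x i 0.
  rewrite dotvE (bigD1 i)//= big1 ?addr0 => [|j ji]; rewrite !mxE ?eqxx ?mulr1//.
  by rewrite (negbTE ji) mulr0.
have e1 i : enorm (e i) = 1 by rewrite /enorm ee mxE !eqxx sqrtr1.
have bs (v : V) : bmeas (fun x => dotv (radial_proj x) v ^+ 2).
  by apply: bmeasX; exact: bmeas_dotv_radial_proj.
have S : \int[U]_x (\sum_(i < p) dotv (radial_proj x) (e i) ^+ 2) = 1.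
  transitivity (\int[U]_x (1 : R)); last exact: Rintegral_prob_cst.
  rewrite /Rintegral; congr fine; apply: ge0_ae_eq_integral => //.
  - by apply/measurable_EFinP; exact: (bmeas_sum _ (fun i => bs (e i))).1.
  - by move=> x _; rewrite lee_fin sumr_ge0// => i _; rewrite sqr_ge0.
  exists (~` sphere p); split.
  - by apply: measurableC; exact: measurable_sphere.
  - exact: rotsym_law_notin_sphere.
  move=> x /= H xs; apply: H => _; congr EFin.
  under eq_bigr do rewrite ee expr2.
  by rewrite -dotvE radial_proj_sphere// enorm1_dotv.
have unit v : enorm v = 1 -> \int[U]_x dotv (radial_proj x) v ^+ 2 = p%:R^-1.
  move=> v1; move: S; rewrite Rintegral_sum_bm//.
  under eq_bigr do rewrite (uniform_sqr_unit (e1 _) v1).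
  rewrite sumr_const card_ord => H.
  have p0 : p%:R != 0 :> R by rewrite pnatr_eq0 -lt0n.
  by apply: (mulIf p0); rewrite mulr_natr H mulVf.
have [->|u0] := eqVneq u 0.
  rewrite dotv0l mul0r; under eq_Rintegral do rewrite dotv0r expr0n.
  exact: Rintegral_prob_cst.
have nu0 : enorm u != 0 by rewrite -sqrf_eq0 enorm_sqr dotv_eq0.
have : enorm ((enorm u)^-1 *: u) = 1.
  by rewrite enormZ ger0_norm ?invr_ge0 ?enorm_ge0// mulVf.
move=> /unit; under eq_Rintegral do rewrite dotvZr exprMn.
rewrite RintegralZl_bm// => H; rewrite -enorm_sqr -H exprVn mulrA mulfV ?mul1r//.
by rewrite sqrf_eq0.
Qed.

(** By Bayes' formula E_P h - E_U h = - (E_P h) E_U(w - 1) + E_U(h (w - 1)), and each of the two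
    terms is at most C delta. *)
Lemma rotsym_uniform_close (h : V -> R) C delta : bmeas h ->
  (forall x, `|h x| <= C) -> (forall x, `|w x - 1| <= delta) ->
  `|\int[P]_x h x - \int[U]_x h x| <= 2 * C * delta.
Proof.
move=> bh hC wd.
have bw := bmeas_angular_weight kappa_ge0 f_gt0 theta1.
have b1 := @bmeas_cst _ V R 1.
have bw1 := bmeasB bw b1.
have -> : \int[P]_x h x - \int[U]_x h x =
  - (\int[P]_x h x * \int[U]_x (w x - 1)) + \int[U]_x (h x * (w x - 1)).
  under [X in _ = _ + X]eq_Rintegral do rewrite mulrBr mulr1.
  rewrite (RintegralB_bm _ bw b1) (RintegralB_bm _ (bmeasM bh bw) bh).
  rewrite -(Rintegral_rotsym_uniform bh) Rintegral_prob_cst.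
  by rewrite mulrBr mulr1 opprB addrA subrK.
have C0 : 0 <= C by apply: le_trans (hC 0).
have -> : 2 * C * delta = C * delta + C * delta by ring.
apply: (le_trans (ler_normD _ _)); rewrite normrN normrM; apply: lerD.
  by apply: ler_pM => //; exact: norm_Rintegral_le.
apply: norm_Rintegral_le; first exact: bmeasM.
by move=> x; rewrite normrM ler_pM.
Qed.

(** Let a be the mean. Substituting w = 1 + kappa x'theta + error in Bayes' formula gives a (1 + b)
    = kappa / p + c with |b|, |c| <= delta, since x'theta has mean 0 and second moment 1/p under
    [U]. Hence a - kappa / p = c - a b, and |a| <= 1. *)
Lemma rotsym_mean_theta delta :
  (forall x, `|w x - 1 - kappa * dotv (radial_proj x) theta| <= delta) ->
  `|\int[P]_x dotv (radial_proj x) theta - kappa / p%:R| <= 2 * delta.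
Proof.
move=> wd; have bt := @bmeas_dotv_radial_proj R p theta.
have bw := bmeas_angular_weight kappa_ge0 f_gt0 theta1.
have b1 := @bmeas_cst _ V R 1.
have bw1 := bmeasB bw b1.
have bk := @bmeas_cst _ V R kappa.
have bkt := bmeasM bk bt.
have br := bmeasB bw1 bkt.
have t1 x : `|dotv (radial_proj x) theta| <= 1.
  by rewrite -theta1; exact: dotv_radial_proj_le.
have E1 : \int[U]_x w x = 1 + \int[U]_x (w x - 1 - kappa * dotv (radial_proj x) theta).
  rewrite !RintegralB_bm// RintegralZl_bm// uniform_mean Rintegral_prob_cst; ring.
have E2 : \int[U]_x (dotv (radial_proj x) theta * w x) =
    kappa / p%:R + \int[U]_x (dotv (radial_proj x) theta *
      (w x - 1 - kappa * dotv (radial_proj x) theta)).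
  under [X in _ = _ + X]eq_Rintegral do
    rewrite 2!mulrBr mulr1 (mulrCA _ kappa) -expr2.
  rewrite !RintegralB_bm ?RintegralZl_bm ?uniform_sqr ?uniform_mean//.
  - by rewrite enorm1_dotv//; ring.
  - exact: bmeasX.
  - exact: bmeasM.
  - by apply: bmeasB => //; exact: bmeasM.
  - by apply: bmeasM => //; exact: bmeasX.
have := Rintegral_rotsym_uniform bt; rewrite E1 E2 mulrDr mulr1 => E3.
set a := \int[P]_x dotv _ _ in E3 *; set b := \int[U]_x (_ - _) in E3.
set c := \int[U]_x _ in E3.
have -> : a - kappa / p%:R = c - a * b.
  by lra.
have -> : 2 * delta = delta + delta by ring.
apply: (le_trans (ler_normB _ _)); apply: lerD.
  apply: norm_Rintegral_le; first exact: bmeasM.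
  by move=> x; rewrite normrM -[delta]mul1r ler_pM.
rewrite normrM -[delta]mul1r ler_pM//; exact: norm_Rintegral_le.
Qed.

End rotsym_moments.

(** * Test functions with second-order expansions *)

Section expansion_prod.
Context {R : realType}.
Implicit Types a b K N L Q : R.

Lemma norm_add7_le (x1 x2 x3 x4 x5 x6 x7 X : R) :
  `|x1| <= X -> `|x2| <= X -> `|x3| <= X -> `|x4| <= X -> `|x5| <= X ->
  `|x6| <= X -> `|x7| <= X -> `|x1 + x2 + x3 + x4 + x5 + x6 + x7| <= 7 * X.
Proof.
rewrite !ler_norml => /andP[? ?] /andP[? ?] /andP[? ?] /andP[? ?] /andP[? ?].
by move=> /andP[? ?] /andP[? ?]; apply/andP; split; lra.
Qed.

(** For N <= 1 the error is a sum of seven products, each of order at least N^3. For N > 1 nothing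
    has to cancel: each of the seven terms of the left-hand side is at most K^2 N^3 by itself. This
    is why K bounds the values as well as the coefficients. *)
Lemma expansion_prod a b a' b' L1 L2 Q1 Q2 K N : 1 <= K -> 0 <= N ->
  `|a| <= K -> `|b| <= K -> `|a'| <= K -> `|b'| <= K ->
  `|L1| <= K * N -> `|L2| <= K * N -> `|Q1| <= K * N ^+ 2 -> `|Q2| <= K * N ^+ 2 ->
  `|a' - a - L1 - Q1| <= K * N ^+ 3 -> `|b' - b - L2 - Q2| <= K * N ^+ 3 ->
  `|a' * b' - a * b - (a * L2 + b * L1) - (a * Q2 + b * Q1 + L1 * L2)| <=
  7 * K ^+ 2 * N ^+ 3.
Proof.
move=> K1 N0 ha hb ha' hb' l1 l2 q1 q2 e1 e2.
have K0 : 0 <= K by exact: le_trans K1.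
have pr (u v : R) c d e : `|u| <= K * c -> `|v| <= K * d -> c * d <= e ->
    `|u * v| <= K ^+ 2 * e.
  move=> uc vd cde; rewrite normrM.
  apply: (@le_trans _ _ ((K * c) * (K * d))); first exact: ler_pM.
  by rewrite mulrACA -expr2 ler_wpM2l// sqr_ge0.
have one (u : R) : `|u| <= K -> `|u| <= K * 1 by rewrite mulr1.
have NX m n : (m <= n)%N -> 1 < N -> N ^+ m <= N ^+ n.
  by move=> mn N1; rewrite ler_weXn2l// ltW.
have NX' m n : (n <= m)%N -> N <= 1 -> N ^+ m <= N ^+ n.
  by move=> mn N1; rewrite ler_wiXn2l.
rewrite -mulrA; have [N1|N1] := leP N 1.
  rewrite (_ : _ - _ = (a' - a - L1 - Q1) * b' + a * (b' - b - L2 - Q2)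
    + L1 * (b' - b - L2 - Q2) + Q1 * (b' - b - L2 - Q2) + L1 * Q2 + Q1 * L2 + Q1 * Q2);
      last by ring.
  apply: norm_add7_le.
  - by apply: (pr _ _ _ _ _ e1 (one _ hb')); rewrite mulr1.
  - by apply: (pr _ _ _ _ _ (one _ ha) e2); rewrite mul1r.
  - by apply: (pr _ _ _ _ _ l1 e2); rewrite -exprS NX'.
  - by apply: (pr _ _ _ _ _ q1 e2); rewrite -exprD NX'.
  - by apply: (pr _ _ _ _ _ l1 q2); rewrite -exprS NX'.
  - by apply: (pr _ _ _ _ _ q1 l2); rewrite -exprSr NX'.
  - by apply: (pr _ _ _ _ _ q1 q2); rewrite -exprD NX'.
rewrite (_ : _ - _ = a' * b' + (- a) * b + (- a) * L2 + (- b) * L1 + (- a) * Q2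
  + (- b) * Q1 + (- L1) * L2); last by ring.
have NN (u c : R) : `|u| <= c -> `|- u| <= c by rewrite normrN.
apply: norm_add7_le.
- by apply: (pr _ _ _ _ _ (one _ ha') (one _ hb')); rewrite mulr1 -(expr0 N) NX.
- by apply: (pr _ _ _ _ _ (one _ (NN _ _ ha)) (one _ hb)); rewrite mulr1 -(expr0 N) NX.
- by apply: (pr _ _ _ _ _ (one _ (NN _ _ ha)) l2); rewrite mul1r -[leLHS]expr1 NX.
- by apply: (pr _ _ _ _ _ (one _ (NN _ _ hb)) l1); rewrite mul1r -[leLHS]expr1 NX.
- by apply: (pr _ _ _ _ _ (one _ (NN _ _ ha)) q2); rewrite mul1r NX.
- by apply: (pr _ _ _ _ _ (one _ (NN _ _ hb)) q1); rewrite mul1r NX.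
- by apply: (pr _ _ _ _ _ (NN _ _ l1) l2); rewrite -expr2 NX.
Qed.

End expansion_prod.

Section smooth.
Context {R : realType} {p : nat}.
Notation V := 'cV[R]_p.
Implicit Types (F : V -> R) (G : 'I_p -> V -> R) (H : 'I_p -> 'I_p -> V -> R).

(** With the l1 norm, linear and quadratic forms are bounded through their largest coefficient,
    without a factor depending on p. *)
Definition norm1 (y : V) : R := \sum_i `|y i 0|.

Definition linf G (w y : V) : R := \sum_i G i w * y i 0.

Definition quadf H (w y : V) : R := \sum_i \sum_j H i j w * (y i 0 * y j 0).

Definition expansion F G H (C : R) := forall w y,
  `|F (w + y) - F w - linf G w y - quadf H w y| <= C * norm1 y ^+ 3.

(* Test functions for Lindeberg's replacement argument; the expansion is uniform
   in [w] and is not required to come from derivatives, so that cubic splines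
   qualify. *)
Definition smooth2 F := bmeas F /\ exists G H C,
  [/\ forall i, bmeas (G i), forall i j, bmeas (H i j) & expansion F G H C].

Lemma norm1_ge0 y : 0 <= norm1 y.
Proof. by apply: sumr_ge0. Qed.

Lemma linf_le G (C : R) w y : (forall i, `|G i w| <= C) -> `|linf G w y| <= C * norm1 y.
Proof.
move=> GC; apply: (le_trans (ler_norm_sum _ _ _)); rewrite mulr_sumr.
by apply: ler_sum => i _; rewrite normrM ler_wpM2r.
Qed.

Lemma quadf_le H (C : R) w y : (forall i j, `|H i j w| <= C) -> `|quadf H w y| <= C * norm1 y ^+ 2.
Proof.
move=> HC; apply: (le_trans (ler_norm_sum _ _ _)).
rewrite expr2 mulrCA mulr_suml; apply: ler_sum => i _.
apply: (le_trans (ler_norm_sum _ _ _)).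
rewrite mulrCA mulr_sumr mulr_sumr; apply: ler_sum => j _.
by rewrite !normrM ler_wpM2r// mulr_ge0.
Qed.

Lemma linfD G1 G2 w y : linf (fun i x => G1 i x + G2 i x) w y = linf G1 w y + linf G2 w y.
Proof. by rewrite /linf -big_split; apply: eq_bigr => i _; rewrite mulrDl. Qed.

Lemma quadfD H1 H2 w y :
  quadf (fun i j x => H1 i j x + H2 i j x) w y = quadf H1 w y + quadf H2 w y.
Proof.
rewrite /quadf -big_split; apply: eq_bigr => i _.
by rewrite -big_split; apply: eq_bigr => j _; rewrite mulrDl.
Qed.

Lemma linfZ (c : V -> R) G w y : linf (fun i x => c x * G i x) w y = c w * linf G w y.
Proof. by rewrite /linf mulr_sumr; apply: eq_bigr => i _; rewrite mulrA. Qed.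

Lemma quadfZ (c : V -> R) H w y : quadf (fun i j x => c x * H i j x) w y = c w * quadf H w y.
Proof.
rewrite /quadf mulr_sumr; apply: eq_bigr => i _.
by rewrite mulr_sumr; apply: eq_bigr => j _; rewrite !mulrA.
Qed.

Lemma quadf_linf G1 G2 w y :
  quadf (fun i j x => G1 i x * G2 j x) w y = linf G1 w y * linf G2 w y.
Proof.
rewrite /quadf /linf mulr_suml; apply: eq_bigr => i _.
by rewrite mulr_sumr; apply: eq_bigr => j _; rewrite mulrACA.
Qed.

Lemma bmeas_bound1 G : (forall i, bmeas (G i)) ->
  exists2 C : R, 0 <= C & forall i w, `|G i w| <= C.
Proof.
move=> bG; pose c i := sval (cid (bG i).2).
have cP i w : `|G i w| <= c i by rewrite /c; case: cid.
exists (\sum_i `|c i|); first exact: sumr_ge0.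
move=> i w; apply: (le_trans (cP i w)); apply: (le_trans (ler_norm _)).
by rewrite (bigD1 i)//= lerDl sumr_ge0.
Qed.

Lemma bmeas_bound2 H : (forall i j, bmeas (H i j)) ->
  exists2 C : R, 0 <= C & forall i j w, `|H i j w| <= C.
Proof.
move=> bH; pose c i := sval (cid2 (bmeas_bound1 (bH i))).
have [c0 cP] : (forall i, 0 <= c i) /\ (forall i j w, `|H i j w| <= c i).
  by split=> [i|i j w]; rewrite /c; case: cid2.
exists (\sum_i c i); first exact: sumr_ge0.
move=> i j w; apply: (le_trans (cP i j w)).
by rewrite (bigD1 i)//= lerDl sumr_ge0.
Qed.

Lemma smooth2_cst c : smooth2 (fun=> c).
Proof.
split; first exact: bmeas_cst.
exists (fun _ _ => 0), (fun _ _ _ => 0), 0; split=> [i|i j|w y]; [exact: bmeas_cst..|].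
rewrite subrr /linf /quadf big1 => [|i _]; last by rewrite mul0r.
rewrite big1 => [|i _]; last by rewrite big1// => j _; rewrite mul0r.
by rewrite !subr0 normr0 mul0r.
Qed.

Lemma smooth2D F1 F2 : smooth2 F1 -> smooth2 F2 -> smooth2 (fun x => F1 x + F2 x).
Proof.
move=> [bF1 [G1 [H1 [C1 [bG1 bH1 E1]]]]] [bF2 [G2 [H2 [C2 [bG2 bH2 E2]]]]].
split; first exact: bmeasD.
exists (fun i x => G1 i x + G2 i x), (fun i j x => H1 i j x + H2 i j x), (C1 + C2).
split=> [i|i j|w y]; [exact: bmeasD..|].
rewrite linfD quadfD mulrDl.
rewrite (_ : _ - _ = (F1 (w + y) - F1 w - linf G1 w y - quadf H1 w y) +
  (F2 (w + y) - F2 w - linf G2 w y - quadf H2 w y)); last by ring.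
by apply: (le_trans (ler_normD _ _)); rewrite lerD.
Qed.

Lemma smooth2M F1 F2 : smooth2 F1 -> smooth2 F2 -> smooth2 (fun x => F1 x * F2 x).
Proof.
move=> [bF1 [G1 [H1 [C1 [bG1 bH1 E1]]]]] [bF2 [G2 [H2 [C2 [bG2 bH2 E2]]]]].
split; first exact: bmeasM.
have [B1 B10 G1B] := bmeas_bound1 bG1; have [B2 B20 G2B] := bmeas_bound1 bG2.
have [D1 D10 H1D] := bmeas_bound2 bH1; have [D2 D20 H2D] := bmeas_bound2 bH2.
have [_ [A1 F1A]] := bF1; have [_ [A2 F2A]] := bF2.
have A10 : 0 <= A1 by exact: le_trans (F1A 0).
have A20 : 0 <= A2 by exact: le_trans (F2A 0).
(* A single constant, at least 1, that dominates every bound asked for by [expansion_prod]. *)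
pose K : R := 1 + A1 + A2 + B1 + B2 + D1 + D2 + `|C1| + `|C2|.
have nC1 := normr_ge0 C1; have nC2 := normr_ge0 C2.
have K1 : 1 <= K by rewrite /K; lra.
pose G i x := F1 x * G2 i x + F2 x * G1 i x.
pose H i j x := F1 x * H2 i j x + F2 x * H1 i j x + G1 i x * G2 j x.
exists G, H, (7 * K ^+ 2); split=> [i|i j|w y].
- by apply: bmeasD; apply: bmeasM.
- by apply: bmeasD; [apply: bmeasD|]; apply: bmeasM.
have -> : linf G w y = F1 w * linf G2 w y + F2 w * linf G1 w y.
  by rewrite linfD !linfZ.
have -> : quadf H w y = F1 w * quadf H2 w y + F2 w * quadf H1 w y + linf G1 w y * linf G2 w y.
  by rewrite !quadfD !quadfZ quadf_linf.
have N0 := norm1_ge0 y.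
have N30 : 0 <= norm1 y ^+ 3 by rewrite exprn_ge0.
apply: expansion_prod => //.
- by apply: (le_trans (F1A w)); rewrite /K; lra.
- by apply: (le_trans (F2A w)); rewrite /K; lra.
- by apply: (le_trans (F1A _)); rewrite /K; lra.
- by apply: (le_trans (F2A _)); rewrite /K; lra.
- by apply: (le_trans (linf_le _ (fun i => G1B i w))); rewrite ler_wpM2r// /K; lra.
- by apply: (le_trans (linf_le _ (fun i => G2B i w))); rewrite ler_wpM2r// /K; lra.
- by apply: (le_trans (quadf_le _ (fun i j => H1D i j w))); rewrite ler_wpM2r ?sqr_ge0// /K; lra.
- by apply: (le_trans (quadf_le _ (fun i j => H2D i j w))); rewrite ler_wpM2r ?sqr_ge0// /K; lra.
- apply: (le_trans (E1 w y)); rewrite ler_wpM2r// (le_trans (ler_norm _))// /K; lra.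
- apply: (le_trans (E2 w y)); rewrite ler_wpM2r// (le_trans (ler_norm _))// /K; lra.
Qed.

Lemma smooth2_sum I (s : seq I) (F : I -> V -> R) : (forall i, smooth2 (F i)) ->
  smooth2 (fun x => \sum_(i <- s) F i x).
Proof.
move=> sF; elim: s => [|i s IHs].
  by under eq_fun do rewrite big_nil; exact: smooth2_cst.
by under eq_fun do rewrite big_cons; exact: smooth2D.
Qed.

Lemma smooth2_prod I (s : seq I) (F : I -> V -> R) : (forall i, smooth2 (F i)) ->
  smooth2 (fun x => \prod_(i <- s) F i x).
Proof.
move=> sF; elim: s => [|i s IHs].
  by under eq_fun do rewrite big_nil; exact: smooth2_cst.
by under eq_fun do rewrite big_cons; exact: smooth2M.
Qed.

Lemma coord_le_norm1 (y : V) i : `|y i 0| <= norm1 y.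
Proof. by rewrite /norm1 (bigD1 i)//= lerDl sumr_ge0. Qed.

Lemma smooth2_coord (s s1 s2 : R -> R) (C : R) (j : 'I_p) :
  bmeas s -> bmeas s1 -> bmeas s2 -> 0 <= C ->
  (forall t u, `|s (t + u) - s t - s1 t * u - s2 t * u ^+ 2| <= C * `|u| ^+ 3) ->
  smooth2 (fun x : V => s (x j 0)).
Proof.
move=> bs bs1 bs2 C0 E; have mj := @measurable_coord R p j.
split; first exact: (bmeas_comp mj bs).
exists (fun i x => (i == j)%:R * s1 (x j 0)).
exists (fun i k x => ((i == j) && (k == j))%:R * s2 (x j 0)), C; split=> [i|i k|w y].
- by apply: bmeasM; [exact: bmeas_cst|exact: (bmeas_comp mj bs1)].
- by apply: bmeasM; [exact: bmeas_cst|exact: (bmeas_comp mj bs2)].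
rewrite /linf (bigD1 j)//= eqxx mul1r big1 ?addr0 => [|i /negbTE ->]; last by rewrite !mul0r.
rewrite /quadf (bigD1 j)//= (bigD1 j)//= eqxx mul1r big1 ?addr0 => [|i /negbTE ->];
  last by rewrite !mul0r.
rewrite big1 ?addr0 => [|i /negbTE ->]; last by rewrite big1// => k _; rewrite !mul0r.
rewrite mxE -expr2; apply: (le_trans (E _ _)); rewrite ler_wpM2l// lerXn2r// ?nnegrE ?norm1_ge0//.
exact: coord_le_norm1.
Qed.

End smooth.

(** * A piecewise cubic step function *)

Section spline.
Context {R : realType}.
Implicit Types t u : R.

Definition pospart t : R := Num.max t 0.

Lemma measurable_pospart : measurable_fun setT pospart.
Proof. by apply: measurable_funrpos || (apply: measurable_maxr => //; exact: measurable_cst). Qed.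

(** The second derivative 6 t_+ of t_+^3 is Lipschitz with constant 6, whence the Taylor remainder 6
    |u|^3 / 3!. The proof only compares the signs of t and t + u. *)
Lemma pospart_cube_expansion t u :
  `|pospart (t + u) ^+ 3 - pospart t ^+ 3 - 3 * pospart t ^+ 2 * u
    - 3 * pospart t * u ^+ 2| <= `|u| ^+ 3.
Proof.
have H (v : R) : (Num.max v 0 = v /\ 0 <= v) \/ (Num.max v 0 = 0 /\ v <= 0).
  by have [v0|v0] := leP v 0; [right|left; split => //; exact: ltW].
rewrite /pospart -normrX; have [[-> h1]|[-> h1]] := H (t + u); have [[-> h2]|[-> h2]] := H t.
- by rewrite (_ : _ - _ = u ^+ 3)//; ring.
- rewrite !expr0n/= !(mulr0, mul0r, subr0) ger0_norm ?exprn_ge0//.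
  rewrite ger0_norm ?exprn_ge0//; last lra.
  by rewrite lerXn2r// ?nnegrE; lra.
- rewrite (_ : _ - _ = (- (t + u)) ^+ 3 - (- u) ^+ 3); last by rewrite expr0n/=; ring.
  have u0 : 0 <= - u by lra.
  rewrite -(normrN (u ^+ 3)) (_ : - u ^+ 3 = (- u) ^+ 3); last by ring.
  rewrite (ger0_norm (exprn_ge0 3 u0)) ler_norml.
  have w0 : 0 <= - (t + u) by lra.
  have : 0 <= (- (t + u)) ^+ 3 by rewrite exprn_ge0.
  have : (- (t + u)) ^+ 3 <= (- u) ^+ 3 by rewrite lerXn2r// ?nnegrE; lra.
  by move=> ? ?; apply/andP; split; lra.
- by rewrite !expr0n/= !(mulr0, mul0r, subr0) normr0.
Qed.

(** The distribution function of the sum of three independent uniform variables on [0, 1]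
    (Irwin-Hall): it rises from 0 at t = 0 to 1 at t = 3. *)
Definition step t : R := (pospart t ^+ 3 - 3 * pospart (t - 1) ^+ 3
  + 3 * pospart (t - 2) ^+ 3 - pospart (t - 3) ^+ 3) / 6.

Definition step1 t : R := (pospart t ^+ 2 - 3 * pospart (t - 1) ^+ 2
  + 3 * pospart (t - 2) ^+ 2 - pospart (t - 3) ^+ 2) / 2.

(** Half of the second derivative of [step], since [quadf] carries no factor 1/2. *)
Definition step2 t : R := (pospart t - 3 * pospart (t - 1)
  + 3 * pospart (t - 2) - pospart (t - 3)) / 2.

(** The four knots contribute (1 + 3 + 3 + 1) / 6 = 4/3, rounded up to 2. *)
Lemma step_expansion t u :
  `|step (t + u) - step t - step1 t * u - step2 t * u ^+ 2| <= 2 * `|u| ^+ 3.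
Proof.
have := pospart_cube_expansion t u.
have := pospart_cube_expansion (t - 1) u.
have := pospart_cube_expansion (t - 2) u.
have := pospart_cube_expansion (t - 3) u.
rewrite !(addrAC t _ u) /step /step1 /step2.
move: (pospart (t + u)) (pospart t) => a a'.
move: (pospart (t + u - 1)) (pospart (t - 1)) => b b'.
move: (pospart (t + u - 2)) (pospart (t - 2)) => c c'.
move: (pospart (t + u - 3)) (pospart (t - 3)) => d d'.
rewrite !ler_norml => /andP[? ?] /andP[? ?] /andP[? ?] /andP[? ?].
by apply/andP; split; lra.
Qed.

Lemma pospart_ge t : 0 <= t -> pospart t = t.
Proof. by move=> t0; rewrite /pospart; apply/max_idPl. Qed.

Lemma pospart_le t : t <= 0 -> pospart t = 0.
Proof. by move=> t0; rewrite /pospart; apply/max_idPr. Qed.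

Lemma step_le0 t : t <= 0 -> step t = 0.
Proof. by move=> t0; rewrite /step !pospart_le; lra. Qed.

Lemma step_ge3 t : 3 <= t -> step t = 1.
Proof. by move=> t0; rewrite /step !pospart_ge; lra. Qed.

(* The fourth difference of s_+^3 / 6 is the cubic B-spline on [0, 4]. *)
Lemma step_diff_ge0 t : step (t - 1) <= step t.
Proof.
have C1 : t - 1 - 1 = t - 2 by ring.
have C2 : t - 1 - 2 = t - 3 by ring.
have C3 : t - 1 - 3 = t - 4 by ring.
have [t0|t0] := leP t 0; first by rewrite !step_le0//; lra.
have [t4|t4] := leP 4 t; first by rewrite !step_ge3//; lra.
have [t3|t3] := leP 3 t.
  rewrite [leRHS]step_ge3//.
  rewrite /step C1 C2 C3 (@pospart_ge (t - 1)) ?(@pospart_ge (t - 2)) ?(@pospart_ge (t - 3))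
    ?(@pospart_le (t - 4)); try lra.
  have : 0 <= (4 - t) ^+ 3 by rewrite exprn_ge0// subr_ge0 ltW.
  lra.
rewrite /step C1 C2 C3 (@pospart_le (t - 3)) ?(@pospart_le (t - 4)) ?(@pospart_ge t); try lra.
have [t2|t2] := leP 2 t.
  rewrite (@pospart_ge (t - 1)) ?(@pospart_ge (t - 2)); try lra.
  (* With v = 3 - t, six times the B-spline is 1 + 3 v (1 + v (1 - v)) on [2, 3]; the piece on
     [1, 2] is the same with v = t - 1. *)
  have : 0 <= (3 - t) * (1 + (t - 2) * (3 - t)).
    by apply: mulr_ge0; [lra|apply: addr_ge0 => //; apply: mulr_ge0; lra].
  lra.
rewrite (@pospart_le (t - 2)); last lra.
have [t1|t1] := leP 1 t.
  rewrite (@pospart_ge (t - 1)); last lra.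
  have : 0 <= (t - 1) * (1 + (2 - t) * (t - 1)).
    by apply: mulr_ge0; [lra|apply: addr_ge0 => //; apply: mulr_ge0; lra].
  lra.
rewrite (@pospart_le (t - 1)); last lra.
have : 0 <= t ^+ 3 by rewrite exprn_ge0// ltW.
lra.
Qed.

Lemma step_ge0 t : 0 <= step t.
Proof.
have [t3|t3] := leP 3 t; first by rewrite step_ge3.
apply: le_trans (step_diff_ge0 t); apply: le_trans (step_diff_ge0 (t - 1)).
by apply: le_trans (step_diff_ge0 (t - 1 - 1)); rewrite step_le0//; lra.
Qed.

Lemma step_le1 t : step t <= 1.
Proof.
have [t0|t0] := leP t 0; first by rewrite step_le0.
have D v : step v <= step (v + 1) by have := step_diff_ge0 (v + 1); rewrite addrK.
apply: (le_trans (D t)); apply: (le_trans (D (t + 1))); apply: (le_trans (D (t + 1 + 1))).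
by rewrite step_ge3//; lra.
Qed.

Lemma pospart_ge0 t : 0 <= pospart t.
Proof. by rewrite /pospart le_max lexx orbT. Qed.

Lemma pospart_ub t (c : R) : 0 <= c -> t <= c -> pospart t <= c.
Proof. by move=> c0 tc; rewrite /pospart ge_max tc. Qed.

Lemma measurable_pospartB (c : R) : measurable_fun setT (fun t => pospart (t - c)).
Proof.
apply: (measurableT_comp measurable_pospart).
by apply: measurable_funB => //; exact: measurable_cst.
Qed.

Lemma bmeas_step : bmeas step.
Proof.
split; last by exists 1 => t; rewrite ger0_norm ?step_ge0 ?step_le1.
have m0 := measurable_pospart; have m1 := measurable_pospartB.
apply: measurable_funM; last exact: measurable_cst.
by repeat (apply: measurable_funB || apply: measurable_funD || apply: measurable_funM ||
  apply: measurable_funX || exact: measurable_cst || exact: m1 || exact: m0).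
Qed.

Lemma bmeas_step1 : bmeas step1.
Proof.
split.
  have m0 := measurable_pospart; have m1 := measurable_pospartB.
  apply: measurable_funM; last exact: measurable_cst.
  by repeat (apply: measurable_funB || apply: measurable_funD || apply: measurable_funM ||
    apply: measurable_funX || exact: measurable_cst || exact: m1 || exact: m0).
(* A generous constant. Past the last knot the third difference of squares vanishes; before it each
   squared positive part is at most 9. *)
exists 36 => t; rewrite /step1; have [t3|t3] := leP 3 t.
  rewrite !pospart_ge; try lra.
  by rewrite (_ : _ / 2 = 0) ?normr0//; field.
have H c : 0 <= c -> 0 <= pospart (t - c) ^+ 2 <= 9.
  move=> c0; rewrite sqr_ge0/= (_ : 9 = 3 ^+ 2); last by ring.
  by rewrite lerXn2r// ?nnegrE ?pospart_ge0// pospart_ub//; lra.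
have := H 0 (lexx _); rewrite subr0 => /andP[? ?].
have /andP[? ?] := H 1 ler01; have /andP[? ?] := H 2 (ler0n _ _).
have /andP[? ?] := H 3 (ler0n _ _).
by rewrite ler_norml; apply/andP; split; lra.
Qed.

Lemma bmeas_step2 : bmeas step2.
Proof.
split.
  have m0 := measurable_pospart; have m1 := measurable_pospartB.
  apply: measurable_funM; last exact: measurable_cst.
  by repeat (apply: measurable_funB || apply: measurable_funD || apply: measurable_funM ||
    apply: measurable_funX || exact: measurable_cst || exact: m1 || exact: m0).
exists 36 => t; rewrite /step2; have [t3|t3] := leP 3 t.
  rewrite !pospart_ge; try lra.
  by rewrite (_ : _ / 2 = 0) ?normr0//; field.
have H c : 0 <= c -> 0 <= pospart (t - c) <= 3.
  by move=> c0; rewrite pospart_ge0/= pospart_ub//; lra.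
have := H 0 (lexx _); rewrite subr0 => /andP[? ?].
have /andP[? ?] := H 1 ler01; have /andP[? ?] := H 2 (ler0n _ _).
have /andP[? ?] := H 3 (ler0n _ _).
by rewrite ler_norml; apply/andP; split; lra.
Qed.

End spline.

(** * Tensor product splines and approximation of continuous functions *)

Section partition_of_unity.
Context {R : realType} (p : nat).
Notation V := 'cV[R]_p.
Variables (m : nat) (N : nat).

(* B-spline centred near the grid point (k - N) / m *)
Definition bspline (k : nat) (t : R) : R :=
  step (m%:R * t + N%:R - k%:R + 1) - step (m%:R * t + N%:R - k%:R).

Lemma bspline_ge0 k t : 0 <= bspline k t.
Proof.
rewrite /bspline subr_ge0; set x := m%:R * t + N%:R - k%:R.
by have := step_diff_ge0 (x + 1); rewrite addrK.
Qed.

(** The sum telescopes, so it is itself a difference of two steps: a smooth indicator of an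
    interval. *)
Lemma sum_bspline t : \sum_(k < N.*2) bspline k t =
  step (m%:R * t + N%:R + 1) - step (m%:R * t - N%:R + 1).
Proof.
suff H M : \sum_(k < M) bspline k t =
    step (m%:R * t + N%:R + 1) - step (m%:R * t + N%:R - M%:R + 1).
  by rewrite H -addnn natrD; congr (_ - step _); ring.
elim: M => [|M IHM]; first by rewrite big_ord0 subr0 subrr.
rewrite big_ord_recr/= IHM /bspline addrA subrK; congr (_ - step _).
by rewrite -natr1; ring.
Qed.

Lemma sum_bspline_ge0 t : 0 <= \sum_(k < N.*2) bspline k t.
Proof. by apply: sumr_ge0 => k _; exact: bspline_ge0. Qed.

Lemma sum_bspline_le1 t : \sum_(k < N.*2) bspline k t <= 1.
Proof.
rewrite sum_bspline lerBlDr; apply: (le_trans (step_le1 _)).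
by rewrite lerDl step_ge0.
Qed.

(** The margin 2 is the one that the left step needs: it has reached 1 only when its argument m t +
    N + 1 is at least 3. *)
Lemma sum_bspline1 t : m%:R * `|t| + 2 <= N%:R -> \sum_(k < N.*2) bspline k t = 1.
Proof.
move=> tN; have mt : `|m%:R * t| <= N%:R - 2 by rewrite normrM ger0_norm//; lra.
move: mt; rewrite ler_norml => /andP[? ?].
by rewrite sum_bspline step_ge3 ?step_le0 ?subr0//; lra.
Qed.

Lemma sum_bspline0 t : N%:R + 2 <= m%:R * `|t| -> \sum_(k < N.*2) bspline k t = 0.
Proof.
move=> tN; have mt : N%:R + 2 <= `|m%:R * t| by rewrite normrM ger0_norm.
have N0 : 0 <= N%:R :> R by [].
rewrite sum_bspline; move: mt; rewrite ler_normr => /orP[?|?].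
  by rewrite !step_ge3 ?subrr//; lra.
by rewrite !step_le0 ?subrr//; lra.
Qed.

Lemma bspline_supp k t : bspline k t != 0 -> `|m%:R * t - (k%:R - N%:R)| <= 3.
Proof.
apply: contraNT; rewrite -ltNge lter_normr => /orP[?|?]; rewrite /bspline.
  by rewrite !step_ge3 ?subrr//; lra.
by rewrite !step_le0 ?subrr//; lra.
Qed.

Definition gridpt (K : {ffun 'I_p -> 'I_N.*2}) : V := \col_i (((K i)%:R - N%:R) / m%:R).

Definition tensor_spline (K : {ffun 'I_p -> 'I_N.*2}) (x : V) : R :=
  \prod_i bspline (K i) (x i 0).

(** The total mass of the tensor splines. It is also a smooth indicator of a box and plays the part
    of a truncation when convergence is extended from smooth to continuous functions. *)
Definition cutoff (x : V) : R := \prod_i \sum_(k < N.*2) bspline k (x i 0).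

Lemma sum_tensor_spline x : \sum_K tensor_spline K x = cutoff x.
Proof. by rewrite /cutoff bigA_distr_bigA. Qed.

Lemma tensor_spline_ge0 K x : 0 <= tensor_spline K x.
Proof. by apply: prodr_ge0 => i _; exact: bspline_ge0. Qed.

Lemma cutoff_ge0 x : 0 <= cutoff x.
Proof. by apply: prodr_ge0 => i _; exact: sum_bspline_ge0. Qed.

Lemma cutoff_le1 x : cutoff x <= 1.
Proof.
by apply: prodr_ile1 => i _; rewrite sum_bspline_ge0 sum_bspline_le1.
Qed.

Lemma cutoff1 (x : V) : (forall i, m%:R * `|x i 0| + 2 <= N%:R) -> cutoff x = 1.
Proof. by move=> xN; rewrite /cutoff big1// => i _; exact: sum_bspline1. Qed.

Lemma cutoff_neq0 (x : V) i : cutoff x != 0 -> m%:R * `|x i 0| <= N%:R + 2.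
Proof.
apply: contraNT; rewrite -ltNge => /ltW H.
by rewrite /cutoff (bigD1 i)//= sum_bspline0// mul0r.
Qed.

Lemma tensor_spline_supp K x i : (0 < m)%N -> tensor_spline K x != 0 ->
  `|x i 0 - gridpt K i 0| <= 3 / m%:R.
Proof.
move=> m0; have m0' : 0 < m%:R :> R by rewrite ltr0n.
rewrite /tensor_spline prodf_seq_neq0 => /allP/(_ i (mem_index_enum _))/= /bspline_supp H.
rewrite mxE ler_pdivlMr// -[X in _ * X]ger0_norm// -normrM; apply: le_trans H.
by rewrite le_eqVlt; apply/orP; left; apply/eqP; congr `|_|; field; rewrite gt_eqF.
Qed.

Lemma smooth2_bspline k j : smooth2 (fun x : V => bspline k (x j 0)).
Proof.
have H (c : R) : smooth2 (fun x : V => step (m%:R * x j 0 + c)).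
  have mc : measurable_fun setT (fun t : R => m%:R * t + c).
    apply: measurable_funD; last exact: measurable_cst.
    by apply: measurable_funM => //; exact: measurable_cst.
  apply: (@smooth2_coord _ _ (fun t => step (m%:R * t + c))
    (fun t => step1 (m%:R * t + c) * m%:R)
    (fun t => step2 (m%:R * t + c) * m%:R ^+ 2) (2 * m%:R ^+ 3)).
  - exact: (bmeas_comp mc bmeas_step).
  - apply: bmeasM; last exact: bmeas_cst.
    exact: (bmeas_comp mc bmeas_step1).
  - apply: bmeasM; last exact: bmeas_cst.
    exact: (bmeas_comp mc bmeas_step2).
  - by rewrite mulr_ge0// exprn_ge0.
  move=> t u; have := step_expansion (m%:R * t + c) (m%:R * u).
  rewrite normrM exprMn (ger0_norm (ler0n _ m)) exprMn !mulrA.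
  by rewrite mulrDr (addrAC _ c).
rewrite (_ : (fun _ => _) = fun x : V => step (m%:R * x j 0 + (N%:R - k%:R + 1))
  + (- 1) * step (m%:R * x j 0 + (N%:R - k%:R))); last first.
  by apply/funext => x; rewrite /bspline mulN1r !addrA.
apply: smooth2D; first exact: H.
by apply: smooth2M; [exact: smooth2_cst|exact: H].
Qed.

Lemma smooth2_tensor_spline K : smooth2 (tensor_spline K).
Proof. by apply: smooth2_prod => i; exact: smooth2_bspline. Qed.

Lemma smooth2_cutoff : smooth2 cutoff.
Proof.
by apply: smooth2_prod => i; apply: smooth2_sum => k; exact: smooth2_bspline.
Qed.

(** A quasi-interpolant: g is only sampled at the grid points, no linear system is solved. *)
Definition spline_approx (g : V -> R) (x : V) : R :=
  \sum_K g (gridpt K) * tensor_spline K x.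

Lemma smooth2_spline_approx g : smooth2 (spline_approx g).
Proof.
apply: smooth2_sum => K; apply: smooth2M; first exact: smooth2_cst.
exact: smooth2_tensor_spline.
Qed.

Lemma spline_approx_bounded (g : V -> R) (C : R) (x : V) : (forall y, `|g y| <= C) ->
  `|spline_approx g x| <= C.
Proof.
move=> gC; have C0 : 0 <= C by exact: le_trans (gC 0).
apply: (le_trans (ler_norm_sum _ _ _)).
apply: (@le_trans _ _ (C * cutoff x)); last by rewrite ler_piMr// cutoff_le1.
rewrite -sum_tensor_spline mulr_sumr; apply: ler_sum => K _.
by rewrite normrM (ger0_norm (tensor_spline_ge0 _ _)) ler_wpM2r// tensor_spline_ge0.
Qed.

(** Where the cutoff is 1, the error is an average of the differences between g(x) and the values of
    g at grid points within 3/m of x. *)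
Lemma spline_approx_close (g : V -> R) (e : R) (x : V) : (0 < m)%N -> 0 <= e ->
  (forall i, m%:R * `|x i 0| + 2 <= N%:R) ->
  (forall y : V, (forall i, `|x i 0 - y i 0| <= 3 / m%:R) -> `|g x - g y| <= e) ->
  `|g x - spline_approx g x| <= e.
Proof.
move=> m0 e0 xN ge.
rewrite (_ : _ - _ = \sum_K (g x - g (gridpt K)) * tensor_spline K x); last first.
  under [RHS]eq_bigr do rewrite mulrBl.
  by rewrite sumrB -mulr_sumr sum_tensor_spline cutoff1// mulr1.
apply: (le_trans (ler_norm_sum _ _ _)).
apply: (@le_trans _ _ (e * cutoff x)); last by rewrite ler_piMr// cutoff_le1.
rewrite -sum_tensor_spline mulr_sumr; apply: ler_sum => K _.
rewrite normrM (ger0_norm (tensor_spline_ge0 _ _)).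
have [->|H] := eqVneq (tensor_spline K x) 0; first by rewrite !mulr0.
rewrite ler_wpM2r ?tensor_spline_ge0// ge// => i; exact: tensor_spline_supp.
Qed.

End partition_of_unity.

Section continuous_cV.
Context {R : realType} (p : nat).
Notation V := 'cV[R]_p.

Lemma continuous_trmx_row : continuous (fun v : 'rV[R]_p => v^T : V).
Proof.
move=> v B [P Pv PB]; exists (fun i j => P j i) => [/= i j|/= w wP].
  by have := Pv j i; rewrite mxE.
by apply: PB => /= i j; rewrite mxE; exact: wP.
Qed.

(** Only x is confined to the box, since the grid points near x may lie outside it; compactness is
    therefore used in its near-covering form. *)
Lemma uniform_continuity_box (g : V -> R) (A e : R) : continuous g -> 0 < e ->
  exists2 delta : R, 0 < delta & forall x y : V, (forall i, `|x i 0| <= A) ->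
    (forall i, `|x i 0 - y i 0| <= delta) -> `|g x - g y| <= e.
Proof.
move=> cg e0.
pose P (delta : R) (x : 'rV[R]_p) := forall y : 'rV[R]_p,
  (forall i, `|x 0 i - y 0 i| <= delta) -> `|g x^T - g y^T| <= e.
have := @rV_compact R p (fun=> [set` `[- A, A]]) (fun=> @segment_compact _ _ _).
move=> /compact_near_coveringP/(_ R (0 : R)^'+ P _) H.
have /H K : forall x : 'rV[R]_p, (forall i, [set` `[- A, A]] (x 0 i)) ->
   \forall x' \near x & delta \near (0 : R)^'+, P delta x'.
  move=> x _.
  have cgx : (fun v : 'rV[R]_p => g v^T) @ x --> g x^T.
    by apply: (@continuous_comp _ _ _ (fun v : 'rV[R]_p => v^T : V) g);
      [exact: continuous_trmx_row|exact: cg].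
  have e20 : 0 < e / 2 by rewrite divr_gt0.
  have /cvgr_dist_lt/(_ _ e20) := cgx.
  move=> /nbhs_ballP[d /= d0 dx].
  exists (ball x (d / 2), [set delta | delta < d / 2]) => /=.
    split; first by apply: nbhsx_ballx; rewrite divr_gt0.
    by apply: nbhs_right_lt; rewrite divr_gt0.
  move=> [x' delta]/= [xx' dd] y xy.
  have b1 : ball x d x' by apply: le_ball xx'; lra.
  have b2 : ball x d y.
    split=> // i j; rewrite (ord1 i).
    have := xx'.2 0 j; rewrite /ball/= => h1.
    rewrite -(subrKA (x' 0 j)); apply: (le_lt_trans (ler_normD _ _)).
    have : `|x 0 j - x' 0 j| + `|x' 0 j - y 0 j| < d / 2 + d / 2.
      by apply: ltrD => //; exact: (le_lt_trans (xy j)).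
    by rewrite -splitr.
  have := dx _ b1; have := dx _ b2 => /= g2 g1.
  rewrite -(subrKA (g x^T)); apply: (le_trans (ler_normD _ _)).
  by rewrite distrC [leRHS](splitr e); apply: lerD; exact: ltW.
near (0 : R)^'+ => delta.
exists delta; first by near: delta; exact: nbhs_right_gt.
move=> x y xA xy; rewrite -(trmxK x) -(trmxK y).
have Kd : [set v : 'rV[R]_p | forall i, [set` `[- A, A]] (v 0 i)] `<=` P delta.
  by near: delta; exact: K.
apply: Kd => [/= i|i]; rewrite !mxE ?in_itv/= -?ler_norml//.
Unshelve. all: by end_near. Qed.

Lemma continuous_spline_approx (g : V -> R) (A e : R) : continuous g -> 0 < e ->
  exists m N : nat, forall x : V, (forall i, `|x i 0| <= A) ->
    `|g x - spline_approx m N g x| <= e.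
Proof.
move=> cg e0; have [delta d0 dP] := uniform_continuity_box A cg e0.
(* m brings the support radius 3/m below delta; N then makes the cutoff equal to 1 on the whole
   box. *)
pose m := (Num.truncn (3 / delta)).+1; exists m.
pose N := (Num.truncn (m%:R * A + 2)).+1; exists N => x xA.
apply: spline_approx_close => //; first exact: ltW.
  move=> i; apply: le_trans (ltW (truncnS_gt _)).
  by rewrite lerD2r ler_wpM2l.
move=> y xy; apply: dP => // i; apply: (le_trans (xy i)).
rewrite ler_pdivrMr ?ltr0n// mulrC -ler_pdivrMr//.
exact/ltW/truncnS_gt.
Qed.

(** The sigma-algebra is generated by the coordinates and not by the open sets, so this has content:
    g is the pointwise limit of its spline approximations on growing boxes, which are measurable. *)
Lemma continuous_measurable_cV (g : V -> R) : continuous g -> measurable_fun setT g.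
Proof.
move=> cg.
have H n : exists F : V -> R, measurable_fun setT F /\
   forall x : V, (forall i, `|x i 0| <= n%:R) -> `|g x - F x| <= n.+1%:R^-1.
  have n0 : 0 < n.+1%:R^-1 :> R by rewrite invr_gt0.
  have [m [N mN]] := continuous_spline_approx n%:R cg n0.
  exists (spline_approx m N g); split => //.
  exact: (smooth2_spline_approx m N g).1.1.
pose F n := sval (cid (H n)).
have FP n : measurable_fun setT (F n) /\
   forall x : V, (forall i, `|x i 0| <= n%:R) -> `|g x - F n x| <= n.+1%:R^-1.
  by rewrite /F; case: cid.
apply: (measurable_fun_cvg (fun n => (FP n).1)) => x _.
apply/cvgrPdist_le => e e0; near=> n.
apply: (le_trans ((FP n).2 x _)).
  move=> i; apply: (@le_trans _ _ (norm1 x)); first exact: coord_le_norm1.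
  by near: n; exact: nbhs_infty_ger.
by apply: ltW; near: n; exact: (near_infty_natSinv_lt (PosNum e0)).
Unshelve. all: by end_near. Qed.

End continuous_cV.

(** * Gaussian vectors *)

Section gauss1.
Context {R : realType}.
Notation mu := (@lebesgue_measure R).
Notation gauss := (@normal_prob R 0 1).
Notation pdf := (@normal_pdf R).
Notation MR := (measurableTypeR R).

Lemma ge0_integral_normal (h : MR -> \bar R) :
  measurable_fun setT h -> (forall x, 0 <= h x)%E ->
  (\int[gauss]_x h x = \int[mu]_x (h x * (pdf 0 1 x)%:E))%E.
Proof.
move=> mh h0; apply: (ge0_integral_density (mu := mu)) => //.
- exact: measurable_normal_pdf.
- by move=> x; exact: normal_pdf_ge0.
Qed.

Lemma normal_pdf_scale (s x : R) : 0 < s ->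
  pdf 0 s x = s^-1 * pdf 0 1 (x / s).
Proof.
move=> s0; have s1 : s != 0 by rewrite gt_eqF.
rewrite !normal_pdfE ?oner_neq0// mulrA; congr (_ * _).
  rewrite /normal_peak expr1n mul1r -mulrnAr sqrtrM ?sqr_ge0// sqrtr_sqr gtr0_norm//.
  by rewrite invfM.
rewrite /normal_fun !subr0; congr expR.
by rewrite expr1n; field.
Qed.

(** Completing the square: the joint density of Z and S = a Z + b Z' at (z, s) is the N(0, c^2)
    density of S times the conditional density of Z given S = s, which is N(a s / c^2, b^2 /
    c^2). *)
Lemma normal_pdf_product (a b c z s : R) : 0 < b -> 0 < c -> a ^+ 2 + b ^+ 2 = c ^+ 2 ->
  b^-1 * (pdf 0 1 z * pdf 0 1 ((s - a * z) / b)) =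
  c^-1 * pdf 0 1 (s / c) * pdf (a * s / c ^+ 2) (b / c) z.
Proof.
move=> b0 c0 abc; have b1 : b != 0 by rewrite gt_eqF.
have c1 : c != 0 by rewrite gt_eqF.
have bc0 : b / c != 0 by rewrite gt_eqF// divr_gt0.
rewrite !(normal_pdfE _ (oner_neq0 R)) (normal_pdfE _ bc0).
have -> : normal_peak (b / c) = c / b * normal_peak (1 : R).
  rewrite /normal_peak expr1n mul1r -mulrnAr sqrtrM ?sqr_ge0// sqrtr_sqr.
  by rewrite gtr0_norm ?divr_gt0// invfM invf_div.
have E : normal_fun 0 1 z * normal_fun 0 1 ((s - a * z) / b) =
   normal_fun 0 1 (s / c) * normal_fun (a * s / c ^+ 2) (b / c) z.
  rewrite /normal_fun -!expRD; congr expR; rewrite !subr0 expr1n.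
  have -> : (b / c) ^+ 2 *+ 2 = 2 * b ^+ 2 / c ^+ 2 by rewrite -mulr_natl expr_div_n mulrA.
  have a2 : a ^+ 2 = c ^+ 2 - b ^+ 2 by rewrite -abc addrK.
  apply/eqP; rewrite -subr_eq0; apply/eqP.
  have -> : - z ^+ 2 / 2 + - ((s - a * z) / b) ^+ 2 / 2 -
    (- (s / c) ^+ 2 / 2 + - (z - a * s / c ^+ 2) ^+ 2 / (2 * b ^+ 2 / c ^+ 2)) =
    (c ^+ 2 - b ^+ 2 - a ^+ 2) * (z ^+ 2 / (2 * b ^+ 2)
       - s ^+ 2 / (2 * b ^+ 2 * c ^+ 2)).
    by field; rewrite b1 c1.
  by rewrite a2; ring.
transitivity (b^-1 * normal_peak 1 ^+ 2 * (normal_fun 0 1 z * normal_fun 0 1 ((s - a * z) / b))).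
  by ring.
rewrite E.
by field; rewrite b1 c1.
Qed.

(** Substitute s = a z + b z' in the inner integral, exchange the integrals and integrate out the
    conditional density of z. The case a = 0 occurs at the start of [lindeberg_iter]. *)
Lemma ge0_integral_gauss_stable (a b c : R) (h : MR -> \bar R) :
  0 < b -> 0 < c -> a ^+ 2 + b ^+ 2 = c ^+ 2 ->
  measurable_fun setT h -> (forall x, 0 <= h x)%E ->
  (\int[gauss]_z \int[gauss]_z' h (a * z + b * z')%R = \int[gauss]_z h (c * z)%R)%E.
Proof.
move=> b0 c0 abc mh h0.
have mpdf : measurable_fun setT (fun x : MR => (pdf 0 1 x)%:E).
  by apply/measurable_EFinP; exact: measurable_normal_pdf.
have pdf0 m s x : (0 <= (pdf m s x)%:E)%E by rewrite lee_fin normal_pdf_ge0.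
have maff (u v : R) : measurable_fun setT (fun x : MR => u * x + v : MR).
  apply: measurable_funD; last exact: measurable_cst.
  by apply: measurable_funM; [exact: measurable_cst|exact: measurable_id].
have mhz z : measurable_fun setT (fun z' : MR => h (a * z + b * z')%R).
  under eq_fun do rewrite addrC.
  exact: (measurableT_comp mh (maff b (a * z))).
have mpz z : measurable_fun setT (fun s : MR => (pdf 0 1 ((s - a * z) / b))%:E).
  have -> : (fun s : MR => (pdf 0 1 ((s - a * z) / b))%:E) =
      (fun x : MR => (pdf 0 1 x)%:E) \o (fun s => b^-1 * s + - (a * z) / b).
    by apply/funext => s /=; congr (pdf _ _ _)%:E; ring.
  exact: (measurableT_comp mpdf (maff _ _)).
have inner z : (\int[gauss]_z' h (a * z + b * z')%R =
    b^-1%:E * \int[mu]_s (h s * (pdf 0 1 ((s - a * z) / b))%:E))%E.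
  rewrite ge0_integral_normal//.
  have H := @ge0_integral_lebesgue_affine R b (a * z)
    (fun s => (h s * (pdf 0 1 ((s - a * z) / b))%:E)%E) b0.
  apply: etrans (H _ _).
  - apply: eq_integral => z' _; rewrite addrK mulrAC mulfV ?mul1r ?gt_eqF//.
    by rewrite addrC.
  - by apply: emeasurable_funM; [exact: mh|exact: mpz].
  - by move=> x; rewrite mule_ge0.
have mprod : measurable_fun setT (fun w : MR * MR => (h w.2 * (b^-1 * (pdf 0 1 w.1 *
    pdf 0 1 ((w.2 - a * w.1) / b)))%:E)%E).
  apply: emeasurable_funM; first by apply: (measurableT_comp mh).
  apply/measurable_EFinP; apply: measurable_funM; first exact: measurable_cst.
  apply: measurable_funM.
    by apply: (measurableT_comp (@measurable_normal_pdf R 0 1)); exact: measurable_fst.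
  apply: (measurableT_comp (@measurable_normal_pdf R 0 1)).
  apply: measurable_funM; last exact: measurable_cst.
  apply: measurable_funB; first exact: measurable_snd.
  by apply: measurable_funM; [exact: measurable_cst|exact: measurable_fst].
transitivity (\int[mu]_z \int[mu]_s (h s * (b^-1 * (pdf 0 1 z *
    pdf 0 1 ((s - a * z) / b)))%:E))%E.
  under eq_integral do rewrite inner.
  have mI : measurable_fun setT
      (fun z : MR => \int[mu]_s (h s * (pdf 0 1 ((s - a * z) / b))%:E))%E.
    apply: (measurable_fun_fubini_tonelli_F (fun w => h w.2 * (pdf 0 1 ((w.2 - a * w.1) /
      b))%:E)%E).
      apply: emeasurable_funM; first by apply: (measurableT_comp mh).
      apply: (measurableT_comp mpdf).
      apply: measurable_funM; last exact: measurable_cst.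
      apply: measurable_funB; first exact: measurable_snd.
      by apply: measurable_funM; [exact: measurable_cst|exact: measurable_fst].
    by move=> w; rewrite mule_ge0.
  rewrite ge0_integral_normal; last 2 first.
  - by apply: emeasurable_funM => //; exact: measurable_cst.
  - move=> z; rewrite mule_ge0 ?lee_fin ?invr_ge0 ?(ltW b0)//.
    by apply: integral_ge0 => s _; rewrite mule_ge0.
  apply: eq_integral => z _.
  rewrite muleAC -EFinM -ge0_integralZl//; last 3 first.
  - exact: emeasurable_funM.
  - by move=> s _; rewrite mule_ge0.
  - by rewrite lee_fin mulr_ge0 ?invr_ge0 ?(ltW b0)// normal_pdf_ge0.
  by apply: eq_integral => s _; rewrite muleCA -EFinM mulrA.
rewrite tonelli_swap; [|exact: mprod|]; last first.
  move=> z s; rewrite mule_ge0// lee_fin mulr_ge0 ?invr_ge0 ?(ltW b0)// mulr_ge0//;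
  exact: normal_pdf_ge0.
have mhc : measurable_fun setT (fun z : MR => h (c * z)%R).
  under eq_fun do rewrite -[X in h X]addr0.
  exact: (measurableT_comp mh (maff _ _)).
have mpc : measurable_fun setT (fun s : MR => (pdf 0 1 (s / c))%:E).
  have -> : (fun s : MR => (pdf 0 1 (s / c))%:E) =
      (fun x : MR => (pdf 0 1 x)%:E) \o (fun s => c^-1 * s + 0).
    by apply/funext => s /=; rewrite addr0 mulrC.
  exact: (measurableT_comp mpdf (maff _ _)).
rewrite ge0_integral_normal//.
transitivity (c^-1%:E * \int[mu]_s (h s * (pdf 0 1 (s / c))%:E))%E; last first.
  have H := @ge0_integral_lebesgue_affine R c 0 (fun s => (h s * (pdf 0 1 (s / c))%:E)%E) c0.
  apply: etrans (esym (H _ _)) _.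
  - by apply: emeasurable_funM; [exact: mh|exact: mpc].
  - by move=> x; rewrite mule_ge0.
  by apply: eq_integral => s _; rewrite addr0 mulrAC mulfV ?mul1r// gt_eqF.
rewrite -ge0_integralZl//; last 3 first.
- exact: emeasurable_funM.
- by move=> s _; rewrite mule_ge0.
- by rewrite lee_fin invr_ge0 ltW.
apply: eq_integral => s _.
under eq_integral do rewrite (normal_pdf_product _ _ b0 c0 abc) EFinM muleA.
rewrite ge0_integralZl//; last 2 first.
- by apply/measurable_EFinP; exact: measurable_normal_pdf.
- by rewrite mule_ge0// lee_fin mulr_ge0 ?invr_ge0 ?(ltW c0)// normal_pdf_ge0.
by rewrite integral_normal_pdf mule1 EFinM muleCA.
Qed.

Lemma Rintegral_gauss_stable (a b c : R) (h : MR -> R) :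
  0 < b -> 0 < c -> a ^+ 2 + b ^+ 2 = c ^+ 2 -> bmeas h ->
  \int[gauss]_z (\int[gauss]_z' h (a * z + b * z')) = \int[gauss]_z h (c * z).
Proof.
move=> b0 c0 abc bh; have [mh [C hC]] := bh.
have m2 : measurable_fun setT (fun w : MR * MR => a * w.1 + b * w.2 : MR).
  by apply: measurable_funD; apply: measurable_funM;
    [exact: measurable_cst|exact: measurable_fst|exact: measurable_cst|exact: measurable_snd].
have b2 : bmeas (fun w : MR * MR => h (a * w.1 + b * w.2)) := bmeas_comp m2 bh.
have bz z : bmeas (fun z' : MR => h (a * z + b * z')).
  exact: (bmeas_section1 (h := fun z z' => h (a * z + b * z')) b2).
have bi : bmeas (fun z : MR => \int[gauss]_z' h (a * z + b * z')).
  exact: (bmeas_Rintegral (gauss : probability MR R) (h := fun z z' => h (a * z + b * z')) b2).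
have bc : bmeas (fun z : MR => h (c * z)).
  apply: (bmeas_comp _ bh).
  by apply: measurable_funM; [exact: measurable_cst|exact: measurable_id].
have bC := bmeas_cst _ C.
apply: (@addIr _ C); apply: EFin_inj; rewrite !addC_Rintegral// !EFin_Rintegral//;
  [|exact: bmeasD..].
rewrite -(ge0_integral_gauss_stable b0 c0 abc (h := fun x => (h x + C)%:E)).
- apply: eq_integral => z _; rewrite addC_Rintegral// EFin_Rintegral//; exact: bmeasD.
- by apply/measurable_EFinP; apply: measurable_funD => //; exact: measurable_cst.
- by move=> x; rewrite lee_fin -lerBlDr sub0r; have := hC x; rewrite ler_norml => /andP[].
Qed.

Lemma ge0_integral_gaussN (h : MR -> \bar R) :
  measurable_fun setT h -> (forall x, 0 <= h x)%E ->
  (\int[gauss]_x h (- x)%R = \int[gauss]_x h x)%E.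
Proof.
move=> mh h0.
have mN : measurable_fun setT (fun x : MR => - x : MR).
  under eq_fun do rewrite -mulN1r.
  by apply: measurable_funM; [exact: measurable_cst|exact: measurable_id].
have mpdf : measurable_fun setT (fun x : MR => (pdf 0 1 x)%:E).
  by apply/measurable_EFinP; exact: measurable_normal_pdf.
have pdfN x : pdf 0 1 (- x) = pdf 0 1 x.
  by rewrite !(normal_pdfE _ (oner_neq0 R)) /normal_fun !subr0 sqrrN.
rewrite !ge0_integral_normal//; last exact: (measurableT_comp mh mN).
pose k x := (h x * (pdf 0 1 x)%:E)%E.
have mk : measurable_fun setT k by exact: emeasurable_funM.
transitivity (\int[mu]_x k (- x)%R)%E.
  by apply: eq_integral => x _; rewrite /k pdfN.
transitivity (\int[pushforward mu (-%R : MR -> MR)]_x k x)%E.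
  rewrite (@ge0_integral_pushforward _ _ _ _ _ _ mN)//= => x _.
  by rewrite /k mule_ge0// lee_fin normal_pdf_ge0.
by apply: eq_measure_integral => A mA _; exact: lebesgue_measureN.
Qed.

End gauss1.

Section integral_preserving.
Local Open Scope ereal_scope.
Context d1 d2 (T1 : measurableType d1) (T2 : measurableType d2) (R : realType).
Variables (P : {measure set T1 -> \bar R}) (Q : {measure set T2 -> \bar R}) (phi : T1 -> T2).
Hypothesis ge0_PQ : forall h : T2 -> \bar R, measurable_fun setT h -> (forall x, 0 <= h x) ->
  \int[P]_x h (phi x) = \int[Q]_x h x.

Lemma integral_preserving (h : T2 -> \bar R) : measurable_fun setT h ->
  \int[P]_x h (phi x) = \int[Q]_x h x.
Proof.
move=> mh; rewrite [LHS]integralE [RHS]integralE.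
rewrite -(ge0_PQ (measurable_funepos mh) (fun x => funepos_ge0 h x)).
rewrite -(ge0_PQ (measurable_funeneg mh) (fun x => funeneg_ge0 h x)).
by congr (_ - _); apply: eq_integral => x _; rewrite (funeposE, funenegE) ?(funeposE, funenegE).
Qed.

Lemma integrable_preserving (h : T2 -> \bar R) :
  measurable_fun setT phi -> Q.-integrable setT h -> P.-integrable setT (h \o phi).
Proof.
move=> mphi /integrableP[mh hoo]; apply/integrableP; split.
  exact: measurableT_comp.
by rewrite (ge0_PQ (h := fun x => `|h x|))//; exact: measurableT_comp.
Qed.

End integral_preserving.

Section marginal.
Context d (T : measurableType d) (R : realType) (P : probability T R).

Lemma ge0_integral_iid_tnth n (i : 'I_n) (h : T -> \bar R) :
  measurable_fun setT h -> (forall x, 0 <= h x)%E ->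
  (\int[iid_ P n]_t h (tnth t i) = \int[P]_x h x)%E.
Proof.
move=> mh h0; elim: n i => [[]//|n IHn] i.
have mt : measurable_fun setT (fun t : n.+1.-tuple T => h (tnth t i)).
  by apply: (measurableT_comp mh); exact: measurable_tnth.
rewrite [LHS](ge0_integral_power_measureS P mt); last by move=> t; exact: h0.
case: (unliftP ord0 i) => [j|] ->.
  under eq_integral.
    move=> x _; rewrite (_ : integral _ _ _ = \int[P]_x h x)%E; last first.
      by rewrite -[RHS](IHn j); apply: eq_integral => t _; rewrite tnthS; congr (h (tnth _ _));
        apply/val_inj.
    over.
  by rewrite integral_cst// [X in (_ * X)%E](probability_setT P) mule1.
apply: eq_integral => x _; transitivity (\int[iid_ P n]_t h x)%E; first by [].
rewrite integral_cst//.
by rewrite [X in (_ * X)%E](probability_setT (iid_ P n : probability _ R)) mule1.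
Qed.

End marginal.

Section exp_bounds.
Context {R : realType}.
Implicit Types x r v : R.

(** From exp(y) >= 1 + y the square dominates (1 + x^2/8)^2; 64 copies cover x^4 and one more covers
    the constant. *)
Lemma quartic_le_expR x : 1 + x ^+ 4 <= 65 * expR (x ^+ 2 / 8) ^+ 2.
Proof.
have e1 := expR_ge1Dx (x ^+ 2 / 8).
have x2 : 0 <= x ^+ 2 by rewrite sqr_ge0.
have : (1 + x ^+ 2 / 8) ^+ 2 <= expR (x ^+ 2 / 8) ^+ 2.
  by rewrite lerXn2r ?nnegrE ?expR_ge0//; lra.
have : x ^+ 4 = x ^+ 2 ^+ 2 by ring.
move: (expR (x ^+ 2 / 8) ^+ 2) (x ^+ 2) x2 => e u u0 ->; nra.
Qed.

Lemma expRN_expansion v : 0 <= v -> 0 <= expR (- v) - 1 + v <= v ^+ 2.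
Proof.
move=> v0; have e1 := expR_ge1Dx (- v); have e2 := expR_ge1Dx v.
have e3 : expR v * expR (- v) = 1 by rewrite -expRD subrr expR0.
apply/andP; split; first lra.
have e0 : 0 < expR (- v) by exact: expR_gt0.
have : (1 + v) * expR (- v) <= 1 by rewrite -[leRHS]e3 ler_wpM2r// ltW.
move: (expR (- v)) e1 e0 => e e1 e0 e4.
nra.
Qed.

Lemma expRN_sqr_expansion r x : 0 <= r ->
  0 <= expR (- (r * x ^+ 2 / 2)) - 1 + r / 2 * x ^+ 2 <= r ^+ 2 / 4 * `|x| ^+ 4.
Proof.
move=> r0; have v0 : 0 <= r * x ^+ 2 / 2 by rewrite mulr_ge0// mulr_ge0// sqr_ge0.
have /andP[h1 h2] := expRN_expansion v0.
rewrite (_ : r / 2 * x ^+ 2 = r * x ^+ 2 / 2); last by ring.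
rewrite h1/= (le_trans h2)// -normrX ger0_norm ?exprn_even_ge0//.
by rewrite le_eqVlt; apply/orP; left; apply/eqP; field.
Qed.

Lemma le_sqr_add (a b : R) : `|a * b| <= `| `|a| ^+ 2 + `|b| ^+ 2 |.
Proof.
rewrite [leRHS]ger0_norm ?addr_ge0 ?sqr_ge0// normrM.
move: (normr_ge0 a) (normr_ge0 b) (`|a|) (`|b|) => _ _ u v.
have := sqr_ge0 (u - v); have := sqr_ge0 u; have := sqr_ge0 v.
rewrite sqrrB; lra.
Qed.

End exp_bounds.

Section gauss_moments.
Context {R : realType}.
Notation gauss := (@normal_prob R 0 1).
Notation pdf := (@normal_pdf R).
Notation MR := (measurableTypeR R).

(* Letting [s] tend to 1 gives the variance, since the integrand is
   1 + (s - 1) x^2 + O((s - 1)^2 (1 + x^4)). *)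
Lemma normal_exp_moment (s : R) : 0 < s ->
  (\int[gauss]_x (expR ((1 - s ^- 2) * x ^+ 2 / 2))%:E = s%:E)%E.
Proof.
move=> s0; have s1 : s != 0 by rewrite gt_eqF.
have mk : measurable_fun setT (fun x : MR => expR ((1 - s ^- 2) * x ^+ 2 / 2)).
  apply: (measurableT_comp (@measurable_expR R)).
  apply: measurable_funM; last exact: measurable_cst.
  by apply: measurable_funM; [exact: measurable_cst|apply: measurable_funX; exact: measurable_id].
rewrite ge0_integral_normal; last 2 first.
- exact: (proj2 (measurable_EFinP _ _) mk).
- by move=> x; rewrite lee_fin expR_ge0.
transitivity (\int[lebesgue_measure]_x (s%:E * (pdf 0 s x)%:E))%E.
  apply: eq_integral => x _; rewrite -!EFinM; congr EFin.
  rewrite (normal_pdf_scale _ s0) mulVKf//.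
  rewrite !(normal_pdfE _ (oner_neq0 R)) mulrCA -expRD; congr (_ * expR _).
  by rewrite !subr0 expr1n; field.
rewrite ge0_integralZl//; last 3 first.
- by apply/measurable_EFinP; exact: measurable_normal_pdf.
- by move=> x _; rewrite lee_fin normal_pdf_ge0.
- by rewrite lee_fin ltW.
by rewrite integral_normal_pdf mule1.
Qed.

Lemma gauss_integrable (h : MR -> R) (C : R) : measurable_fun setT h ->
  (forall x, `|h x| <= C * (1 + x ^+ 4)) -> gauss.-integrable setT (EFin \o h).
Proof.
move=> mh hC; have C0 : 0 <= C by have := hC 0; rewrite expr0n addr0 mulr1; exact: le_trans.
(* At s = sqrt 2 the exponent is x^2 / 4, twice the x^2 / 8 of [quartic_le_expR]. *)
have s2 : 0 < Num.sqrt 2 :> R by rewrite sqrtr_gt0.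
have H := normal_exp_moment s2.
have E x : expR ((1 - Num.sqrt 2 ^- 2) * x ^+ 2 / 2) = expR (x ^+ 2 / 8) ^+ 2 :> R.
  rewrite -expRM_natl; congr expR; rewrite sqr_sqrtr//; by field.
pose g (x : R) := C * 65 * expR (x ^+ 2 / 8) ^+ 2.
have mx2 : measurable_fun setT (fun x : MR => expR (x ^+ 2 / 8) ^+ 2).
  apply: measurable_funX; apply: (measurableT_comp (@measurable_expR R)).
  by apply: measurable_funM; [apply: measurable_funX; exact: measurable_id|exact: measurable_cst].
have ig : gauss.-integrable setT (EFin \o g).
  apply: (integrableZl measurableT (C * 65) (f := fun x : MR => (expR (x ^+ 2 / 8) ^+ 2)%:E)).
  apply/integrableP; split; first exact: (proj2 (measurable_EFinP _ _) mx2).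
  under eq_integral do rewrite gee0_abs ?lee_fin ?sqr_ge0// -E.
  by rewrite H ltry.
apply: le_integrable ig => //; first exact/measurable_EFinP.
move=> x _ /=; rewrite lee_fin; apply: (le_trans (hC x)).
rewrite (le_trans _ (ler_norm _))// /g -mulrA ler_wpM2l//.
exact: quartic_le_expR.
Qed.

Lemma gauss_mean0 : \int[gauss]_x (x : R) = 0.
Proof.
have i1 : gauss.-integrable setT (EFin \o (fun x : MR => x)).
  apply: (@gauss_integrable _ 1); first exact: measurable_id.
  move=> x; rewrite mul1r; have [x1|x1] := leP `|x| 1.
    by rewrite (le_trans x1)// lerDl exprn_even_ge0.
  apply: (@le_trans _ _ (`|x| ^+ 4)); first by rewrite -[leLHS]expr1 ler_weXn2l// ltW.
  by rewrite -normrX ger0_norm ?exprn_even_ge0// lerDr.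
have H := @integral_preserving _ _ _ _ R gauss gauss (fun x : MR => - x)
   (@ge0_integral_gaussN R) (EFin \o (fun x : MR => x)) (measurable_int _ i1).
have : \int[gauss]_x (- x : R) = \int[gauss]_x (x : R) by rewrite /Rintegral H.
under eq_Rintegral do rewrite -mulN1r.
rewrite RintegralZl// mulN1r => /eqP; rewrite eqNr => /eqP.
exact.
Qed.

Lemma gauss_integrableX k : (k <= 4)%N ->
  gauss.-integrable setT (EFin \o (fun x : MR => `|x| ^+ k)).
Proof.
move=> k4; apply: (@gauss_integrable _ 1).
  by apply: measurable_funX; exact: (measurableT_comp (@normr_measurable R setT)).
move=> x; rewrite mul1r normrX normr_id; have [x1|x1] := leP `|x| 1.
  by rewrite (@le_trans _ _ 1) ?exprn_ile1// lerDl exprn_even_ge0.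
apply: (@le_trans _ _ (`|x| ^+ 4)); first by rewrite ler_weXn2l// ltW.
by rewrite -normrX ger0_norm ?exprn_even_ge0// lerDr.
Qed.

(** For s <= 1 the exponent in [normal_exp_moment] is nonpositive, so the second-order expansion of
    the exponential has a two-sided bound. Integrating it traps c between two quantities that tend
    to 1 as s increases to 1; fourth moments enter only through the finite constant M. *)
Lemma gauss_variance : \int[gauss]_x ((x : R) ^+ 2) = 1.
Proof.
set c := Rintegral _ _ _.
pose M := \int[gauss]_x (`|x : R| ^+ 4).
have i2 : gauss.-integrable setT (EFin \o (fun x : MR => x ^+ 2)).
  have := @gauss_integrableX 2 isT; apply: eq_integrable => // x _ /=.
  by rewrite real_normK// num_real.
have i4 := @gauss_integrableX 4 isT.
have M0 : 0 <= M by apply: Rintegral_ge0.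
have key (s : R) : 0 < s -> s <= 1 ->
   0 <= s - 1 + (s ^- 2 - 1) / 2 * c <= (s ^- 2 - 1) ^+ 2 / 4 * M.
  move=> s0 s1; set r := s ^- 2 - 1.
  have r0 : 0 <= r by rewrite subr_ge0 invf_ge1 ?exprn_gt0// exprn_ile1// ltW.
  pose k (x : MR) := expR (- (r * x ^+ 2 / 2)).
  have bk : bmeas k.
    split.
      apply: (measurableT_comp (@measurable_expR R)); apply: measurableT_comp => //.
      apply: measurable_funM; last exact: measurable_cst.
      by apply: measurable_funM; [exact: measurable_cst|apply: measurable_funX;
        exact: measurable_id].
    exists 1 => x; rewrite ger0_norm ?expR_ge0// /k -[leRHS]expR0 ler_expR oppr_le0.
    by rewrite mulr_ge0// mulr_ge0// (sqr_ge0 (x : R)).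
  have Ek : \int[gauss]_x k x = s.
    have := normal_exp_moment s0; rewrite /Rintegral => H.
    rewrite (_ : integral _ _ _ = s%:E)//= -H; apply: eq_integral => x _.
    by congr (expR _)%:E; rewrite /r; ring.
  have bk1 := bmeasB bk (bmeas_cst _ (1 : R)).
  have ik1 := bmeas_integrable gauss bk1.
  have ir2 : gauss.-integrable setT (EFin \o (fun x : MR => r / 2 * x ^+ 2)).
    exact: (integrableZl _ (r / 2) i2).
  have ir4 : gauss.-integrable setT (EFin \o (fun x : MR => r ^+ 2 / 4 * `|x| ^+ 4)).
    exact: (integrableZl _ (r ^+ 2 / 4) i4).
  have Eq : s - 1 + r / 2 * c = \int[gauss]_x (k x - 1 + r / 2 * (x : R) ^+ 2).
    rewrite RintegralD// RintegralZl// (RintegralB_bm gauss bk (bmeas_cst _ (1 : R))).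
    by rewrite Ek Rintegral_prob_cst.
  have iD : gauss.-integrable setT (EFin \o (fun x : MR => k x - 1 + r / 2 * x ^+ 2)).
    exact: (integrableD _ ik1 ir2).
  have B (x : R) : 0 <= k x - 1 + r / 2 * x ^+ 2 <= r ^+ 2 / 4 * `|x| ^+ 4.
    exact: expRN_sqr_expansion.
  apply/andP; split.
    by rewrite Eq; apply: Rintegral_ge0 => x _; have /andP[] := B x.
  rewrite Eq /M -RintegralZl//; apply: le_Rintegral => // x _.
  by have /andP[] := B x.
have c0 : 0 <= c by apply: Rintegral_ge0 => x _; rewrite sqr_ge0.
apply/eqP; rewrite -subr_eq0 -normr_le0; apply/ler_addgt0Pl => e e0; rewrite addr0.
(* With s = 1 - d the lower bound for c is s^2 >= 1 - 2 d, and the upper one is 1 + 16 M d because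
   ((1 + s) q)^2 / 4 <= 16; hence 2 + 16 M. *)
pose d := Num.min 2^-1 (e / (2 + 16 * M)).
have KM : 0 < 2 + 16 * M by lra.
have d0 : 0 < d by rewrite lt_min invr_gt0 ltr0n/= divr_gt0.
have d12 : d <= 2^-1 by rewrite ge_min lexx.
have de : (2 + 16 * M) * d <= e by rewrite mulrC -ler_pdivlMr// ge_min lexx orbT.
pose s := 1 - d; have s0 : 0 < s by rewrite /s; lra.
have s12 : 2^-1 <= s by rewrite /s; lra.
have s1 : s <= 1 by rewrite /s; lra.
have := key s s0 s1; set q := s ^- 2.
have qs : q * s ^+ 2 = 1 by rewrite /q mulVf// gt_eqF// exprn_gt0.
have q1 : 1 <= q by rewrite invf_ge1 ?exprn_gt0// exprn_ile1// ltW.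
have q4 : q <= 4.
  rewrite /q -[leRHS]invrK lef_pV2 ?posrE ?exprn_gt0// ?invr_gt0//.
  have : 2^-1 * 2^-1 <= s * s by apply: ler_pM.
  by rewrite expr2 (_ : 4^-1 = 2^-1 * 2^-1)//; field.
have qd : q - 1 = d * ((1 + s) * q) by rewrite -[in LHS]qs /s; ring.
have dE : s - 1 = - d by rewrite /s; ring.
rewrite qd dE => /andP[h1 h2].
have {h1}h1 : 1 <= (1 + s) * q * c / 2.
  rewrite -(ler_pM2l d0); lra.
have {h2}h2 : (1 + s) * q * c / 2 <= 1 + d * (((1 + s) * q) ^+ 2 * M / 4).
  rewrite -(ler_pM2l d0); lra.
have w2 : (1 + s) * q <= 8 by nra.
have w2' : 2 <= (1 + s) * q.
  have : s * q <= q by rewrite ler_piMl// ltW// (lt_le_trans _ q1).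
  have : 1 <= s * q.
    by rewrite -qs mulrC expr2 ler_wpM2r ?(le_trans _ q1)// ler_piMr// ltW.
  lra.
have W : ((1 + s) * q) ^+ 2 <= 64 by rewrite (_ : 64 = 8 ^+ 2) ?lerXn2r ?nnegrE//; [lra|ring].
rewrite ler_norml; apply/andP; split.
  have : (1 + s) * q * c * s ^+ 2 = (1 + s) * c.
    by rewrite -[RHS]mulr1 -qs; ring.
  have : s ^+ 2 * 1 <= s ^+ 2 * ((1 + s) * q * c / 2) by rewrite ler_wpM2l// sqr_ge0.
  have : (1 + s) * c / 2 <= c.
    have : s * c <= c by rewrite ler_piMl.
    lra.
  have : 0 <= d * M by rewrite mulr_ge0// ltW.
  have : 0 <= d ^+ 2 by exact: sqr_ge0.
  have : s ^+ 2 = 1 - 2 * d + d ^+ 2 by rewrite /s; ring.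
  move: de; lra.
have : c <= (1 + s) * q * c / 2 by rewrite ler_pdivlMr// mulrC ler_wpM2r.
have : d * (((1 + s) * q) ^+ 2 * M / 4) <= d * (16 * M).
  rewrite ler_wpM2l ?(ltW d0)//.
  have : ((1 + s) * q) ^+ 2 * M <= 64 * M by rewrite ler_wpM2r.
  lra.
lra.
Qed.

End gauss_moments.

Section gauss_tuple.
Context {R : realType} (p : nat).
Notation gauss := (@normal_prob R 0 1).
Notation MR := (measurableTypeR R).
Notation G := (iid_ gauss p : probability (p.-tuple MR) R).

Lemma gauss_tuple_integrable (i : 'I_p) k : (k <= 4)%N ->
  G.-integrable setT (EFin \o (fun t : p.-tuple MR => `|tnth t i| ^+ k)).
Proof.
move=> k4; apply: (@integrable_preserving _ _ _ _ R G gauss (fun t => tnth t i) _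
  (EFin \o (fun x : MR => `|x| ^+ k))).
- by move=> h mh h0; exact: ge0_integral_iid_tnth.
- exact: measurable_tnth.
- exact: gauss_integrableX.
Qed.

Lemma gauss_tuple_marginal (i : 'I_p) (h : MR -> R) : measurable_fun setT h ->
  \int[G]_t h (tnth t i) = \int[gauss]_x h x.
Proof.
move=> mh; rewrite /Rintegral; congr fine.
apply: (@integral_preserving _ _ _ _ R G gauss (fun t => tnth t i) _ (EFin \o h)).
- by move=> g mg g0; exact: ge0_integral_iid_tnth.
- exact/measurable_EFinP.
Qed.

Lemma gauss_tuple_mean (i : 'I_p) : \int[G]_t (tnth t i : R) = 0.
Proof.
rewrite (gauss_tuple_marginal i (h := id)); last exact: measurable_id.
exact: gauss_mean0.
Qed.

Lemma measurable_tnth_mul (i j : 'I_p) :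
  measurable_fun setT (fun t : p.-tuple MR => tnth t i * tnth t j : R).
Proof. by apply: measurable_funM; exact: measurable_tnth. Qed.

Lemma gauss_tuple_integrableM (i j : 'I_p) :
  G.-integrable setT (EFin \o (fun t : p.-tuple MR => tnth t i * tnth t j)).
Proof.
have H := integrableD measurableT (@gauss_tuple_integrable i 2 isT)
  (@gauss_tuple_integrable j 2 isT).
apply: le_integrable H => //.
  by apply/measurable_EFinP; exact: measurable_tnth_mul.
move=> t _; have L := le_sqr_add (tnth t i) (tnth t j).
by rewrite -lee_fin in L; exact: L.
Qed.

(* For [i != j], change the sign of the i-th coordinate. *)
Lemma gauss_tuple_cov (i j : 'I_p) : \int[G]_t (tnth t i * tnth t j : R) = (i == j)%:R.
Proof.
have [<-|ij] := eqVneq i j.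
  rewrite -[RHS]gauss_variance -(gauss_tuple_marginal i (h := fun x => x ^+ 2)).
    by apply: eq_Rintegral => t _; rewrite expr2.
  by apply: measurable_funX; exact: measurable_id.
have mN : measurable_fun setT (fun x : MR => - x : MR).
  under eq_fun do rewrite -mulN1r.
  by apply: measurable_funM; [exact: measurable_cst|exact: measurable_id].
pose phi (k : 'I_p) (x : MR) : MR := if k == i then - x else x.
have mphi k : measurable_fun setT (phi k).
  by rewrite /phi; case: (k == i); [exact: mN|exact: measurable_id].
have mp : measurable_fun setT (map_coords phi) by exact: measurable_map_coords.
have H : (\int[G]_t ((tnth (map_coords phi t) i * tnth (map_coords phi t) j : R)%:E) =
  \int[G]_t ((tnth t i * tnth t j : R)%:E))%E.
  apply: (@integral_preserving _ _ _ _ R G G (map_coords phi) _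
    (EFin \o (fun t : p.-tuple MR => tnth t i * tnth t j))).
    move=> h mh h0; apply: (@ge0_integral_map_coords _ _ _ gauss p phi h) => // k g mg g0.
    by rewrite /phi; case: (k == i) => //; exact: ge0_integral_gaussN.
  by apply/measurable_EFinP; exact: measurable_tnth_mul.
have : \int[G]_t (- (tnth t i * tnth t j) : R) = \int[G]_t (tnth t i * tnth t j : R).
  rewrite {2}/Rintegral -H; congr fine; apply: eq_integral => t _.
  by rewrite !tnth_mktuple /phi eqxx eq_sym (negbTE ij) mulNr.
under eq_Rintegral do rewrite -mulN1r.
rewrite RintegralZl//; last exact: gauss_tuple_integrableM.
by rewrite mulN1r => /eqP; rewrite eqNr => /eqP.
Qed.

End gauss_tuple.

Section gauss_tuple_stable.
Context {R : realType}.
Notation gauss := (@normal_prob R 0 1).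
Notation MR := (measurableTypeR R).

(** [lincomb_tuple c 0 t t] is c times t, so the same map expresses both sides of the stability
    identity. *)
Definition lincomb_tuple p (a b : R) (s t : p.-tuple MR) : p.-tuple MR :=
  [tuple (a * tnth s i + b * tnth t i : MR) | i < p].

Lemma measurable_lincomb_tuple p (a b : R) :
  measurable_fun setT (fun z : p.-tuple MR * p.-tuple MR => lincomb_tuple a b z.1 z.2).
Proof.
apply/measurable_fun_tnthP => i.
rewrite (_ : _ \o _ = fun z : p.-tuple MR * p.-tuple MR => a * tnth z.1 i + b * tnth z.2 i).
  apply: measurable_funD; apply: measurable_funM; (try exact: measurable_cst);
  by apply: (measurableT_comp (measurable_tnth i)).
by apply/funext => z /=; rewrite tnth_mktuple.
Qed.

Lemma lincomb_tuple_cons p (a b : R) x x' (t t' : p.-tuple MR) :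
  lincomb_tuple a b (tuple_cons (x, t)) (tuple_cons (x', t')) =
  tuple_cons (a * x + b * x' : MR, lincomb_tuple a b t t').
Proof.
apply: eq_from_tnth => i; rewrite tnth_mktuple.
case: (unliftP ord0 i) => [j|] ->; last by [].
by rewrite !tnthS tnth_mktuple.
Qed.

Lemma gauss_tuple_stable p (a b c : R) (h : p.-tuple MR -> R) :
  0 < b -> 0 < c -> a ^+ 2 + b ^+ 2 = c ^+ 2 -> bmeas h ->
  \int[iid_ gauss p]_t (\int[iid_ gauss p]_t' h (lincomb_tuple a b t t')) =
  \int[iid_ gauss p]_t h (lincomb_tuple c 0 t t).
Proof.
move=> b0 c0 abc; elim: p h => [|p IHp] h bh.
  by rewrite !Rintegral_iid0; congr h; rewrite tuple0 [RHS]tuple0.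
have bl : bmeas (fun z : p.+1.-tuple MR * p.+1.-tuple MR => h (lincomb_tuple a b z.1 z.2)).
  exact: (bmeas_comp (@measurable_lincomb_tuple _ a b) bh).
pose G := iid_ gauss p : probability (p.-tuple MR) R.
have mcons d (T : measurableType d) (u : T -> MR) (v : T -> p.-tuple MR) :
    measurable_fun setT u -> measurable_fun setT v ->
    bmeas (fun z => h (tuple_cons (u z, v z))).
  move=> mu mv; apply: (bmeas_comp _ bh).
  apply: (measurableT_comp (@measurable_tuple_cons_pair _ MR p) (g := fun z => (u z, v z))).
  exact/measurable_fun_pairP.
have mlin d (T : measurableType d) (u v : T -> MR) :
    measurable_fun setT u -> measurable_fun setT v ->
    measurable_fun setT (fun z => a * u z + b * v z : MR).
  by move=> mu mv; apply: measurable_funD; apply: measurable_funM => //; exact: measurable_cst.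
rewrite Rintegral_iidS; last first.
  exact: (bmeas_Rintegral (iid_ gauss p.+1 : probability _ R)
    (h := fun t t' => h (lincomb_tuple a b t t'))).
have mlc d (T : measurableType d) (u v : T -> p.-tuple MR) a' b' :
    measurable_fun setT u -> measurable_fun setT v ->
    measurable_fun setT (fun z => lincomb_tuple a' b' (u z) (v z)).
  move=> mu mv; apply: (measurableT_comp (@measurable_lincomb_tuple p a' b')
    (g := fun z => (u z, v z))).
  exact/measurable_fun_pairP.
pose H (y : MR) := \int[G]_t h (tuple_cons (y, lincomb_tuple c 0 t t)).
have bH : bmeas H.
  apply: (bmeas_Rintegral G (h := fun y t => h (tuple_cons (y, lincomb_tuple c 0 t t)))).
  apply: mcons; first exact: measurable_fst.
  by apply: mlc; exact: measurable_snd.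
transitivity (\int[gauss]_x (\int[gauss]_x' H (a * x + b * x'))).
  apply: eq_Rintegral => x _.
  transitivity (\int[G]_t \int[gauss]_x' \int[G]_t'
      h (tuple_cons (a * x + b * x' : MR, lincomb_tuple a b t t'))).
    apply: eq_Rintegral => t _; rewrite Rintegral_iidS; last first.
      exact: (bmeas_section1 (h := fun t t' => h (lincomb_tuple a b t t')) bl (tuple_cons (x, t))).
    by apply: eq_Rintegral => x' _; apply: eq_Rintegral => t' _; rewrite lincomb_tuple_cons.
  (* The tail t and the head x' change places, which makes the two tails adjacent for the induction
     hypothesis and leaves the two heads to the one-dimensional stability. *)
  rewrite Rintegral_swap; last first.
    apply: (bmeas_Rintegral G (h := fun z t' =>
      h (tuple_cons (a * x + b * z.2 : MR, lincomb_tuple a b z.1 t')))).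
    apply: mcons; first apply: mlin; first exact: measurable_cst.
      exact: (measurableT_comp measurable_snd measurable_fst).
    apply: mlc; last exact: measurable_snd.
    exact: (measurableT_comp measurable_fst measurable_fst).
  apply: eq_Rintegral => x' _.
  apply: (IHp (fun u => h (tuple_cons (a * x + b * x' : MR, u)))).
  by apply: mcons; [exact: measurable_cst|exact: measurable_id].
rewrite (Rintegral_gauss_stable b0 c0 abc bH) Rintegral_iidS; last first.
  apply: (bmeas_comp _ bh (phi := fun t => lincomb_tuple c 0 t t)).
  apply: (measurableT_comp (@measurable_lincomb_tuple p.+1 c 0) (g := fun z => (z, z))).
  by apply/measurable_fun_pairP; split; exact: measurable_id.
apply: eq_Rintegral => x _; apply: eq_Rintegral => t _.
by rewrite lincomb_tuple_cons mul0r addr0.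
Qed.

End gauss_tuple_stable.

(** * Central limit theorem for triangular arrays *)

Section integrable_sums.
Context d (T : measurableType d) (R : realType) (P : probability T R).
Notation intble h := (P.-integrable setT (EFin \o h)).

Lemma integrable_sumR I (s : seq I) (h : I -> T -> R) :
  (forall i, intble (h i)) -> intble (fun x => \sum_(i <- s) h i x).
Proof.
move=> ih; elim: s => [|i s IHs].
  by under eq_fun do rewrite big_nil; apply: bmeas_integrable; exact: bmeas_cst.
under eq_fun do rewrite big_cons.
exact: (integrableD measurableT (ih i) IHs).
Qed.

Lemma Rintegral_sumR I (s : seq I) (h : I -> T -> R) :
  (forall i, intble (h i)) ->
  \int[P]_x (\sum_(i <- s) h i x) = \sum_(i <- s) \int[P]_x h i x.
Proof.
move=> ih; elim: s => [|i s IHs].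
  by under eq_Rintegral do rewrite big_nil; rewrite Rintegral_prob_cst big_nil.
under eq_Rintegral do rewrite big_cons.
by rewrite RintegralD// ?IHs ?big_cons//; exact: integrable_sumR.
Qed.

Lemma integrable_le (h g : T -> R) : measurable_fun setT h ->
  (forall x, `|h x| <= g x) -> intble g -> intble h.
Proof.
move=> mh hg ig; apply: le_integrable ig => //; first exact/measurable_EFinP.
move=> x _; have L : `|h x| <= `|g x| by rewrite (le_trans (hg x))// ler_norm.
by rewrite -lee_fin in L; exact: L.
Qed.

Lemma norm_Rintegral_dom (h g : T -> R) : measurable_fun setT h ->
  (forall x, `|h x| <= g x) -> intble g -> `|\int[P]_x h x| <= \int[P]_x g x.
Proof.
move=> mh hg ig; have ih := integrable_le mh hg ig.
apply: (le_trans (le_normr_Rintegral measurableT ih)).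
apply: le_Rintegral => //.
apply: (integrable_le _ _ ig); first exact: measurableT_comp.
by move=> x; rewrite normr_id.
Qed.

End integrable_sums.

Section one_step.
Context d (T : measurableType d) (R : realType) (P : probability T R) (p : nat).
Notation V := 'cV[R]_p.
Notation MR := (measurableTypeR R).
Notation intble h := (P.-integrable setT (EFin \o h)).
Variables (Y : T -> V).
Hypothesis mY : measurable_fun setT Y.
Hypothesis iY : intble (fun x => norm1 (Y x) ^+ 3).

Lemma measurable_coordY i : measurable_fun setT (fun x => Y x i 0 : R).
Proof. exact: (measurableT_comp (measurable_coord i) mY). Qed.

Lemma measurable_norm1Y : measurable_fun setT (fun x => norm1 (Y x)).
Proof.
by apply: measurable_sum => i; apply: measurableT_comp => //; exact: measurable_coordY.
Qed.

Lemma cube_ge (t : R) k : (k <= 3)%N -> 0 <= t -> t ^+ k <= 1 + t ^+ 3.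
Proof.
move=> k3 t0; have [t1|t1] := leP t 1.
  by rewrite (@le_trans _ _ 1) ?exprn_ile1// lerDl exprn_ge0.
by rewrite (@le_trans _ _ (t ^+ 3)) ?lerDr// ler_weXn2l// ltW.
Qed.

Lemma integrable_norm1X k : (k <= 3)%N -> intble (fun x => norm1 (Y x) ^+ k).
Proof.
move=> k3; apply: (@integrable_le _ _ _ _ _ (fun x => 1 + norm1 (Y x) ^+ 3)).
- by apply: measurable_funX; exact: measurable_norm1Y.
- by move=> x; rewrite ger0_norm ?exprn_ge0 ?norm1_ge0// cube_ge// norm1_ge0.
- exact: (integrableD measurableT (bmeas_integrable P (bmeas_cst T (1 : R))) iY).
Qed.

Lemma integrable_coordY i : intble (fun x => Y x i 0).
Proof.
apply: (integrable_le (measurable_coordY i) (g := fun x => norm1 (Y x) ^+ 1)).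
  by move=> x; rewrite expr1 coord_le_norm1.
exact: integrable_norm1X.
Qed.

Lemma integrable_coordYM i j : intble (fun x => Y x i 0 * Y x j 0).
Proof.
apply: (integrable_le _ (g := fun x => norm1 (Y x) ^+ 2)).
- by apply: measurable_funM; exact: measurable_coordY.
- by move=> x; rewrite normrM expr2 ler_pM// coord_le_norm1.
- exact: integrable_norm1X.
Qed.

Hypothesis Y0 : forall i, \int[P]_x (Y x i 0) = 0.

Lemma measurable_shiftY (a : R) (w : V) : measurable_fun setT (fun x => w + a *: Y x).
Proof.
apply: measurable_fun_cVP => i.
under eq_fun do rewrite !mxE.
apply: measurable_funD; first exact: measurable_cst.
by apply: measurable_funM; [exact: measurable_cst|exact: measurable_coordY].
Qed.

Lemma norm1Z (a : R) (y : V) : norm1 (a *: y) = `|a| * norm1 y.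
Proof. by rewrite /norm1 mulr_sumr; apply: eq_bigr => i _; rewrite mxE normrM. Qed.

Lemma one_step_expansion (F : V -> R) G H (C : R) (a : R) (w : V) : bmeas F ->
  expansion F G H C ->
  `|\int[P]_x F (w + a *: Y x) - F w -
    a ^+ 2 * \sum_i \sum_j H i j w * \int[P]_x (Y x i 0 * Y x j 0)| <=
  C * (`|a| ^+ 3 * \int[P]_x norm1 (Y x) ^+ 3).
Proof.
move=> bF FE.
have bFY : bmeas (fun x => F (w + a *: Y x)).
  by apply: (bmeas_comp _ bF); exact: measurable_shiftY.
have iF : intble (fun x => F (w + a *: Y x) - F w).
  by apply: bmeas_integrable; apply: bmeasB => //; exact: bmeas_cst.
pose L x := \sum_i (a * G i w) * Y x i 0.
pose Q x := \sum_i \sum_j (a ^+ 2 * H i j w) * (Y x i 0 * Y x j 0).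
have iZ c (h : T -> R) : intble h -> intble (fun x => c * h x).
  by move=> ih; exact: (integrableZl measurableT c ih).
have iL : intble L by apply: integrable_sumR => i; apply: iZ; exact: integrable_coordY.
have iQ : intble Q.
  apply: integrable_sumR => i; apply: integrable_sumR => j; apply: iZ.
  exact: integrable_coordYM.
have EL : \int[P]_x L x = 0.
  rewrite Rintegral_sumR; last by move=> i; apply: iZ; exact: integrable_coordY.
  apply: big1 => i _; rewrite RintegralZl//; last exact: integrable_coordY.
  by rewrite Y0 mulr0.
have EQ : \int[P]_x Q x = a ^+ 2 * \sum_i \sum_j H i j w * \int[P]_x (Y x i 0 * Y x j 0).
  rewrite Rintegral_sumR; last first.
    move=> i; apply: integrable_sumR => j; apply: iZ; exact: integrable_coordYM.
  rewrite mulr_sumr; apply: eq_bigr => i _.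
  rewrite Rintegral_sumR; last by move=> j; apply: iZ; exact: integrable_coordYM.
  rewrite mulr_sumr; apply: eq_bigr => j _.
  by rewrite RintegralZl ?mulrA//; exact: integrable_coordYM.
have iFL : intble (fun x => F (w + a *: Y x) - F w - L x).
  exact: (integrableB measurableT iF iL).
have -> : \int[P]_x F (w + a *: Y x) - F w -
    a ^+ 2 * \sum_i \sum_j H i j w * \int[P]_x (Y x i 0 * Y x j 0) =
    \int[P]_x (F (w + a *: Y x) - F w - L x - Q x).
  rewrite RintegralB// RintegralB// EL subr0 EQ RintegralB_bm//; last exact: bmeas_cst.
  by rewrite Rintegral_prob_cst.
have i3 : intble (fun x => C * (`|a| ^+ 3 * norm1 (Y x) ^+ 3)) by do 2 apply: (iZ).
rewrite (_ : C * _ = \int[P]_x (C * (`|a| ^+ 3 * norm1 (Y x) ^+ 3))); last first.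
  by rewrite RintegralZl ?RintegralZl//; exact: (iZ).
apply: norm_Rintegral_dom => //.
  by apply/measurable_EFinP; exact: (measurable_int _ (integrableB measurableT iFL iQ)).
move=> x; have := FE w (a *: Y x); rewrite norm1Z exprMn.
congr (`|_ - _ - _ - _| <= _).
- by apply: eq_bigr => i _; rewrite mxE /L mulrCA mulrA.
- by apply: eq_bigr => i _; apply: eq_bigr => j _; rewrite !mxE; ring.
Qed.

End one_step.

Section lindeberg_swap.
Context d1 d2 (T1 : measurableType d1) (T2 : measurableType d2) (R : realType).
Context (P1 : probability T1 R) (P2 : probability T2 R) (p : nat).
Notation V := 'cV[R]_p.
Variables (Y1 : T1 -> V) (Y2 : T2 -> V).
Hypotheses (mY1 : measurable_fun setT Y1) (mY2 : measurable_fun setT Y2).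
Hypothesis iY1 : P1.-integrable setT (EFin \o (fun x => norm1 (Y1 x) ^+ 3)).
Hypothesis iY2 : P2.-integrable setT (EFin \o (fun x => norm1 (Y2 x) ^+ 3)).
Hypothesis Y10 : forall i, \int[P1]_x (Y1 x i 0) = 0.
Hypothesis Y20 : forall i, \int[P2]_x (Y2 x i 0) = 0.

(** Both expectations are expanded around w; the linear terms are centred and the quadratic ones see
    only the covariances. For a = n^(-1/2), n such replacements cost K times the covariance mismatch
    plus O(n^(-1/2)). *)
Lemma lindeberg_swap (F : V -> R) G H (C K : R) (a : R) (w : V) : bmeas F ->
  expansion F G H C -> (forall i j w, `|H i j w| <= K) ->
  `|\int[P1]_x F (w + a *: Y1 x) - \int[P2]_x F (w + a *: Y2 x)| <=
  a ^+ 2 * (K * \sum_i \sum_j `|\int[P1]_x (Y1 x i 0 * Y1 x j 0) -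
      \int[P2]_x (Y2 x i 0 * Y2 x j 0)|) +
  `|a| ^+ 3 * (C * (\int[P1]_x norm1 (Y1 x) ^+ 3 + \int[P2]_x norm1 (Y2 x) ^+ 3)).
Proof.
move=> bF FE HK.
have := one_step_expansion mY1 iY1 Y10 a w bF FE.
have := one_step_expansion mY2 iY2 Y20 a w bF FE.
set S1 := \sum_i _; set S2 := \sum_i _; set D := \sum_i _.
have SD : `|S2 - S1| <= K * D.
  rewrite /S1 /S2 -sumrB mulr_sumr; apply: (le_trans (ler_norm_sum _ _ _)).
  apply: ler_sum => i _; rewrite -sumrB mulr_sumr.
  apply: (le_trans (ler_norm_sum _ _ _)).
  by apply: ler_sum => j _; rewrite -mulrBr normrM ler_wpM2r.
have {}SD : `|a ^+ 2 * S2 - a ^+ 2 * S1| <= a ^+ 2 * (K * D).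
  by rewrite -mulrBr normrM ger0_norm ?sqr_ge0// ler_wpM2l// sqr_ge0.
move: SD; rewrite !ler_norml => /andP[? ?] /andP[? ?] /andP[? ?].
by apply/andP; split; lra.
Qed.

End lindeberg_swap.

Section lindeberg.
Context (R : realType) (p : nat).
Notation V := 'cV[R]_p.
Notation MR := (measurableTypeR R).
Notation gauss := (@normal_prob R 0 1).
Notation gaussp := (iid_ gauss p : probability (p.-tuple MR) R).

Lemma measurable_affine_gauss (A : 'M[R]_p) (w : V) (s : R) :
  measurable_fun setT (fun t : p.-tuple MR => w + s *: (A *m cV_of_tuple t)).
Proof.
apply: (measurable_shiftY (Y := fun t => A *m cV_of_tuple t)).
rewrite (_ : (fun _ => _) = affine_cV 0 A) //.
by apply/funext => t; rewrite /affine_cV add0r.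
Qed.

Lemma gauss_add_step (A : 'M[R]_p) (F : V -> R) (w : V) (a b c : R) :
  bmeas F -> 0 < b -> 0 < c -> a ^+ 2 + b ^+ 2 = c ^+ 2 ->
  \int[gaussp]_t (\int[gaussp]_t'
     F ((w + a *: (A *m cV_of_tuple t)) + b *: (A *m cV_of_tuple t'))) =
  \int[gaussp]_t F (w + c *: (A *m cV_of_tuple t)).
Proof.
move=> bF b0 c0 abc.
have E a' b' (t t' : p.-tuple MR) : cV_of_tuple (lincomb_tuple a' b' t t') =
    a' *: cV_of_tuple t + b' *: cV_of_tuple t' :> V.
  by apply/colP => i; rewrite !mxE tnth_mktuple.
have bh : bmeas (fun t : p.-tuple MR => F (w + 1 *: (A *m cV_of_tuple t))).
  by apply: (bmeas_comp _ bF); exact: measurable_affine_gauss.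
have H := gauss_tuple_stable b0 c0 abc bh.
transitivity (\int[gaussp]_t (\int[gaussp]_t'
     F (w + 1 *: (A *m cV_of_tuple (lincomb_tuple a b t t'))))).
  apply: eq_Rintegral => t _; apply: eq_Rintegral => t' _.
  by rewrite E mulmxDr -!scalemxAr scale1r addrA.
transitivity (\int[gaussp]_t F (w + 1 *: (A *m cV_of_tuple (lincomb_tuple c 0 t t)))).
  exact: H.
apply: eq_Rintegral => t _.
by rewrite E scale0r addr0 scale1r -scalemxAr.
Qed.

Section iterate.
Context d (T : measurableType d) (P : probability T R) (Y : T -> V) (A : 'M[R]_p).
Hypothesis mY : measurable_fun setT Y.

Lemma measurable_sum_iid k (a : R) (w : V) :
  measurable_fun setT (fun t : k.-tuple T => w + a *: \sum_(i < k) Y (tnth t i)).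
Proof.
apply: measurable_fun_cVP => j.
under eq_fun do rewrite !mxE summxE.
apply: measurable_funD; first exact: measurable_cst.
apply: measurable_funM; first exact: measurable_cst.
apply: measurable_sum => i.
exact: (measurableT_comp (measurable_coordY mY j) (measurable_tnth i)).
Qed.

(* One summand at a time is replaced by a Gaussian vector, and the Gaussian vectors
   are merged by stability: sqrt(k) Z + Z' has the law of sqrt(k + 1) Z. *)
Lemma lindeberg_iter (F : V -> R) (a e : R) : bmeas F -> 0 < a ->
  (forall w, `|\int[P]_x F (w + a *: Y x) -
               \int[gaussp]_t F (w + a *: (A *m cV_of_tuple t))| <= e) ->
  forall k w, `|\int[iid_ P k]_t F (w + a *: \sum_(i < k) Y (tnth t i)) -
     \int[gaussp]_t F (w + (Num.sqrt k%:R * a) *: (A *m cV_of_tuple t))| <= k%:R * e.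
Proof.
move=> bF a0 He; elim=> [|k IHk] w.
  rewrite Rintegral_iid0 big_ord0 scaler0 addr0 sqrtr0 mul0r.
  under eq_Rintegral do rewrite scale0r addr0.
  by rewrite Rintegral_prob_cst subrr normr0 mul0r.
have bS : bmeas (fun t : k.+1.-tuple T => F (w + a *: \sum_(i < k.+1) Y (tnth t i))).
  by apply: (bmeas_comp _ bF); exact: measurable_sum_iid.
rewrite Rintegral_iidS//.
pose sk := Num.sqrt k%:R * a : R.
pose I x := \int[iid_ P k]_t F ((w + a *: Y x) + a *: \sum_(i < k) Y (tnth t i)).
pose J x := \int[gaussp]_t F ((w + a *: Y x) + sk *: (A *m cV_of_tuple t)).
have -> : \int[P]_x (\int[iid_ P k]_t F (w + a *: \sum_(i < k.+1) Y (tnth (tuple_cons (x, t)) i)))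
   = \int[P]_x I x.
  apply: eq_Rintegral => x _; apply: eq_Rintegral => t _.
  by rewrite sum_tuple_cons scalerDr addrA.
have bI : bmeas I.
  apply: (bmeas_Rintegral (iid_ P k : probability _ R)
    (h := fun x t => F ((w + a *: Y x) + a *: \sum_(i < k) Y (tnth t i)))).
  apply: (bmeas_comp _ bF); apply: measurable_addv.
    exact: (measurableT_comp (measurable_shiftY mY a w) measurable_fst).
  rewrite (_ : (fun _ => _) = (fun t => 0 + a *: \sum_(i < k) Y (tnth t i)) \o snd).
    exact: (measurableT_comp (measurable_sum_iid a 0) measurable_snd).
  by apply/funext => z /=; rewrite add0r.
have bJ2 : bmeas (fun z : T * p.-tuple MR =>
    F ((w + a *: Y z.1) + sk *: (A *m cV_of_tuple z.2))).
  apply: (bmeas_comp _ bF); apply: measurable_addv.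
    exact: (measurableT_comp (measurable_shiftY mY a w) measurable_fst).
  rewrite (_ : (fun _ => _) = (fun t => 0 + sk *: (A *m cV_of_tuple t)) \o snd).
    exact: (measurableT_comp (measurable_affine_gauss A 0 sk) measurable_snd).
  by apply/funext => z /=; rewrite add0r.
have bJ : bmeas J.
  exact: (bmeas_Rintegral gaussp
    (h := fun x t => F ((w + a *: Y x) + sk *: (A *m cV_of_tuple t)))).
have IJ : `|\int[P]_x I x - \int[P]_x J x| <= k%:R * e.
  rewrite -RintegralB_bm//; apply: norm_Rintegral_le; first exact: bmeasB.
  by move=> x; exact: IHk.
pose J1 t := \int[P]_x F ((w + sk *: (A *m cV_of_tuple t)) + a *: Y x).
pose J2 t := \int[gaussp]_t' F ((w + sk *: (A *m cV_of_tuple t)) + a *: (A *m cV_of_tuple t')).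
(* By Fubini the Gaussian vector is integrated last, so that the remaining observation is replaced
   around the fixed point w + sk A Z; the bound [He] is uniform in that point. *)
have EJ : \int[P]_x J x = \int[gaussp]_t J1 t.
  transitivity (\int[gaussp]_t (\int[P]_x F ((w + a *: Y x) + sk *: (A *m cV_of_tuple t)))).
    exact: (Rintegral_swap P gaussp
      (h := fun x t => F ((w + a *: Y x) + sk *: (A *m cV_of_tuple t))) bJ2).
  by apply: eq_Rintegral => t _; apply: eq_Rintegral => x _; rewrite addrAC.
have bJ1 : bmeas J1.
  apply: (bmeas_Rintegral P (h := fun t x => F ((w + sk *: (A *m cV_of_tuple t)) + a *: Y x))).
  rewrite (_ : (fun z : p.-tuple MR * T => _) = fun z : p.-tuple MR * T =>
    F ((w + a *: Y z.2) + sk *: (A *m cV_of_tuple z.1))); last first.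
    by apply/funext => z; rewrite addrAC.
  apply: (bmeas_comp (phi := fun z : p.-tuple MR * T => (z.2, z.1)) _ bJ2).
  by apply/measurable_fun_pairP; split; [exact: measurable_snd|exact: measurable_fst].
have bJ22 : bmeas J2.
  apply: (bmeas_Rintegral gaussp (h := fun t t' =>
    F ((w + sk *: (A *m cV_of_tuple t)) + a *: (A *m cV_of_tuple t')))).
  apply: (bmeas_comp _ bF); apply: measurable_addv.
    exact: (measurableT_comp (measurable_affine_gauss A w sk) measurable_fst).
  rewrite (_ : (fun _ => _) = (fun t => 0 + a *: (A *m cV_of_tuple t)) \o snd).
    exact: (measurableT_comp (measurable_affine_gauss A 0 a) measurable_snd).
  by apply/funext => z /=; rewrite add0r.
have J12 : `|\int[gaussp]_t J1 t - \int[gaussp]_t J2 t| <= e.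
  rewrite -RintegralB_bm//; apply: norm_Rintegral_le; first exact: bmeasB.
  by move=> t; exact: He.
have EJ2 : \int[gaussp]_t J2 t =
    \int[gaussp]_t F (w + (Num.sqrt k.+1%:R * a) *: (A *m cV_of_tuple t)).
  apply: gauss_add_step => //; first by rewrite mulr_gt0// sqrtr_gt0.
  by rewrite /sk !exprMn !sqr_sqrtr// -natr1; ring.
rewrite -EJ2 -natr1 mulrDl mul1r -(subrKA (\int[P]_x J x)).
by apply: (le_trans (ler_normD _ _)); apply: lerD => //; rewrite EJ.
Qed.

End iterate.
End lindeberg.

Section cvg_bound.
Context {R : realType}.

Lemma cvg_dist_le (x u : R^nat) (l : R) :
  (\forall n \near \oo, `|x n - l| <= u n) -> u n @[n --> \oo] --> (0 : R) ->
  x n @[n --> \oo] --> l.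
Proof.
move=> xu u0; apply/cvgrPdist_le => e e0.
move/cvgrPdist_le : u0 => /(_ e e0) u0; near=> n.
rewrite distrC; apply: (@le_trans _ _ (u n)); first by near: n.
apply: (le_trans (ler_norm _)); rewrite -normrN -[X in `|X|]add0r.
by near: n.
Unshelve. all: by end_near. Qed.

Lemma cvg_inv_sqrt : (Num.sqrt n%:R : R)^-1 @[n --> \oo] --> (0 : R).
Proof.
apply/cvgrPdist_le => e e0; near=> n; rewrite sub0r normrN ger0_norm ?invr_ge0 ?sqrtr_ge0//.
rewrite -[leRHS]invrK lef_pV2 ?posrE ?invr_gt0 ?sqrtr_gt0 ?ltr0n//; last by near: n; exists 1%N.
rewrite -[leLHS]gtr0_norm ?invr_gt0// -sqrtr_sqr ler_sqrt//.
by near: n; exact: nbhs_infty_ger.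
Unshelve. all: by end_near. Qed.

Lemma cvg_sum0 I (s : seq I) (u : I -> R^nat) :
  (forall i, u i n @[n --> \oo] --> (0 : R)) -> \sum_(i <- s) u i n @[n --> \oo] --> (0 : R).
Proof.
move=> u0; elim: s => [|i s IHs].
  by under eq_fun do rewrite big_nil; exact: cvg_cst.
under eq_fun do rewrite big_cons.
by have := cvgD (u0 i) IHs; rewrite addr0; exact.
Qed.

Lemma sum_cube_le I (s : seq I) : exists K : R, forall u : I -> R, (forall i, 0 <= u i) ->
  (\sum_(i <- s) u i) ^+ 3 <= K * \sum_(i <- s) u i ^+ 3.
Proof.
suff [K K1 KP] : exists2 K : R, 1 <= K & forall u : I -> R, (forall i, 0 <= u i) ->
    (\sum_(i <- s) u i) ^+ 3 <= K * \sum_(i <- s) u i ^+ 3 by exists K.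
elim: s => [|i s [K K1 IHs]].
  by exists 1 => // u u0; rewrite !big_nil expr0n mulr0.
exists (4 * K) => [|u u0]; first by lra.
rewrite !big_cons; have := IHs u u0.
have S0 : 0 <= \sum_(j <- s) u j by exact: sumr_ge0.
have S30 : 0 <= \sum_(j <- s) u j ^+ 3 by apply: sumr_ge0 => j _; rewrite exprn_ge0.
move: (\sum_(j <- s) u j) (\sum_(j <- s) u j ^+ 3) (u i) (u0 i) S0 S30 => x y z z0 x0 y0 H.
(* The difference is 3 (z + x) (z - x)^2. *)
have : (z + x) ^+ 3 <= 4 * (z ^+ 3 + x ^+ 3).
  have : 0 <= 3 * (z + x) * (z - x) ^+ 2 by rewrite mulr_ge0// ?sqr_ge0//; lra.
  by rewrite -subr_ge0 => h; rewrite -subr_ge0; apply: le_trans h _; rewrite le_eqVlt;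
    apply/orP; left; apply/eqP; ring.
have : z ^+ 3 <= K * z ^+ 3 by rewrite ler_peMl// exprn_ge0.
lra.
Qed.

End cvg_bound.

Section gauss_affine_moments.
Context (R : realType) (p : nat) (A : 'M[R]_p).
Notation V := 'cV[R]_p.
Notation MR := (measurableTypeR R).
Notation gauss := (@normal_prob R 0 1).
Notation gaussp := (iid_ gauss p : probability (p.-tuple MR) R).
Notation AZ := (fun t : p.-tuple MR => A *m cV_of_tuple t : V).

Lemma measurable_linear_gauss : measurable_fun setT AZ.
Proof.
have := measurable_affine_gauss A 0 1.
by under eq_fun do rewrite add0r scale1r.
Qed.

Lemma norm1_mulmx : exists2 K : R, 0 <= K & forall z : V, norm1 (A *m z) <= K * norm1 z.
Proof.
exists (\sum_i \sum_j `|A i j|); first by do 2 (apply: sumr_ge0 => ? _).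
move=> z; rewrite mulr_suml; apply: ler_sum => i _; rewrite mxE.
apply: (le_trans (ler_norm_sum _ _ _)); rewrite mulr_suml; apply: ler_sum => j _.
by rewrite normrM ler_wpM2l// coord_le_norm1.
Qed.

Lemma integrable_norm1_gauss : gaussp.-integrable setT (EFin \o (fun t => norm1 (AZ t) ^+ 3)).
Proof.
have [K K0 KP] := norm1_mulmx.
have [L LP] := @sum_cube_le R _ (index_enum 'I_p).
apply: (integrable_le (g := fun t : p.-tuple MR => (K ^+ 3 * L) * \sum_i `|tnth t i| ^+ 3)).
- by apply: measurable_funX; exact: (measurable_norm1Y measurable_linear_gauss).
- move=> t; rewrite ger0_norm ?exprn_ge0 ?norm1_ge0//.
  apply: (@le_trans _ _ ((K * norm1 (cV_of_tuple t : V)) ^+ 3)).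
    by rewrite lerXn2r ?nnegrE ?norm1_ge0// ?mulr_ge0// norm1_ge0.
  rewrite exprMn -mulrA ler_wpM2l ?exprn_ge0// /norm1.
  under eq_bigr do rewrite mxE.
  by apply: LP => i.
- apply: (integrableZl measurableT (K ^+ 3 * L)
    (f := fun t : p.-tuple MR => (\sum_i `|tnth t i| ^+ 3)%:E)).
  by apply: integrable_sumR => i; exact: gauss_tuple_integrable.
Qed.

Lemma gauss_affine_mean i : \int[gaussp]_t (AZ t i 0) = 0.
Proof.
have i1 j : gaussp.-integrable setT (EFin \o (fun t : p.-tuple MR => tnth t j)).
  have := @gauss_tuple_integrable R p j 1 isT; apply: integrable_le.
    exact: measurable_tnth.
  by move=> t; rewrite expr1.
have iA j : gaussp.-integrable setT (EFin \o (fun t : p.-tuple MR => A i j * tnth t j)).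
  exact: (integrableZl measurableT (A i j) (i1 j)).
transitivity (\int[gaussp]_t (\sum_j (A i j * tnth t j : R))).
  by apply: eq_Rintegral => t _; rewrite mxE; apply: eq_bigr => j _; rewrite mxE.
rewrite Rintegral_sumR//; apply: big1 => j _.
transitivity (A i j * \int[gaussp]_t (tnth t j : R)).
  by rewrite RintegralZl//; exact: i1.
by rewrite gauss_tuple_mean mulr0.
Qed.

Lemma gauss_affine_cov i j : \int[gaussp]_t (AZ t i 0 * AZ t j 0) = (A *m A^T) i j.
Proof.
pose c k l := A i k * A j l.
have iA k l : gaussp.-integrable setT
    (EFin \o (fun t : p.-tuple MR => c k l * (tnth t k * tnth t l))).
  exact: (integrableZl measurableT (c k l) (gauss_tuple_integrableM k l)).
transitivity (\int[gaussp]_t (\sum_k \sum_l (c k l * (tnth t k * tnth t l) : R))).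
  apply: eq_Rintegral => t _; rewrite !mxE big_distrlr/=.
  by apply: eq_bigr => k _; apply: eq_bigr => l _; rewrite !mxE /c; ring.
rewrite Rintegral_sumR; last by move=> k; exact: integrable_sumR.
have E k l : \int[gaussp]_t (c k l * (tnth t k * tnth t l) : R) = c k l * (k == l)%:R.
  rewrite -(gauss_tuple_cov k l).
  by rewrite RintegralZl//; exact: gauss_tuple_integrableM.
rewrite mxE; apply: eq_bigr => k _; rewrite Rintegral_sumR//.
rewrite (bigD1 k)//= big1 ?addr0 => [|l lk].
  by rewrite E eqxx mulr1 mxE.
by rewrite E eq_sym (negbTE lk) mulr0.
Qed.

End gauss_affine_moments.

Section clt.
Context d (T : measurableType d) (R : realType) (p : nat).
Notation V := 'cV[R]_p.
Notation MR := (measurableTypeR R).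
Notation gauss := (@normal_prob R 0 1).
Notation gaussp := (iid_ gauss p : probability (p.-tuple MR) R).
Context (P : nat -> probability T R) (Y : nat -> T -> V) (A : 'M[R]_p) (B : R).
Variable delta : nat -> V.
Hypothesis mY : forall n, measurable_fun setT (Y n).
Hypothesis YB : forall n x i, `|Y n x i 0| <= B.
Hypothesis Y0 : forall n i, \int[P n]_x (Y n x i 0) = 0.
Hypothesis Ycov : forall i j,
  \int[P n]_x (Y n x i 0 * Y n x j 0) @[n --> \oo] --> (A *m A^T) i j.
Hypothesis delta0 : norm1 (delta n) @[n --> \oo] --> (0 : R).

(** Used to discard the vanishing shift [delta n]. All three powers appear because the expansion is
    global in y. *)
Lemma expansion_lipschitz (F : V -> R) : smooth2 F -> exists2 K : R, 0 <= K &
  forall w y, `|F (w + y) - F w| <= K * (norm1 y + norm1 y ^+ 2 + norm1 y ^+ 3).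
Proof.
move=> [_ [G [H [C [bG bH FE]]]]].
have [K1 K10 GK] := bmeas_bound1 bG; have [K2 K20 HK] := bmeas_bound2 bH.
exists (K1 + K2 + `|C|); first by rewrite !addr_ge0.
move=> w y; have := FE w y.
have := linf_le y (fun i => GK i w); have := quadf_le y (fun i j => HK i j w).
have := norm1_ge0 y; move: (norm1 y) (linf G w y) (quadf H w y) (F (w + y)) (F w) => N l q a b
  N0 hq hl h.
have N20 : 0 <= N ^+ 2 by exact: sqr_ge0.
have N30 : 0 <= N ^+ 3 by rewrite exprn_ge0.
have CN : C * N ^+ 3 <= `|C| * N ^+ 3 by rewrite ler_wpM2r// ler_norm.
rewrite !mulrDl !mulrDr.
have := mulr_ge0 K10 N20; have := mulr_ge0 K10 N30.
have := mulr_ge0 K20 N0; have := mulr_ge0 K20 N30.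
have := mulr_ge0 (normr_ge0 C) N0; have := mulr_ge0 (normr_ge0 C) N20.
move: h hl hq; rewrite !ler_norml => /andP[? ?] /andP[? ?] /andP[? ?] ? ? ? ? ? ?.
by apply/andP; split; lra.
Qed.

Lemma integrable_norm1_bounded n : (P n).-integrable setT (EFin \o (fun x => norm1 (Y n x) ^+ 3)).
Proof.
apply: bmeas_integrable; apply: bmeasX; apply: bmeas_sum => i.
by apply: bmeas_norm; split; [exact: measurable_coordY|exists B => x; exact: YB].
Qed.

Lemma norm1_bounded n x : norm1 (Y n x) <= p%:R * B.
Proof.
apply: (@le_trans _ _ (\sum_(i < p) B)); first exact: ler_sum.
by rewrite sumr_const card_ord mulr_natl.
Qed.

(** A triangular array: the law and the summand vary with n, under a common bound. The error [u n]
    collects the covariance mismatch, the third moments divided by sqrt(n), and the shift. *)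
Lemma smooth_clt (F : V -> R) : smooth2 F ->
  \int[iid_ (P n) n]_t F (delta n + (Num.sqrt n%:R)^-1 *: \sum_(i < n) Y n (tnth t i))
    @[n --> \oo] --> \int[gaussp]_t F (A *m cV_of_tuple t).
Proof.
move=> sF; have [bF [G [H [C [bG bH FE]]]]] := sF.
have [K K0 HK] := bmeas_bound2 bH.
have [L L0 FL] := expansion_lipschitz sF.
pose M2 := \int[gaussp]_t norm1 (A *m cV_of_tuple t : V) ^+ 3.
have M20 : 0 <= M2 by apply: Rintegral_ge0 => t _; rewrite exprn_ge0// norm1_ge0.
pose D n := \sum_i \sum_j `|\int[P n]_x (Y n x i 0 * Y n x j 0) - (A *m A^T) i j|.
pose a n : R := (Num.sqrt n%:R)^-1.
pose N n := norm1 (delta n).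
pose u n := K * D n + a n * (`|C| * ((p%:R * B) ^+ 3 + M2)) +
  L * (N n + N n ^+ 2 + N n ^+ 3).
have D0 : D n @[n --> \oo] --> (0 : R).
  apply: cvg_sum0 => i; apply: cvg_sum0 => j.
  rewrite -(@normr0 _ R) -(subrr ((A *m A^T) i j)).
  by apply: cvg_norm; apply: cvgB; [exact: Ycov|exact: cvg_cst].
have a0 : a n @[n --> \oo] --> (0 : R) by exact: cvg_inv_sqrt.
apply: (@cvg_dist_le _ _ u); last first.
  rewrite (_ : 0 = K * 0 + 0 * (`|C| * ((p%:R * B) ^+ 3 + M2)) + L * (0 + 0 ^+ 2 + 0 ^+ 3));
    last first.
    by rewrite !expr0n/=; ring.
  apply: cvgD; first apply: cvgD.
  - by apply: cvgM => //; exact: cvg_cst.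
  - by apply: cvgM => //; exact: cvg_cst.
  - apply: cvgM; first exact: cvg_cst.
    by apply: cvgD; [apply: cvgD => //|]; rewrite /GRing.exp/=; do ?apply: cvgM.
near=> n.
have n0 : (0 < n)%N by near: n; exists 1%N.
have s0 : 0 < Num.sqrt n%:R :> R by rewrite sqrtr_gt0 ltr0n.
have an0 : 0 < a n by rewrite invr_gt0.
have ss : Num.sqrt n%:R ^+ 2 = n%:R :> R by rewrite sqr_sqrtr.
have step w : `|\int[P n]_x F (w + a n *: Y n x) -
    \int[gaussp]_t F (w + a n *: (A *m cV_of_tuple t))| <=
    n%:R^-1 * (K * D n + a n * (`|C| * ((p%:R * B) ^+ 3 + M2))).
  have := lindeberg_swap (mY n) (measurable_linear_gauss A) (integrable_norm1_bounded n)
    (integrable_norm1_gauss A) (Y0 n) (gauss_affine_mean A) (a n) w bF FE HK.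
  move/le_trans; apply.
  rewrite [leRHS]mulrDr; apply: lerD.
    rewrite /a exprVn ss le_eqVlt; apply/orP; left; apply/eqP; congr (_ * (_ * _)).
    by apply: eq_bigr => i _; apply: eq_bigr => j _; rewrite gauss_affine_cov.
  rewrite ger0_norm ?(ltW an0)// exprSr (_ : a n ^+ 2 = n%:R^-1); last by rewrite /a exprVn ss.
  rewrite -mulrA ler_wpM2l ?invr_ge0// ler_wpM2l ?(ltW an0)//.
  set M1 := Rintegral _ _ _.
  have M10 : 0 <= M1 by apply: Rintegral_ge0 => t _; rewrite exprn_ge0// norm1_ge0.
  have M1B : M1 <= (p%:R * B) ^+ 3.
    apply: (le_trans (ler_norm _)); apply: norm_Rintegral_le.
      apply: bmeasX; apply: bmeas_sum => i.
      by apply: bmeas_norm; split; [exact: measurable_coordY|exists B => x; exact: YB].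
    move=> x; rewrite ger0_norm ?exprn_ge0 ?norm1_ge0//.
    have := norm1_bounded n x; have := norm1_ge0 (Y n x) => h0 h.
    by rewrite lerXn2r// nnegrE// (le_trans h0).
  apply: (@le_trans _ _ (`|C| * (M1 + M2))); last by rewrite ler_wpM2l// lerD2r.
  by rewrite ler_wpM2r ?ler_norm// addr_ge0.
have := lindeberg_iter (mY n) bF an0 step n (delta n).
rewrite /a (mulfV (lt0r_neq0 s0)) mulrA (_ : n%:R * n%:R^-1 = 1 :> R); last first.
  by rewrite mulfV// gt_eqF// ltr0n.
rewrite mul1r => H1.
have bA (w : V) : bmeas (fun t : p.-tuple MR => F (w + 1 *: (A *m cV_of_tuple t))).
  by apply: (bmeas_comp _ bF); exact: measurable_affine_gauss.
have H2 : `|\int[gaussp]_t F (delta n + 1 *: (A *m cV_of_tuple t)) -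
    \int[gaussp]_t F (A *m cV_of_tuple t)| <= L * (N n + N n ^+ 2 + N n ^+ 3).
  have -> : \int[gaussp]_t F (A *m cV_of_tuple t) =
    \int[gaussp]_t F (0 + 1 *: (A *m cV_of_tuple t)).
    by apply: eq_Rintegral => t _; rewrite add0r scale1r.
  rewrite -RintegralB_bm//; apply: norm_Rintegral_le; first exact: bmeasB.
  by move=> t; rewrite add0r (addrC (delta n)); exact: FL.
rewrite -(subrKA (\int[gaussp]_t F (delta n + 1 *: (A *m cV_of_tuple t)))).
by apply: (le_trans (ler_normD _ _)); apply: lerD.
Unshelve. all: by end_near. Qed.

End clt.

Section smooth_to_continuous.
Context (R : realType) (p : nat).
Notation V := 'cV[R]_p.
Context d (T : nat -> measurableType d) (P : forall n, probability (T n) R).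
Context d' (T' : measurableType d') (Q : probability T' R).
Variables (X : forall n, T n -> V) (Z : T' -> V).
Arguments X : clear implicits.
Hypotheses (mX : forall n, measurable_fun setT (X n)) (mZ : measurable_fun setT Z).
Hypothesis iZ : Q.-integrable setT (EFin \o (fun t => norm1 (Z t))).
Hypothesis smooth_cvg : forall F : V -> R, smooth2 F ->
  \int[P n]_t F (X n t) @[n --> \oo] --> \int[Q]_t F (Z t).

(** A smooth form of Markov's inequality: integrated, it turns a first moment into a tail bound. *)
Lemma cutoff_ge (N : nat) (x : V) : (0 < N)%N -> 1 - cutoff 1 N x <= N%:R^-1 * (norm1 x + 2).
Proof.
move=> N0; have NR : 0 < N%:R :> R by rewrite ltr0n.
have n0 := norm1_ge0 x.
have [xN|xN] := leP (norm1 x + 2) N%:R.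
  rewrite cutoff1 ?subrr; last first.
    by move=> i; rewrite mul1r (le_trans _ xN)// lerD2r coord_le_norm1.
  by rewrite mulr_ge0 ?invr_ge0//; lra.
rewrite (@le_trans _ _ 1)//; first by rewrite gerBl cutoff_ge0.
by rewrite mulrC ler_pdivlMr// mul1r ltW.
Qed.

(** Since 1 - cx <= 2 e, the three gaps add up to (e + 2 C e) + e + (e + 4 C e) <= 9 C e. *)
Lemma approx_arith (C e gz gx fz fx cz cx : R) : 1 <= C -> 0 <= e ->
  `|fz - fx| <= e -> `|cz - cx| <= e -> 1 - cz <= e ->
  `|gz - fz| <= e + 2 * C * (1 - cz) -> `|gx - fx| <= e + 2 * C * (1 - cx) ->
  `|gz - gx| <= e * (9 * C).
Proof.
move=> C1 e0 fzx czx cze gfz gfx.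
have H1 : 2 * C * (1 - cz) <= 2 * C * e by rewrite ler_pM2l//; lra.
have H2 : 2 * C * (1 - cx) <= 2 * C * (2 * e).
  by rewrite ler_pM2l; [move: czx; rewrite ler_norml => /andP[? ?]; lra|lra].
have Ce : e <= C * e by rewrite ler_peMl.
move: fzx gfz gfx; rewrite !ler_norml => /andP[? ?] /andP[? ?] /andP[? ?].
by apply/andP; split; lra.
Qed.

(** g is replaced by a spline F close to it on a box outside which the cutoff vanishes; the cutoff
    then controls the error elsewhere. Tightness is needed only for the limit Z: the cutoff is
    itself a smooth test function, so its integrals along the sequence converge. *)
Lemma cvg_continuous_of_smooth (g : V -> R) : continuous g -> bounded_fun g ->
  (\int[P n]_t (g (X n t))%:E)%E @[n --> \oo] --> (\int[Q]_t (g (Z t))%:E)%E.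
Proof.
move=> cg [C0 [_ gC0]].
pose C := `|C0| + 1.
have C1 : 1 <= C by rewrite /C lerDr.
have gC x : `|g x| <= C.
  by apply: (gC0 C) => //; rewrite /C (le_lt_trans (ler_norm C0))// ltrDl.
have bg : bmeas g by split; [exact: continuous_measurable_cV|exists C].
have bgX n : bmeas (fun t => g (X n t)) by apply: (bmeas_comp _ bg); exact: mX.
have bgZ : bmeas (fun t => g (Z t)) by apply: (bmeas_comp _ bg).
rewrite -(EFin_Rintegral Q bgZ).
under eq_fun do rewrite -(EFin_Rintegral (P _) (bgX _)).
apply: cvg_EFin; first by near=> n.
pose E1 := \int[Q]_t (norm1 (Z t) + 2).
have iZ2 : Q.-integrable setT (EFin \o (fun t => norm1 (Z t) + 2)).
  exact: (integrableD measurableT iZ (bmeas_integrable Q (bmeas_cst T' (2 : R)))).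
have E10 : 0 <= E1 by apply: Rintegral_ge0 => t _; rewrite addr_ge0// norm1_ge0.
apply/cvgrPdist_le => e e0.
pose e' := e / (9 * C).
have C90 : 0 < 9 * C by lra.
have e'0 : 0 < e' by rewrite divr_gt0.
have ee' : e = e' * (9 * C) by rewrite /e' divfK// gt_eqF.
pose N := (Num.truncn (E1 / e')).+1.
have NE : N%:R^-1 * E1 <= e'.
  rewrite mulrC ler_pdivrMr ?ltr0n// mulrC -ler_pdivrMr//.
  exact/ltW/truncnS_gt.
pose cut := @cutoff R p 1 N.
have scut : smooth2 cut := smooth2_cutoff p 1 N.
have [m [M gF]] := continuous_spline_approx (N%:R + 2) cg e'0.
set F := spline_approx m M g in gF.
have sF : smooth2 F := smooth2_spline_approx m M g.
have FC x : `|F x| <= C by exact: spline_approx_bounded.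
have gFcut x : `|g x - F x| <= e' + 2 * C * (1 - cut x).
  have c1 : 0 <= 1 - cut x by rewrite subr_ge0 cutoff_le1.
  have [cx|cx] := eqVneq (cut x) 0.
    rewrite cx subr0 mulr1; apply: (le_trans (ler_normB _ _)).
    have := gC x; have := FC x; lra.
  apply: (@le_trans _ _ e'); last by rewrite lerDl mulr_ge0//; lra.
  by apply: gF => i; have := cutoff_neq0 i cx; rewrite mul1r.
have dev d1 (T1 : measurableType d1) (P1 : probability T1 R) (W : T1 -> V) :
    measurable_fun setT W ->
    `|\int[P1]_t g (W t) - \int[P1]_t F (W t)| <=
    e' + 2 * C * (1 - \int[P1]_t cut (W t)).
  move=> mW; have bgW : bmeas (fun t => g (W t)) by exact: (bmeas_comp mW bg).
  have bFW : bmeas (fun t => F (W t)) by exact: (bmeas_comp mW sF.1).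
  have bcW : bmeas (fun t => cut (W t)) by exact: (bmeas_comp mW scut.1).
  have b1c : bmeas (fun t => 1 - cut (W t)) by apply: bmeasB => //; exact: bmeas_cst.
  have b2c : bmeas (fun t => 2 * C * (1 - cut (W t))).
    by apply: bmeasM => //; exact: bmeas_cst.
  rewrite -RintegralB_bm//; apply: (le_trans (le_norm_Rintegral_bm P1 (bmeasB bgW bFW))).
  apply: (@le_trans _ _ (\int[P1]_t (e' + 2 * C * (1 - cut (W t))))).
    apply: le_Rintegral_bm => //; first exact/bmeas_norm/bmeasB.
    by apply: bmeasD => //; exact: bmeas_cst.
  rewrite RintegralD_bm//; last exact: bmeas_cst.
  rewrite Rintegral_prob_cst RintegralZl_bm// RintegralB_bm//; last exact: bmeas_cst.
  by rewrite Rintegral_prob_cst.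
have cutZ : 1 - \int[Q]_t cut (Z t) <= e'.
  have bcZ : bmeas (fun t => cut (Z t)) by exact: (bmeas_comp mZ scut.1).
  rewrite -[1 in leLHS](Rintegral_prob_cst Q) -RintegralB_bm//; last exact: bmeas_cst.
  apply: (le_trans _ NE); rewrite /E1 -RintegralZl//.
  apply: le_Rintegral => //.
  - by apply: bmeas_integrable; apply: bmeasB => //; exact: bmeas_cst.
  - exact: (integrableZl measurableT _ iZ2).
  - by move=> t _; exact: cutoff_ge.
have devZ := dev _ _ Q Z mZ.
near=> n.
have FZ : `|\int[Q]_t F (Z t) - \int[P n]_t F (X n t)| <= e'.
  by near: n; move/cvgrPdist_le : (smooth_cvg sF); exact.
have cZ : `|\int[Q]_t cut (Z t) - \int[P n]_t cut (X n t)| <= e'.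
  by near: n; move/cvgrPdist_le : (smooth_cvg scut); exact.
have devX := dev _ _ (P n) _ (@mX n).
rewrite ee'; exact: (approx_arith C1 (ltW e'0) FZ cZ cutZ devZ devX).
Unshelve. all: by end_near. Qed.

End smooth_to_continuous.

(** * Strict differentiability and the logarithm *)

Section real_analysis.
Context {R : realType}.

(** Existence of f''(0) makes f' continuous at 0, so f' stays within e of 1 on a neighbourhood; the
    mean value theorem is applied between t and s rather than from 0. *)
Lemma strict_derivative (f : R -> R) : (\forall t \near (0 : R), derivable f t 1) ->
  derivable (derive1 f) 0 1 -> derive1 f 0 = 1 -> forall e : R, 0 < e ->
  exists2 d, 0 < d & forall s t, `|s| <= d -> `|t| <= d ->
    `|f s - f t - (s - t)| <= e * `|s - t|.
Proof.
move=> df ddf f1 e e0.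
have cf' : (derive1 f) x @[x --> (0 : R)] --> (1 : R).
  have /derivable1_diffP/differentiable_continuous := ddf.
  by rewrite -[in X in _ -> X]f1.
have : \forall x \near (0 : R), derivable f x 1 /\ `|1 - derive1 f x| <= e.
  near=> x; split; first by near: x.
  by near: x; move/cvgrPdist_le : cf'; exact.
move=> /nbhs_ballP[d /= d0 dP]; exists (d / 2); first by rewrite divr_gt0.
have dP' x : `|x| <= d / 2 -> derivable f x 1 /\ `|1 - derive1 f x| <= e.
  move=> xd; apply: dP; rewrite /ball/= sub0r normrN.
  by apply: (le_lt_trans xd); rewrite ltr_pdivrMr// ltr_pMr// ltr1n.
have lt_case s t : s < t -> `|s| <= d / 2 -> `|t| <= d / 2 ->
    `|f t - f s - (t - s)| <= e * `|t - s|.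
  move=> st sd td.
  have xd x : s <= x <= t -> `|x| <= d / 2.
    move: sd td; rewrite !ler_norml => /andP[? ?] /andP[? ?] /andP[? ?].
    by apply/andP; split; lra.
  have [c /[!in_itv]/= /andP[/ltW sc /ltW ct] ->] : exists2 c, c \in `]s, t[ &
      f t - f s = derive1 f c * (t - s).
    apply: (@MVT R f (derive1 f) s t st).
      move=> x; rewrite in_itv/= => /andP[/ltW sx /ltW xt].
      have [dfx _] := dP' x (xd x (introT andP (conj sx xt))).
      by apply: DeriveDef => //; rewrite derive1E.
    apply: derivable_within_continuous => x; rewrite in_itv/= => sxt.
    exact: (dP' x (xd x sxt)).1.
  rewrite (_ : _ - _ = (derive1 f c - 1) * (t - s)); last by ring.
  rewrite normrM ler_wpM2r// distrC.
  by apply: (dP' c (xd c _)).2; rewrite sc.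
move=> s t sd td; have [st|ts|->] := ltgtP s t.
- rewrite (_ : f s - f t - (s - t) = - (f t - f s - (t - s))) ?normrN; last by ring.
  by rewrite (distrC s t); exact: lt_case.
- exact: lt_case.
- by rewrite !subrr normr0 mulr0.
Unshelve. all: by end_near. Qed.

(** F(u) = ln u + u^2 / 2 - 2 u has derivative (1 - u)^2 / u, and F(1 + x) - F(1) is the remainder,
    so one application of the mean value theorem suffices; 1 / c <= 2 because c >= 1/2. *)
Lemma ln1D_expansion (x : R) : `|x| <= 2^-1 ->
  `|ln (1 + x) - x + x ^+ 2 / 2| <= 2 * `|x| ^+ 3.
Proof.
pose F : R -> R := (@ln R) + 2^-1 *: (id ^+ 2) - 2 *: id.
have dF (u : R) : 0 < u -> is_derive u 1 F ((1 - u) ^+ 2 / u).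
  move=> u0; have dl := is_derive1_ln u0.
  have E : u^-1 + 2^-1 * ((2%:R * u ^+ 1) * 1) - 2 * 1 = (1 - u) ^+ 2 / u.
    by field; rewrite gt_eqF.
  have did : is_derive u (1 : R) (id : R -> R) 1 by exact: is_derive_id.
  have dsq := @is_deriveX R R id 2 u 1 1 did.
  have d1 := is_deriveD dl (is_deriveZ 2^-1 dsq).
  have d2 := is_deriveB d1 (is_deriveZ 2 did).
  by rewrite -E; exact: d2.
have FE : F (1 + x) - F 1 = ln (1 + x) - x + x ^+ 2 / 2.
  have E y : F y = ln y + 2^-1 * y ^+ 2 - 2 * y by [].
  by rewrite !E ln1; field.
move: F dF FE => F dF <-.
have key (a b : R) : 0 < a -> a < b -> exists2 c, a <= c <= b &
    F b - F a = (1 - c) ^+ 2 / c * (b - a).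
  move=> a0 ab; have pos c : a <= c -> 0 < c by exact: lt_le_trans.
  have [c /[!in_itv]/= /andP[/ltW ac /ltW cb] H] : exists2 c, c \in `]a, b[ &
      F b - F a = (1 - c) ^+ 2 / c * (b - a).
    apply: (@MVT R F (fun c => (1 - c) ^+ 2 / c) _ _ ab).
      by move=> c; rewrite in_itv/= => /andP[/ltW/pos c0 _]; exact: dF.
    apply: derivable_within_continuous => c; rewrite in_itv/= => /andP[/pos c0 _].
    by have [] := dF c c0.
  by exists c => //; rewrite ac.
move=> x12.
have fin (c : R) : 2^-1 <= c -> `|1 - c| <= `|x| ->
    `|(1 - c) ^+ 2 / c * x| <= 2 * `|x| ^+ 3.
  move=> c12 cx; have c0 : 0 < c by lra.
  rewrite (_ : 2 * `|x| ^+ 3 = 2 * `|x| ^+ 2 * `|x|); last by ring.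
  rewrite 2!normrM normrX ler_wpM2r// mulrC ler_pM//.
    by rewrite normfV gtr0_norm// -[leRHS]invrK lef_pV2 ?posrE ?invr_gt0.
  by rewrite lerXn2r ?nnegrE.
move: (x12); rewrite ler_norml => /andP[x1 x2].
have [x0|x0|->] := ltgtP x 0.
- have [||c /andP[c1 c2] H] := key (1 + x) 1; [lra|lra|].
  rewrite -normrN opprB H (_ : 1 - (1 + x) = - x); last by ring.
  rewrite mulrN normrN; apply: fin; first lra.
  by rewrite [leRHS]ltr0_norm// [leLHS]ger0_norm; lra.
- have [||c /andP[c1 c2] H] := key 1 (1 + x); [lra|lra|].
  rewrite H (_ : 1 + x - 1 = x); last by ring.
  apply: fin; first lra.
  by rewrite [leRHS]gtr0_norm// [leLHS]ler0_norm; lra.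
- by rewrite addr0 subrr !normr0 expr0n mulr0.
Qed.

(** The modulus is the supremum of the difference quotients over [- kappa, kappa]; adding kappa to
    it lets a single vanishing sequence bound kappa as well. *)
Lemma strict_derivative_seq (f : R -> R) (kappa : R^nat) :
  (\forall t \near (0 : R), derivable f t 1) ->
  derivable (derive1 f) 0 1 -> derive1 f 0 = 1 ->
  (forall n, 0 <= kappa n) -> kappa n @[n --> \oo] --> (0 : R) ->
  exists2 eps : R^nat, eps n @[n --> \oo] --> (0 : R) &
    \forall n \near \oo, kappa n <= eps n /\
      forall s t, `|s| <= kappa n -> `|t| <= kappa n ->
        `|f s - f t - (s - t)| <= eps n * `|s - t|.
Proof.
move=> df ddf f1 k0 kcvg; have SD := strict_derivative df ddf f1.
pose E n := [set r | exists s t, [/\ `|s| <= kappa n, `|t| <= kappa n &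
  r = `|f s - f t - (s - t)| / `|s - t|] ].
(* The degenerate pair s = t = 0 counts as quotient 0, since division by zero gives 0; the set is
   thus never empty and its supremum is nonnegative. *)
have E0 n : E n 0 by exists 0, 0; rewrite !normr0 !subrr normr0 invr0 mulr0; split.
have Eub e : 0 < e -> \forall n \near \oo, ubound (E n) e.
  move=> e0; have [d d0 dP] := SD e e0; near=> n.
  have kd : kappa n <= d.
    rewrite -(ger0_norm (k0 n)) -normrN -sub0r.
    by near: n; move/cvgrPdist_le : kcvg; exact.
  move=> _ [s [t [sk tk ->]]]; have [->|st] := eqVneq s t.
    by rewrite !subrr !normr0 mul0r ltW.
  rewrite ler_pdivrMr ?normr_gt0 ?subr_eq0//; apply: dP; exact: (le_trans _ kd).
have Esup e : 0 < e -> \forall n \near \oo, has_sup (E n) /\ 0 <= sup (E n) <= e.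
  move=> e0; near=> n; have ub : ubound (E n) e by near: n; exact: Eub.
  have hs : has_sup (E n) by split; [exists 0|exists e].
  split => //; apply/andP; split; first exact: (sup_upper_bound hs).
  by apply: sup_le_ub => //; exists 0.
exists (fun n => kappa n + sup (E n)).
  rewrite -(addr0 (0 : R)); apply: cvgD => //; apply/cvgrPdist_le => e e0.
  near=> n; have [_ /andP[s0 se]] : has_sup (E n) /\ 0 <= sup (E n) <= e.
    by near: n; exact: Esup.
  by rewrite sub0r normrN ger0_norm.
near=> n; have [hs /andP[s0 _]] : has_sup (E n) /\ 0 <= sup (E n) <= 1.
  by near: n; apply: Esup.
split=> [|s t sk tk]; first by rewrite lerDl.
have [->|st] := eqVneq s t; first by rewrite !subrr normr0 mulr0.
rewrite -ler_pdivrMr ?normr_gt0 ?subr_eq0//.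
apply: (@le_trans _ _ (sup (E n))); last by rewrite lerDr.
by apply: (sup_upper_bound hs); exists s, t.
Unshelve. all: by end_near. Qed.

End real_analysis.

(** * Log-likelihood ratio at a fixed sample size *)

Section variance.
Context d (T : measurableType d) (R : realType) (P : probability T R).

Lemma variance_le (g : T -> R) (C : R) : bmeas g -> (forall x, `|g x| <= C) ->
  \int[P]_x (g x - \int[P]_x g x) ^+ 2 <= C ^+ 2.
Proof.
move=> bg gC; set m := Rintegral P setT g; have bg2 := bmeasX 2 bg.
have bm : bmeas (fun x : T => 2 * m * g x) by apply: bmeasM => //; exact: bmeas_cst.
have E : \int[P]_x (g x - m) ^+ 2 = \int[P]_x g x ^+ 2 - m ^+ 2.
  transitivity (\int[P]_x (g x ^+ 2 - 2 * m * g x + m ^+ 2)).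
    by apply: eq_Rintegral => x _; ring.
  rewrite RintegralD_bm; [|exact: bmeasB|exact: bmeas_cst].
  rewrite RintegralB_bm// RintegralZl_bm// Rintegral_prob_cst -/m; ring.
rewrite E; apply: (@le_trans _ _ (\int[P]_x g x ^+ 2)); first by rewrite gerBl sqr_ge0.
apply: (le_trans (ler_norm _)); apply: norm_Rintegral_le => // x.
rewrite normrX lerXn2r ?nnegrE//; exact: le_trans (gC x).
Qed.

(** A union bound in which r is the deterministic share of e; points where Y is infinite lie in the
    null set. *)
Lemma probability_le_split (Y : T -> \bar R) (Y1 Y2 : T -> R) (r e e1 e2 : R) :
  measurable_fun setT Y -> measurable_fun setT Y1 -> measurable_fun setT Y2 ->
  e1 + e2 + r <= e ->
  {ae P, forall x, exists2 y, Y x = y%:E & `|y| <= `|Y1 x| + `|Y2 x| + r} ->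
  (P [set x | e%:E <= `|Y x|] <= P [set x | e1%:E <= `|(Y1 x)%:E|] +
    P [set x | e2%:E <= `|(Y2 x)%:E|])%E.
Proof.
move=> mY mY1 mY2 ee [N [mN N0 YN]].
have mge (Z : T -> \bar R) c : measurable_fun setT Z -> measurable [set x | (c%:E <= `|Z x|)%E].
  move=> mZ; rewrite -[X in measurable X]setTI.
  apply: emeasurable_fun_c_infty => //.
  exact: (measurableT_comp (@abse_measurable R setT) mZ).
have mA := mge _ e mY.
have mA1 : measurable [set x | (e1%:E <= `|(Y1 x)%:E|)%E] by apply: (mge (EFin \o Y1));
  exact/measurable_EFinP.
have mA2 : measurable [set x | (e2%:E <= `|(Y2 x)%:E|)%E] by apply: (mge (EFin \o Y2));
  exact/measurable_EFinP.
apply: (@le_trans _ _ (P ([set x | e1%:E <= `|(Y1 x)%:E|] `|` [set x | e2%:E <= `|(Y2 x)%:E|]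
  `|` N))%E).
  apply: le_measure; rewrite ?inE//; first by apply: measurableU => //; exact: measurableU.
  move=> x /= Yx; have [Nx|Nx] := pselect (N x); [by right|left].
  have [y yE yl] : exists2 y, Y x = y%:E & `|y| <= `|Y1 x| + `|Y2 x| + r.
    by apply: contrapT => H; apply: Nx; apply: YN.
  have ey : e <= `|y| by move: Yx; rewrite yE /= lee_fin.
  rewrite !lee_fin; have [h1|h1] := leP e1 `|Y1 x|; first by left.
  right; rewrite leNgt; apply/negP => h2; lra.
apply: (le_trans (measureU2 _ _ _)) => //; first exact: measurableU.
rewrite [X in (_ + X <= _)%E]N0 adde0; exact: measureU2.
Qed.

End variance.

Lemma quarter_split (R : realType) (e : R) : e / 4 + e / 4 + e / 2 <= e.
Proof. lra. Qed.

Lemma half_quarter_split (R : realType) (a b e : R) :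
  `|a| + `|b| / 2 + e / 4 + e / 4 <= `|a| + `|b| + e / 2.
Proof. have := normr_ge0 b; lra. Qed.

Section one_sample_size.
Context {R : realType} (p : nat) (p_gt0 : (0 < p)%N) (f : angular_function R).
Hypothesis f0 : f 0 = 1.
Variables (kappa nu eps Mt : R) (theta tau : 'cV[R]_p).
Hypotheses (kappa_ge0 : 0 <= kappa) (nu_ge0 : 0 <= nu).
Hypotheses (kappa_eps : kappa <= eps) (eps8 : eps <= 8^-1).
Hypothesis SD : forall s t, `|s| <= kappa -> `|t| <= kappa ->
  `|f s - f t - (s - t)| <= eps * `|s - t|.
Hypotheses (theta1 : enorm theta = 1) (theta1' : enorm (theta + nu *: tau) = 1).
Hypothesis tauM : enorm tau <= Mt.
Notation V := 'cV[R]_p.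
Notation theta' := (theta + nu *: tau).
Notation P := (rotsym_law theta kappa f).
Notation U := (rotsym_law theta 0 f).
Notation w := (angular_weight f kappa theta).
Notation b := (kappa * nu).
Notation u := (b * Mt).

(** The bound [SD] at - kappa and 0 gives f(- kappa) >= 1 - kappa - eps kappa, which is positive
    since both kappa and eps are at most 1/8. *)
Lemma f_kappa_gt0 : 0 < f (- kappa).
Proof.
have := SD (s := - kappa) (t := 0); rewrite normrN normr0 ger0_norm// f0 subr0.
move=> /(_ (lexx _) kappa_ge0); rewrite normrN (ger0_norm kappa_ge0) ler_norml => /andP[h _].
have : eps * kappa <= 8^-1 * kappa by rewrite ler_wpM2r.
have := le_trans kappa_eps eps8; lra.
Qed.

Lemma weight_expansion x : `|w x - 1 - kappa * dotv (radial_proj x) theta| <= eps * kappa.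
Proof.
have xk : `|kappa * dotv (radial_proj x) theta| <= kappa.
  by rewrite ler_norml; exact: kappa_dotv_radial_proj.
have := SD xk (t := 0); rewrite normr0 => /(_ kappa_ge0).
rewrite f0 !subr0 => /le_trans; apply; rewrite ler_wpM2l//; exact: le_trans kappa_eps.
Qed.

Lemma weight_close x : `|w x - 1| <= 2 * kappa.
Proof.
have xk : `|kappa * dotv (radial_proj x) theta| <= kappa.
  by rewrite ler_norml; exact: kappa_dotv_radial_proj.
have := weight_expansion x.
have : eps * kappa <= 1 * kappa by rewrite ler_wpM2r//; move: eps8; lra.
move: xk; rewrite !ler_norml => /andP[? ?] ? /andP[? ?]; apply/andP; split; lra.
Qed.

Definition ratio_dev (x : V) : R := angular_ratio f kappa theta' theta x - 1.
Notation D := ratio_dev.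

Definition linear_dev (x : V) : R := b * dotv (radial_proj x) tau.
Notation y := linear_dev.

Lemma b_ge0 : 0 <= b. Proof. exact: mulr_ge0. Qed.

Lemma linear_dev_le x : `|y x| <= u.
Proof.
rewrite normrM ger0_norm ?b_ge0// ler_wpM2l ?b_ge0//.
exact: le_trans (dotv_radial_proj_le _ _) tauM.
Qed.

(** With w' the weight at [theta'], D - y = ((w' - w - y) + y (1 - w)) / w. The numerator is at most
    3 eps |y| and w >= 1/2, whence 6. The error is relative to y itself, however small nu is. *)
Lemma ratio_dev_linear x : `|D x - y x| <= 6 * eps * `|y x|.
Proof.
have w2 := weight_close x.
have k8 := le_trans kappa_eps eps8.
have w0 : 2^-1 <= w x by move: w2; rewrite ler_norml => /andP[? ?]; lra.
have wp : 0 < w x by lra.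
have sk : `|kappa * dotv (radial_proj x) theta'| <= kappa.
  by rewrite ler_norml; exact: kappa_dotv_radial_proj.
have tk : `|kappa * dotv (radial_proj x) theta| <= kappa.
  by rewrite ler_norml; exact: kappa_dotv_radial_proj.
have := SD sk tk.
have -> : kappa * dotv (radial_proj x) theta' - kappa * dotv (radial_proj x) theta = y x.
  by rewrite /y dotvDr dotvZr; ring.
rewrite -/(angular_weight f kappa theta' x) -/(w x) => h.
have -> : D x - y x = ((angular_weight f kappa theta' x - w x - y x) + y x * (1 - w x)) / w x.
  by rewrite /D /angular_ratio; field; rewrite gt_eqF.
rewrite normrM normfV (gtr0_norm wp) ler_pdivrMr//.
apply: (le_trans (ler_normD _ _)); rewrite normrM (distrC 1).
apply: (@le_trans _ _ (eps * `|y x| + `|y x| * (2 * eps))).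
  by apply: lerD => //; rewrite ler_wpM2l// (le_trans w2)// ler_pM2l.
have -> : 6 * eps * `|y x| * w x = 6 * (eps * `|y x|) * w x by ring.
have -> : `|y x| * (2 * eps) = 2 * (eps * `|y x|) by ring.
have : 0 <= eps * `|y x| by rewrite mulr_ge0//; exact: le_trans kappa_eps.
move: (eps * `|y x|) (w x) w0 => z v v0 z0.
have : z * 2^-1 <= z * v by rewrite ler_wpM2l.
lra.
Qed.

Lemma ratio_dev_le x : `|D x| <= 2 * `|y x|.
Proof.
have := ratio_dev_linear x.
have : 6 * eps * `|y x| <= 1 * `|y x|.
  by rewrite ler_wpM2r//; apply: (@le_trans _ _ (6 * 8^-1)); [rewrite ler_pM2l|lra].
move=> h1 h2; rewrite -(subrK (y x) (D x)); apply: (le_trans (ler_normD _ _)); lra.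
Qed.

Lemma ratio_dev_bound x : `|D x| <= 2 * u.
Proof. by apply: (le_trans (ratio_dev_le x)); rewrite ler_pM2l// linear_dev_le. Qed.

Lemma bmeas_linear_dev : bmeas y.
Proof. by apply: bmeasM; [exact: bmeas_cst|exact: bmeas_dotv_radial_proj]. Qed.

Lemma bmeas_ratio_dev : bmeas D.
Proof.
split; last by exists (2 * u); exact: ratio_dev_bound.
apply: measurable_funB; last exact: measurable_cst.
exact: (measurable_angular_ratio kappa_ge0 f_kappa_gt0 theta1' theta1).
Qed.

Lemma bmeas_angular_ratio : bmeas (angular_ratio f kappa theta' theta).
Proof.
rewrite (_ : angular_ratio _ _ _ _ = fun x => D x + 1).
  by apply: bmeasD; [exact: bmeas_ratio_dev|exact: bmeas_cst].
by apply/funext => x; rewrite subrK.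
Qed.

Lemma ratio_dev_mean : \int[P]_x D x = 0.
Proof.
rewrite RintegralB_bm; [|exact: bmeas_angular_ratio|exact: bmeas_cst].
rewrite Rintegral_prob_cst.
have := @bmeas_ge0_integral_transfer _ _ R (rotsym_law theta' kappa f) _ _ P id
  (angular_ratio f kappa theta' theta) (fun=> 1) (@measurable_id _ _ _) bmeas_angular_ratio.
rewrite Rintegral_prob_cst => ->; last exact: bmeas_cst.
- by under [X in _ - X]eq_Rintegral do rewrite mul1r; rewrite subrr.
- by move=> x; apply/ltW;
  exact: (@angular_ratio_gt0 R p f kappa kappa_ge0 f_kappa_gt0 theta' theta x theta1' theta1).
- by move=> h mh h0; exact: (ge0_integral_angular_ratio p_gt0 kappa_ge0 f_kappa_gt0 theta1' theta1).
Qed.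

Lemma mean_theta_close :
  `|\int[P]_x dotv (radial_proj x) theta - kappa / p%:R| <= 2 * (eps * kappa).
Proof. exact: (rotsym_mean_theta p_gt0 f0 kappa_ge0 f_kappa_gt0 theta1 weight_expansion). Qed.

Lemma rotsym_uniform_diff (h : V -> R) C : bmeas h -> (forall x, `|h x| <= C) ->
  `|\int[P]_x h x - \int[U]_x h x| <= 2 * C * (2 * kappa).
Proof.
move=> bh hC.
exact: (rotsym_uniform_close p_gt0 f0 kappa_ge0 f_kappa_gt0 theta1 bh hC weight_close).
Qed.

(** 18 = 6 * 3 comes from the factorization of D^2 - y^2 into (D - y) (D + y), and 4 from passing to
    the uniform law, under which the second moment of y is explicit. *)
Lemma ratio_dev_sqr_mean :
  `|\int[P]_x D x ^+ 2 - b ^+ 2 * (dotv tau tau / p%:R)| <= 22 * eps * u ^+ 2.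
Proof.
have e0 : 0 <= eps by exact: le_trans kappa_eps.
have by2 : bmeas (fun x => y x ^+ 2) by apply: bmeasX; exact: bmeas_linear_dev.
have bD2 : bmeas (fun x => D x ^+ 2) by apply: bmeasX; exact: bmeas_ratio_dev.
have h1 : `|\int[P]_x D x ^+ 2 - \int[P]_x y x ^+ 2| <= 18 * eps * u ^+ 2.
  rewrite -RintegralB_bm//; apply: norm_Rintegral_le; first exact: bmeasB.
  move=> x; rewrite subr_sqr normrM.
  have yu := linear_dev_le x.
  apply: (@le_trans _ _ ((6 * eps * u) * (3 * u))); last first.
    by rewrite le_eqVlt; apply/orP; left; apply/eqP; ring.
  apply: ler_pM => //.
    by apply: (le_trans (ratio_dev_linear x)); rewrite ler_wpM2l// mulr_ge0.
  apply: (le_trans (ler_normD _ _)); have := ratio_dev_bound x.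
  by move: yu; move: (`|y x|) (`|D x|) u => ? ? ?; lra.
have h2 : `|\int[P]_x y x ^+ 2 - \int[U]_x y x ^+ 2| <= 4 * eps * u ^+ 2.
  apply: (le_trans (rotsym_uniform_diff by2 (C := u ^+ 2) _)).
    by move=> x; rewrite normrX lerXn2r ?nnegrE ?linear_dev_le// (le_trans _ (linear_dev_le x)).
  rewrite (_ : 2 * u ^+ 2 * (2 * kappa) = 4 * kappa * u ^+ 2); last by ring.
  by rewrite ler_wpM2r ?sqr_ge0// ler_pM2l.
have h3 : \int[U]_x y x ^+ 2 = b ^+ 2 * (dotv tau tau / p%:R).
  rewrite -(uniform_sqr p_gt0 f0 theta1 tau) -RintegralZl_bm; last first.
    by apply: bmeasX; exact: bmeas_dotv_radial_proj.
  by apply: eq_Rintegral => x _; rewrite /y exprMn.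
rewrite -h3 -(subrKA (\int[P]_x y x ^+ 2)); apply: (le_trans (ler_normD _ _)).
rewrite (_ : 22 * eps * u ^+ 2 = 18 * eps * u ^+ 2 + 4 * eps * u ^+ 2); last by ring.
exact: lerD.
Qed.

Section expansion.
Variables (n : nat) (zeta : V) (k e : R) (Y : n.-tuple V -> \bar R).
Hypotheses (e0 : 0 < e) (mY : measurable_fun setT Y) (u4 : 2 * u <= 2^-1).
Hypothesis YE : {ae joint_law kappa f n theta, forall x, Y x =
  (loglik_ratio kappa f theta' theta x -
   (\sum_(i < n) dotv (radial_proj (tnth x i)) zeta + k)%:E)%E}.
Hypothesis centering : `|n%:R * (dotv zeta theta * \int[P]_x dotv (radial_proj x) theta)
  + n%:R * \int[P]_x D x ^+ 2 / 2 + k| <= e / 4.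
Hypothesis remainder : n%:R * (2 * (2 * u) ^+ 3) <= e / 4.

(** Four contributions receive e / 4 each: the centred sums of D(x) - x'zeta and of D^2, handled by
    Chebyshev's inequality, the deterministic centring, and the cubic remainder of the logarithm. *)
Lemma loglik_remainder_prob :
  (joint_law kappa f n theta [set x | e%:E <= `|Y x|] <=
   (((e / 4) ^+ 2)^-1 * (n%:R * (6 * eps * u + enorm (b *: tau - zeta)) ^+ 2) +
    ((e / 4) ^+ 2)^-1 * (n%:R * (2 * u) ^+ 4))%:E)%E.
Proof.
have e40 : 0 < e / 4 by rewrite divr_gt0.
have bD := bmeas_ratio_dev.
have bz : bmeas (fun x : V => dotv (radial_proj x) zeta) by exact: bmeas_dotv_radial_proj.
pose g x := D x - dotv (radial_proj x) zeta.
have bg : bmeas g by exact: bmeasB.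
pose psi1 x := g x - \int[P]_x g x.
pose psi2 x := D x ^+ 2 - \int[P]_x D x ^+ 2.
have bD2 := bmeasX 2 bD.
have b1 : bmeas psi1 by apply: bmeasB => //; exact: bmeas_cst.
have b2 : bmeas psi2 by apply: bmeasB => //; exact: bmeas_cst.
have E1 : \int[P]_x psi1 x = 0.
  by rewrite RintegralB_bm//; [rewrite Rintegral_prob_cst subrr|exact: bmeas_cst].
have E2 : \int[P]_x psi2 x = 0.
  by rewrite RintegralB_bm//; [rewrite Rintegral_prob_cst subrr|exact: bmeas_cst].
have Eg : \int[P]_x g x = - (dotv zeta theta * \int[P]_x dotv (radial_proj x) theta).
  rewrite RintegralB_bm// ratio_dev_mean sub0r.
  by rewrite (rotsym_mean p_gt0 kappa_ge0 f_kappa_gt0 theta1 zeta).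
have gC x : `|g x| <= 6 * eps * u + enorm (b *: tau - zeta).
  have -> : g x = (D x - y x) + dotv (radial_proj x) (b *: tau - zeta).
    by rewrite /g /y dotvBr dotvZr; ring.
  apply: (le_trans (ler_normD _ _)); apply: lerD; last exact: dotv_radial_proj_le.
  apply: (le_trans (ratio_dev_linear x)); rewrite ler_wpM2l ?linear_dev_le//.
  by rewrite mulr_ge0//; exact: le_trans kappa_eps.
have V1 := variance_le P bg gC.
have V2 : \int[P]_x psi2 x ^+ 2 <= (2 * u) ^+ 4.
  rewrite (_ : (2 * u) ^+ 4 = ((2 * u) ^+ 2) ^+ 2); last by rewrite -exprM.
  apply: variance_le => // x; rewrite normrX lerXn2r ?nnegrE ?ratio_dev_bound//.
  exact: le_trans (ratio_dev_bound x).
have C1 := chebyshev_iid n b1 E1 e40.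
have C2 := chebyshev_iid n b2 E2 e40.
apply: (@le_trans _ _ (joint_law kappa f n theta
    [set t | (e / 4)%:E <= `|(\sum_(i < n) psi1 (tnth t i))%:E|] +
  joint_law kappa f n theta
    [set t | (e / 4)%:E <= `|(\sum_(i < n) psi2 (tnth t i))%:E|])%E); last first.
  rewrite EFinD; apply: leeD.
    apply: (le_trans C1); rewrite lee_fin ler_wpM2l ?invr_ge0 ?sqr_ge0//.
    by rewrite ler_wpM2l.
  apply: (le_trans C2); rewrite lee_fin ler_wpM2l ?invr_ge0 ?sqr_ge0//.
  by rewrite ler_wpM2l.
apply: (@probability_le_split _ _ _ _ Y _ _ (e / 2)) => //.
- exact: (bmeas_sum_tnth n b1).1.
- exact: (bmeas_sum_tnth n b2).1.
- exact: quarter_split.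
have H := ae_loglik_ratio p_gt0 kappa_ge0 f_kappa_gt0 n theta1' theta1.
apply: filterS2 YE H => x -> ->.
eexists; first by [].
pose rem i := ln (1 + D (tnth x i)) - D (tnth x i) + D (tnth x i) ^+ 2 / 2.
have remE i : `|rem i| <= 2 * (2 * u) ^+ 3.
  have Du := ratio_dev_bound (tnth x i).
  apply: (le_trans (ln1D_expansion (le_trans Du u4))).
  by rewrite ler_pM2l// lerXn2r ?nnegrE// (le_trans _ Du).
pose m := \int[P]_x dotv (radial_proj x) theta.
pose q := \int[P]_x D x ^+ 2.
have Egm : \int[P]_x g x = - (dotv zeta theta * m) := Eg.
have cent : `|n%:R * (dotv zeta theta * m) + n%:R * q / 2 + k| <= e / 4 := centering.
(* The mean of D - x'zeta is minus that of x'zeta because D is centred; hence the sign of the first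
   term of the centring. *)
have -> : \sum_(i < n) ln (angular_ratio f kappa theta' theta (tnth x i)) -
    (\sum_(i < n) dotv (radial_proj (tnth x i)) zeta + k) =
    \sum_(i < n) psi1 (tnth x i) - (\sum_(i < n) psi2 (tnth x i)) / 2 +
    \sum_(i < n) rem i - (n%:R * (dotv zeta theta * m) + n%:R * q / 2 + k).
  rewrite mulr_suml opprD addrA -!sumrB -big_split/=.
  rewrite (_ : n%:R * (dotv zeta theta * m) + n%:R * q / 2 + k =
    \sum_(i < n) (dotv zeta theta * m + q / 2) + k); last first.
    by rewrite sumr_const card_ord -mulr_natl; ring.
  rewrite opprD addrA -sumrB; congr (_ - _); apply: eq_bigr => i _.
  rewrite /rem /psi1 /psi2 Egm -/q /g (_ : angular_ratio _ _ _ _ _ = 1 + D (tnth x i)).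
    by field.
  by rewrite /D addrCA subrr addr0.
have remS : `|\sum_(i < n) rem i| <= e / 4.
  apply: le_trans remainder; apply: (le_trans (ler_norm_sum _ _ _)).
  apply: (@le_trans _ _ (\sum_(i < n) 2 * (2 * u) ^+ 3)); first exact: ler_sum.
  by rewrite sumr_const card_ord -[leLHS]mulr_natl.
move: remS cent; move: (\sum_(i < n) rem i) (n%:R * _ + _ + _) => r1 r2.
move: (\sum_(i < n) psi1 _) (\sum_(i < n) psi2 _) => s1 s2 h1 h2.
apply: (le_trans (ler_normB _ _)).
apply: (@le_trans _ _ (`|s1| + `|s2| / 2 + e / 4 + e / 4)).
  apply: lerD => //; apply: (le_trans (ler_normD _ _)); apply: lerD => //.
  apply: (le_trans (ler_normB _ _)); rewrite lerD2l normrM ler_wpM2l//.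
  by rewrite ger0_norm.
exact: half_quarter_split.
Qed.

End expansion.

End one_sample_size.

(** * Asymptotic expansion of the log-likelihood ratio *)

Section asymptotic_expansion.
Context {R : realType} (p : nat) (p_gt0 : (0 < p)%N) (f : angular_function R).
Hypothesis f0 : f 0 = 1.
Notation V := 'cV[R]_p.
Variables (kappa nu eps : R^nat) (Mt alpha : R) (theta : V) (tau zeta : nat -> V) (k : R^nat).
Hypotheses (kappa_ge0 : forall n, 0 <= kappa n) (nu_ge0 : forall n, 0 <= nu n).
Hypothesis eps0 : eps n @[n --> \oo] --> (0 : R).
Hypothesis SD : \forall n \near \oo, kappa n <= eps n /\
  forall s t, `|s| <= kappa n -> `|t| <= kappa n ->
    `|f s - f t - (s - t)| <= eps n * `|s - t|.
Hypotheses (theta1 : enorm theta = 1).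
Hypothesis theta1' : \forall n \near \oo, enorm (theta + nu n *: tau n) = 1.
Hypothesis tauM : forall n, enorm (tau n) <= Mt.
Notation b n := (kappa n * nu n).
Notation a n := (Num.sqrt n%:R * (kappa n * nu n)).
Hypothesis a_cvg : a n @[n --> \oo] --> alpha.
Hypothesis zeta_close :
  Num.sqrt n%:R * enorm (b n *: tau n - zeta n) @[n --> \oo] --> (0 : R).
Notation m n := (\int[rotsym_law theta (kappa n) f]_x dotv (radial_proj x) theta).
Hypothesis drift : n%:R * (dotv (zeta n) theta * m n) +
  a n ^+ 2 * (dotv (tau n) (tau n) / p%:R) / 2 + k n @[n --> \oo] --> (0 : R).
Variable Y : forall n, n.-tuple V -> \bar R.
Arguments Y : clear implicits.
Hypothesis mY : \forall n \near \oo, measurable_fun setT (Y n).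
Hypothesis YE : \forall n \near \oo, {ae joint_law (kappa n) f n theta, forall x, Y n x =
  (loglik_ratio (kappa n) f (theta + nu n *: tau n) theta x -
   (\sum_(i < n) dotv (radial_proj (tnth x i)) (zeta n) + k n)%:E)%E}.

(** With A n = a n Mt convergent and s n = n^(-1/2), the uniform bound kappa nu Mt on the linear
    part equals A s. Then n (A s)^3 and n (A s)^4 vanish, while n (A s)^2 = A^2 stays bounded and is
    always met with a factor that tends to 0. *)
Lemma loglik_remainder_cvg0 e : 0 < e ->
  joint_law (kappa n) f n theta [set x | (e%:E <= `|Y n x|)%E] @[n --> \oo] --> 0%E.
Proof.
move=> e0; pose A n := a n * Mt.
pose s n : R := (Num.sqrt n%:R)^-1.
pose q n := Num.sqrt n%:R * enorm (b n *: tau n - zeta n).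
pose dr n := n%:R * (dotv (zeta n) theta * m n) +
  a n ^+ 2 * (dotv (tau n) (tau n) / p%:R) / 2 + k n.
have A_cvg : A n @[n --> \oo] --> alpha * Mt by apply: cvgM => //; exact: cvg_cst.
have s_cvg : s n @[n --> \oo] --> (0 : R) by exact: cvg_inv_sqrt.
have AX j : A n ^+ j @[n --> \oo] --> (alpha * Mt) ^+ j.
  elim: j => [|j IHj]; first exact: cvg_cst.
  by under eq_fun do rewrite exprS; rewrite exprS; apply: cvgM.
(* [B1] and [B2] are the two Chebyshev bounds, [B3] the cubic remainder, [B4] the bound on |D|, and
   [B5] the centring, with 11 = 22 / 2 from [ratio_dev_sqr_mean]. *)
pose B1 n := (6 * eps n * A n + q n) ^+ 2.
pose B2 n := 16 * A n ^+ 4 * s n * s n.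
pose B3 n := 16 * A n ^+ 3 * s n.
pose B4 n := 2 * A n * s n.
pose B5 n := `|dr n| + 11 * eps n * A n ^+ 2.
have cz (x y : R^nat) (l : R) : x n @[n --> \oo] --> l -> y n @[n --> \oo] --> (0 : R) ->
    x n * y n @[n --> \oo] --> (0 : R).
  by move=> xl y0; rewrite -(mulr0 l); exact: cvgM.
have zc (x y : R^nat) (l : R) : x n @[n --> \oo] --> (0 : R) -> y n @[n --> \oo] --> l ->
    x n * y n @[n --> \oo] --> (0 : R).
  by move=> x0 yl; rewrite -(mul0r l); exact: cvgM.
have z6 c : c * eps n @[n --> \oo] --> (0 : R) by apply: cz => //; exact: cvg_cst.
have B1c : B1 n @[n --> \oo] --> (0 : R).
  have H : 6 * eps n * A n + q n @[n --> \oo] --> (0 : R).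
    by rewrite -(addr0 (0 : R)); apply: cvgD => //; exact: (zc _ _ _ (z6 6) A_cvg).
  by rewrite /B1; under eq_fun do rewrite expr2; exact: (zc _ _ _ H H).
have cA c j : c * A n ^+ j @[n --> \oo] --> c * (alpha * Mt) ^+ j.
  by apply: cvgM => //; exact: cvg_cst.
have B2c : B2 n @[n --> \oo] --> (0 : R) by exact: (zc _ _ _ (cz _ _ _ (cA 16 4%N) s_cvg) s_cvg).
have B3c : B3 n @[n --> \oo] --> (0 : R) by exact: (cz _ _ _ (cA 16 3%N) s_cvg).
have B4c : B4 n @[n --> \oo] --> (0 : R).
  by apply: (cz _ _ _ _ s_cvg); apply: (cvgM _ A_cvg); exact: cvg_cst.
have B5c : B5 n @[n --> \oo] --> (0 : R).
  rewrite -(addr0 (0 : R)); apply: cvgD; last exact: (zc _ _ _ (z6 11) (AX 2%N)).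
  by rewrite -(@normr0 _ R); exact: cvg_norm.
pose B n := ((e / 4) ^+ 2)^-1 * B1 n + ((e / 4) ^+ 2)^-1 * B2 n.
have Bc : B n @[n --> \oo] --> (0 : R).
  by rewrite -(addr0 (0 : R)); apply: cvgD; (apply: cz; first exact: cvg_cst).
have small (x : R^nat) c : x n @[n --> \oo] --> (0 : R) -> 0 < c ->
    \forall n \near \oo, `|x n| <= c.
  move=> x0 c0; move/cvgrPdist_le : x0 => /(_ c c0); apply: filterS => n.
  by rewrite sub0r normrN.
have e40 : 0 < e / 4 by rewrite divr_gt0.
have h12 : 0 < 2^-1 :> R by rewrite invr_gt0.
have h18 : 0 < 8^-1 :> R by rewrite invr_gt0.
apply: (@squeeze_cvge _ _ _ _ (cst 0%E) _ (fun n => (B n)%:E)); last 2 first.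
- exact: cvg_cst.
- by apply: cvg_EFin => //; near=> n.
near=> n; apply/andP; split; first exact: measure_ge0.
have n0 : (0 < n)%N by near: n; exists 1%N.
have nR : 0 < n%:R :> R by rewrite ltr0n.
have s0 : 0 < Num.sqrt n%:R :> R by rewrite sqrtr_gt0.
have nE : n%:R = Num.sqrt n%:R ^+ 2 :> R by rewrite sqr_sqrtr// ltW.
have [ke SDn] : kappa n <= eps n /\
  forall s t, `|s| <= kappa n -> `|t| <= kappa n ->
    `|f s - f t - (s - t)| <= eps n * `|s - t| by near: n.
have t1' : enorm (theta + nu n *: tau n) = 1 by near: n.
have e8 : eps n <= 8^-1.
  by apply: (le_trans (ler_norm _)); near: n; exact: small.
have ns : n%:R * s n ^+ 2 = 1.
  by rewrite /s exprVn -nE mulfV// gt_eqF.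
have sqs : Num.sqrt n%:R * s n = 1 by rewrite /s mulfV// gt_eqF.
have uE : b n * Mt = A n * s n.
  by rewrite -[LHS]mulr1 -[X in _ * X = _]sqs /A; ring.
have B3E : n%:R * (2 * (2 * (b n * Mt)) ^+ 3) = B3 n.
  by rewrite uE -[RHS]mulr1 -[X in _ = _ * X]ns /B3; ring.
have B2E : n%:R * (2 * (b n * Mt)) ^+ 4 = B2 n.
  by rewrite uE -[RHS]mulr1 -[X in _ = _ * X]ns /B2; ring.
have B1E : n%:R * (6 * eps n * (b n * Mt) + enorm (b n *: tau n - zeta n)) ^+ 2 = B1 n.
  rewrite /B1 (_ : 6 * eps n * A n + q n =
    Num.sqrt n%:R * (6 * eps n * (b n * Mt) + enorm (b n *: tau n - zeta n))).
    by rewrite exprMn -nE.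
  have -> : 6 * eps n * A n = 6 * eps n * A n * (Num.sqrt n%:R * s n) by rewrite sqs mulr1.
  by rewrite uE /q; ring.
have := @loglik_remainder_prob R p p_gt0 f f0 (kappa n) (nu n) (eps n) Mt theta (tau n)
  (kappa_ge0 n) (nu_ge0 n) ke e8 SDn theta1 t1' (tauM n) n (zeta n) (k n) e (Y n) e0.
rewrite B1E B2E B3E; apply.
- by near: n.
- rewrite uE mulrA; apply: (le_trans (ler_norm _)).
  by near: n; exact: small.
- by near: n.
- have DM := @ratio_dev_sqr_mean R p p_gt0 f f0 (kappa n) (nu n) (eps n) Mt theta (tau n)
    (kappa_ge0 n) (nu_ge0 n) ke e8 SDn theta1 t1' (tauM n).
  apply: (@le_trans _ _ (B5 n)); last first.
    by apply: (le_trans (ler_norm _)); near: n; exact: small.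
  set Q := Rintegral _ _ _ in DM *.
  have -> : n%:R * (dotv (zeta n) theta * m n) + n%:R * Q / 2 + k n =
    dr n + n%:R * (Q - b n ^+ 2 * (dotv (tau n) (tau n) / p%:R)) / 2.
    by rewrite /dr exprMn -nE; field; rewrite gt_eqF// ltr0n.
  apply: (le_trans (ler_normD _ _)); rewrite lerD2l.
  rewrite -mulrA normrM (gtr0_norm nR) normrM (ger0_norm (ltW h12)).
  apply: (@le_trans _ _ (n%:R * (22 * eps n * (b n * Mt) ^+ 2 * 2^-1))).
    by rewrite ler_wpM2l ?(ltW nR)// ler_wpM2r.
  rewrite uE le_eqVlt; apply/orP; left; apply/eqP.
  by rewrite -[RHS]mulr1 -[X in _ = _ * X]ns; field.
- by apply: (le_trans (ler_norm _)); near: n; exact: small.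
Unshelve. all: by end_near. Qed.

End asymptotic_expansion.

(** * The three regimes *)

Section tangent_projection.
Context {R : realType} (p : nat).
Notation V := 'cV[R]_p.
Implicit Types (r : regime) (theta tau x : V) (xi : R).

(** In each regime a symmetric idempotent matrix M with Gamma = xi^2 M, through which the central
    sequence depends on the observations. It allows one proof for the three regimes. *)
Definition score_proj r theta : 'M[R]_p :=
  match r with
  | beyond_contiguity => 1%:M - theta *m theta^T
  | under_contiguity => 1%:M
  | strict_contiguity => 0
  end.

(** Under contiguity xi^2 theta is the limit of the mean of the linear statistic, as follows from
    [sqrt_mean_theta_cvg]. *)
Definition score_shift r xi : R :=
  match r with under_contiguity => xi ^+ 2 | _ => 0 end.

Lemma score_proj_tr r theta : (score_proj r theta)^T = score_proj r theta.
Proof. by case: r; rewrite /= ?trmx0 ?trmx1// linearB/= trmx1 trmx_mul trmxK. Qed.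

Lemma outer_mul theta x : theta *m theta^T *m x = dotv theta x *: theta.
Proof. by rewrite -mulmxA [theta^T *m x]mx11_scalar mul_mx_scalar. Qed.

Lemma score_proj_mul r theta x : score_proj r theta *m x =
  match r with
  | beyond_contiguity => x - dotv theta x *: theta
  | under_contiguity => x
  | strict_contiguity => 0
  end.
Proof. by case: r; rewrite /= ?mul1mx ?mul0mx// mulmxBl mul1mx outer_mul. Qed.

Lemma score_proj_idem r theta : enorm theta = 1 ->
  score_proj r theta *m (score_proj r theta)^T = score_proj r theta.
Proof.
move=> t1; rewrite score_proj_tr; apply/trmx_inj; rewrite trmx_mul score_proj_tr.
case: r; rewrite /= ?mulmx1 ?mulmx0//.
rewrite mulmxBr mulmx1 mulmxBl mul1mx -mulmxA (mulmxA theta^T) [theta^T *m theta]mx11_scalar.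
rewrite -[_ 0 0]/(dotv theta theta) enorm1_dotv// mul_scalar_mx scale1r.
by rewrite subrr subr0.
Qed.

Lemma fisher_informationE r xi theta :
  fisher_information r xi theta = xi ^+ 2 *: score_proj r theta.
Proof. by case: r; rewrite //= scaler0. Qed.

Lemma score_scaleE (n : nat) xi : (0 < n)%N ->
  xi * Num.sqrt (n * p)%:R / n%:R = xi * Num.sqrt p%:R / Num.sqrt n%:R :> R.
Proof.
move=> n0; have s0 : 0 < Num.sqrt n%:R :> R by rewrite sqrtr_gt0 ltr0n.
rewrite natrM sqrtrM//.
have -> : n%:R^-1 = (Num.sqrt n%:R)^-1 ^+ 2 :> R by rewrite exprVn sqr_sqrtr.
by field; rewrite gt_eqF.
Qed.

(** The sphere condition allows [radial_proj] to be inserted, which makes the summands bounded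
    functions on all of R^p. *)
Lemma central_sequenceE r xi theta (n : nat) (x : n.-tuple V) : (0 < n)%N ->
  (forall i, sphere p (tnth x i)) ->
  central_sequence r xi theta x = (xi * Num.sqrt p%:R / Num.sqrt n%:R) *:
    (\sum_(i < n) score_proj r theta *m radial_proj (tnth x i)) - score_shift r xi *: theta.
Proof.
move=> n0 xs; have -> : \sum_(i < n) score_proj r theta *m radial_proj (tnth x i) =
    score_proj r theta *m \sum_(i < n) tnth x i.
  by rewrite mulmx_sumr; apply: eq_bigr => i _; rewrite radial_proj_sphere.
rewrite -score_scaleE// /central_sequence /sample_mean.
case: r => /=.
- by rewrite scale0r subr0 -scalemxAr scalerA.
- by rewrite mul1mx scalerA.
- by rewrite mul0mx scaler0 scale0r subr0.
Qed.

Lemma measurable_central_sequence r xi theta (n : nat) :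
  measurable_fun setT (@central_sequence R p r xi theta n).
Proof.
have ms : measurable_fun setT (fun x : n.-tuple V => sample_mean x).
  apply: measurable_scalev; first exact: measurable_cst.
  apply: measurable_fun_cVP => j; under eq_fun do rewrite summxE.
  apply: measurable_sum => i.
  exact: (measurableT_comp (measurable_coord j) (measurable_tnth i)).
case: r.
- by apply: measurable_scalev; [exact: measurable_cst|exact: measurable_mulmxv].
- apply: measurable_addv; last exact: measurable_cst.
  by apply: measurable_scalev => //; exact: measurable_cst.
- exact: measurable_cst.
Qed.

Lemma enorm_triangle x y : enorm (x + y) <= enorm x + enorm y.
Proof.
have h := enorm_ge0 x; have h' := enorm_ge0 y.
rewrite -(@ler_pXn2r _ 2) ?nnegrE ?addr_ge0 ?enorm_ge0// sqrrD !enorm_sqr.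
rewrite dotvDl !dotvDr (dotvC y x).
have := cauchy_schwarz x y; rewrite ler_norml => /andP[_ ?]; lra.
Qed.

Lemma sphere_shift_dotv theta tau (nu : R) : enorm theta = 1 ->
  enorm (theta + nu *: tau) = 1 -> 0 < nu ->
  dotv theta tau = - (nu * dotv tau tau / 2).
Proof.
move=> t1 t1' nu0; have := enorm1_dotv t1'.
rewrite dotvDl !dotvDr !dotvZl !dotvZr (dotvC tau) enorm1_dotv// => H.
have : nu * (2 * dotv theta tau + nu * dotv tau tau) = 0 by lra.
by move/eqP; rewrite mulf_eq0 gt_eqF//= => /eqP ?; lra.
Qed.

End tangent_projection.

Section rates.
Context {R : realType} (p : nat).
Variables (eta kappa : R^nat) (xi : R).
Hypotheses (eta_ge0 : forall n, 0 <= eta n) (xi_gt0 : 0 < xi).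
Hypothesis kappaE : (fun n => kappa n - Num.sqrt p%:R * eta n * xi) =o_\oo eta.
Notation sp := (Num.sqrt p%:R : R).

Lemma rate_error e : 0 < e -> \forall n \near \oo,
  `|kappa n - sp * eta n * xi| <= e * eta n.
Proof.
move=> e0; have /eqoP/(_ e e0) := kappaE.
by apply: filterS => n; rewrite (ger0_norm (eta_ge0 n)).
Qed.

Lemma rate_cvg0 : eta n @[n --> \oo] --> (0 : R) -> kappa n @[n --> \oo] --> (0 : R).
Proof.
move=> eta0; apply: (@cvg_dist_le _ _ (fun n => (1 + sp * xi) * eta n)).
  near=> n; rewrite subr0.
  have : `|kappa n - sp * eta n * xi| <= 1 * eta n by near: n; exact: rate_error.
  have s0 : 0 <= sp * eta n * xi by rewrite mulr_ge0 ?(ltW xi_gt0)// mulr_ge0 ?sqrtr_ge0.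
  rewrite !ler_norml => /andP[h1 h2]; apply/andP; split; move: (eta_ge0 n); lra.
by rewrite -(mulr0 (1 + sp * xi)); apply: cvgM => //; exact: cvg_cst.
Unshelve. all: by end_near. Qed.

Lemma rate_sqrt_cvg (l : R) : Num.sqrt n%:R * eta n @[n --> \oo] --> l ->
  Num.sqrt n%:R * kappa n @[n --> \oo] --> sp * xi * l.
Proof.
move=> etal; pose err n := Num.sqrt n%:R * (kappa n - sp * eta n * xi).
have err0 : err n @[n --> \oo] --> (0 : R).
  apply/cvgrPdist_le => e e0; have l1 : 0 < `|l| + 1 by rewrite ltr_wpDl.
  have e10 : 0 < e / (`|l| + 1) by rewrite divr_gt0.
  near=> n; rewrite sub0r normrN /err normrM ger0_norm ?sqrtr_ge0//.
  have k1 : `|kappa n - sp * eta n * xi| <= e / (`|l| + 1) * eta n.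
    by near: n; exact: rate_error.
  apply: (@le_trans _ _ (e / (`|l| + 1) * (Num.sqrt n%:R * eta n))).
    by rewrite mulrCA ler_wpM2l// sqrtr_ge0.
  rewrite mulrAC ler_pdivrMr// ler_pM2l//.
  have : `|l - Num.sqrt n%:R * eta n| <= 1 by near: n; move/cvgrPdist_le : etal; exact.
  by rewrite ler_norml => /andP[h _]; have := ler_norm l; lra.
have -> : (fun n => Num.sqrt n%:R * kappa n) =
    (fun n => sp * xi * (Num.sqrt n%:R * eta n) + err n).
  by apply/funext => n; rewrite /err; ring.
rewrite -(addr0 (sp * xi * l)); apply: cvgD => //.
by apply: cvgM => //; exact: cvg_cst.
Unshelve. all: by end_near. Qed.

Lemma eta_gt0_beyond : Num.sqrt n%:R * eta n @[n --> \oo] --> +oo ->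
  \forall n \near \oo, 0 < Num.sqrt n%:R * eta n.
Proof. by move=> /cvgryPgt/(_ 0). Qed.

(** The factors sqrt(n) cancel, and kappa / eta tends to sqrt(p) xi. *)
Lemma rate_ratio_cvg : Num.sqrt n%:R * eta n @[n --> \oo] --> +oo ->
  Num.sqrt n%:R * (kappa n * (Num.sqrt n%:R * eta n)^-1) @[n --> \oo] --> sp * xi.
Proof.
move=> etaoo; apply/cvgrPdist_le => e e0; near=> n.
have sn : 0 < Num.sqrt n%:R * eta n by near: n; exact: eta_gt0_beyond.
have se : (Num.sqrt n%:R != 0 :> R) && (eta n != 0).
  by rewrite -negb_or -mulf_eq0 gt_eqF.
have [s1 n1] := andP se.
have n0 : 0 < eta n by rewrite lt_def n1 eta_ge0.
have -> : sp * xi - Num.sqrt n%:R * (kappa n * (Num.sqrt n%:R * eta n)^-1) =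
    - ((kappa n - sp * eta n * xi) / eta n) by field; rewrite s1 n1.
rewrite normrN normrM normfV (gtr0_norm n0) ler_pdivrMr//.
by near: n; exact: rate_error.
Unshelve. all: by end_near. Qed.

Lemma contiguity_rate_ge0 r n : 0 <= contiguity_rate r eta n.
Proof. by case: r => //=; rewrite invr_ge0 mulr_ge0 ?sqrtr_ge0. Qed.

Definition rate_limit r : R :=
  match r with strict_contiguity => 0 | _ => sp * xi end.

Lemma rate_limit_cvg r : in_regime r eta ->
  Num.sqrt n%:R * (kappa n * contiguity_rate r eta n) @[n --> \oo] --> rate_limit r.
Proof.
case: r => /= H; first exact: rate_ratio_cvg.
- have := rate_sqrt_cvg H; rewrite mulr1.
  by under [in X in _ -> X]eq_fun do rewrite mulr1.
- have := rate_sqrt_cvg H; rewrite mulr0.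
  by under [in X in _ -> X]eq_fun do rewrite mulr1.
Qed.

End rates.

Section lan.
Context {R : realType} (p : nat) (p_gt0 : (0 < p)%N).
Notation V := 'cV[R]_p.
Variables (eta kappa : R^nat) (xi : R) (f : angular_function R) (r : regime) (theta : V).
Hypotheses (eta_ge0 : forall n, 0 <= eta n) (eta_o1 : eta n @[n --> \oo] --> (0 : R)).
Hypothesis xi_gt0 : 0 < xi.
Hypothesis f_diff : \forall t \near (0 : R), derivable f t 1.
Hypothesis f_diff2 : derivable (derive1 f) 0 1.
Hypotheses (f0 : f 0 = 1) (f'0 : derive1 f 0 = 1).
Hypothesis kappa_ge0 : forall n, 0 <= kappa n.
Hypothesis kappaE : (fun n => kappa n - Num.sqrt p%:R * eta n * xi) =o_\oo eta.
Hypotheses (eta_r : in_regime r eta) (theta1 : enorm theta = 1).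
Notation sp := (Num.sqrt p%:R : R).
Notation nu n := (contiguity_rate r eta n).
Notation P n := (rotsym_law theta (kappa n) f).
Notation m n := (\int[P n]_x dotv (radial_proj x) theta).
Notation M := (score_proj r theta).

Lemma sp_neq0 : sp != 0. Proof. by rewrite gt_eqF// sqrtr_gt0 ltr0n. Qed.

Lemma sp_sqr : sp ^+ 2 = p%:R. Proof. by rewrite sqr_sqrtr. Qed.

Lemma strict_derivative_rate : exists2 eps : R^nat, eps n @[n --> \oo] --> (0 : R) &
  \forall n \near \oo, [/\ kappa n <= eps n, eps n <= 8^-1 &
    forall s t, `|s| <= kappa n -> `|t| <= kappa n ->
      `|f s - f t - (s - t)| <= eps n * `|s - t|].
Proof.
have kappa0 := rate_cvg0 eta_ge0 xi_gt0 kappaE eta_o1.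
have [eps eps0 H] := strict_derivative_seq f_diff f_diff2 f'0 kappa_ge0 kappa0.
exists eps => //; near=> n.
have [ke SD] : kappa n <= eps n /\ forall s t, `|s| <= kappa n -> `|t| <= kappa n ->
    `|f s - f t - (s - t)| <= eps n * `|s - t| by near: n.
split => //; apply: (le_trans (ler_norm _)); rewrite -normrN -sub0r.
by near: n; move/cvgrPdist_le : eps0; apply; rewrite invr_gt0.
Unshelve. all: by end_near. Qed.

Lemma f_kappa_near_gt0 : \forall n \near \oo, 0 < f (- kappa n).
Proof.
have [eps _ H] := strict_derivative_rate; apply: filterS H => n [ke e8 SD].
exact: (f_kappa_gt0 f0 (kappa_ge0 n) ke e8 SD).
Qed.

(** The weight tends to 1 uniformly at rate kappa, so limits of bounded moments may be computed
    under the uniform law. *)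
Lemma uniform_diff_near (h : nat -> V -> R) (C l : R) : (forall n, bmeas (h n)) ->
  (forall n x, `|h n x| <= C) ->
  \int[rotsym_law theta 0 f]_x h n x @[n --> \oo] --> l ->
  \int[P n]_x h n x @[n --> \oo] --> l.
Proof.
move=> bh hC hl; have kappa0 := rate_cvg0 eta_ge0 xi_gt0 kappaE eta_o1.
have [eps _ H] := strict_derivative_rate.
pose dif n := \int[P n]_x h n x - \int[rotsym_law theta 0 f]_x h n x.
have dif0 : dif n @[n --> \oo] --> (0 : R).
  apply: (@cvg_dist_le _ _ (fun n => 2 * C * (2 * kappa n))).
    apply: filterS H => n [ke e8 SD]; rewrite subr0.
    by apply: (rotsym_uniform_diff p_gt0 f0 (kappa_ge0 n) ke e8 SD theta1).
  have -> : (0 : R) = 2 * C * (2 * 0) by rewrite !mulr0.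
  by apply: cvgM; [exact: cvg_cst|apply: cvgM => //; exact: cvg_cst].
have -> : (fun n => \int[P n]_x h n x) =
    (fun n => dif n + \int[rotsym_law theta 0 f]_x h n x).
  by apply/funext => n; rewrite /dif subrK.
by rewrite -(add0r l); exact: cvgD.
Qed.

Lemma mean_dotv_cvg0 (u : V) : \int[P n]_x dotv (radial_proj x) u @[n --> \oo] --> (0 : R).
Proof.
apply: (@uniform_diff_near (fun _ x => dotv (radial_proj x) u) (enorm u)).
- by move=> _; exact: bmeas_dotv_radial_proj.
- by move=> _ x; exact: dotv_radial_proj_le.
- by under eq_fun do rewrite (uniform_mean p_gt0 f0 theta1); exact: cvg_cst.
Qed.

(** Polarization of [uniform_sqr]. *)
Lemma mean_dotv_mul_cvg (u v : V) :
  \int[P n]_x (dotv (radial_proj x) u * dotv (radial_proj x) v) @[n --> \oo] -->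
  dotv u v / p%:R.
Proof.
have bu := @bmeas_dotv_radial_proj R p u; have bv := @bmeas_dotv_radial_proj R p v.
apply: (@uniform_diff_near (fun _ x => dotv (radial_proj x) u * dotv (radial_proj x) v)
  (enorm u * enorm v)).
- by move=> _; exact: bmeasM.
- by move=> _ x; rewrite normrM ler_pM// dotv_radial_proj_le.
have buD := @bmeas_dotv_radial_proj R p (u + v).
have buB := @bmeas_dotv_radial_proj R p (u - v).
suff -> : \int[rotsym_law theta 0 f]_x (dotv (radial_proj x) u * dotv (radial_proj x) v) =
    dotv u v / p%:R by exact: cvg_cst.
transitivity (\int[rotsym_law theta 0 f]_x (4^-1 * (dotv (radial_proj x) (u + v) ^+ 2 -
    dotv (radial_proj x) (u - v) ^+ 2))).
  by apply: eq_Rintegral => x _; rewrite dotvDr dotvBr; field.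
rewrite RintegralZl_bm; last by apply: bmeasB; exact: bmeasX.
rewrite RintegralB_bm; [|exact: bmeasX|exact: bmeasX].
rewrite !(uniform_sqr p_gt0 f0 theta1) !(dotvDl, dotvDr, dotvNl, dotvNr) (dotvC v u).
by field; rewrite pnatr_eq0 -lt0n.
Qed.

(** The mean is kappa / p up to 2 eps kappa, and sqrt(n) kappa tends to sqrt(p) xi, so the error
    survives multiplication by sqrt(n). Multiplied by xi sqrt(p), the limit is the xi^2 of
    [score_shift]. *)
Lemma sqrt_mean_theta_cvg : r = under_contiguity ->
  Num.sqrt n%:R * m n @[n --> \oo] --> xi / sp.
Proof.
move=> ru; have [eps eps0 H] := strict_derivative_rate.
have sk : Num.sqrt n%:R * kappa n @[n --> \oo] --> sp * xi.
  by have := rate_sqrt_cvg eta_ge0 kappaE (l := 1); rewrite mulr1; apply; move: eta_r; rewrite ru.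
pose dif n := Num.sqrt n%:R * m n - Num.sqrt n%:R * kappa n / p%:R.
have dif0 : dif n @[n --> \oo] --> (0 : R).
  apply: (@cvg_dist_le _ _ (fun n => 2 * (eps n * (Num.sqrt n%:R * kappa n)))).
    apply: filterS H => n [ke e8 SD]; rewrite subr0 /dif -mulrA -mulrBr normrM.
    rewrite ger0_norm ?sqrtr_ge0//.
    rewrite (_ : 2 * _ = Num.sqrt n%:R * (2 * (eps n * kappa n))); last by ring.
    rewrite ler_wpM2l ?sqrtr_ge0//.
    exact: (mean_theta_close p_gt0 f0 (kappa_ge0 n) ke e8 SD theta1).
  have -> : (0 : R) = 2 * (0 * (sp * xi)) by ring.
  by apply: cvgM; [exact: cvg_cst|exact: cvgM].
have -> : (fun n => Num.sqrt n%:R * m n) =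
    (fun n => dif n + Num.sqrt n%:R * kappa n / p%:R).
  by apply/funext => n; rewrite /dif subrK.
have -> : xi / sp = 0 + sp * xi / p%:R.
  by rewrite -[X in _ = _ + _ / X]sp_sqr; field; exact: sp_neq0.
by apply: cvgD => //; apply: cvgM => //; exact: cvg_cst.
Qed.

Section clt.
Let u i : V := \col_j M i j.
Let mu n : V := \col_i \int[P n]_x dotv (radial_proj x) (u i).
(** The centred and rescaled summand: on the sphere and for n > 0 the central sequence equals
    [delta n] plus n^(-1/2) times the sum of the [Y n]. *)
Let Y n x : V := (xi * sp) *: (M *m radial_proj x - mu n).
(** The bias left by the centring, that is, the exact mean of the central sequence. *)
Let delta n : V := (Num.sqrt n%:R * (xi * sp)) *: mu n - score_shift r xi *: theta.

Let Mdot (x : V) i : (M *m x) i 0 = dotv x (u i).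
Proof. by rewrite mxE dotvE; apply: eq_bigr => j _; rewrite mxE mulrC. Qed.

Let YE n x i : Y n x i 0 = (xi * sp) * (dotv (radial_proj x) (u i) - mu n i 0).
Proof. by rewrite mxE mxE Mdot [in LHS]mxE. Qed.

Let bu i := @bmeas_dotv_radial_proj R p (u i).

Let mu_le n i : `|mu n i 0| <= enorm (u i).
Proof. by rewrite mxE; apply: norm_Rintegral_le => // x; exact: dotv_radial_proj_le. Qed.

Let Ymean n i : \int[P n]_x (Y n x i 0) = 0.
Proof.
under eq_Rintegral do rewrite YE.
rewrite RintegralZl_bm; last by apply: bmeasB => //; exact: bmeas_cst.
rewrite RintegralB_bm//; last exact: bmeas_cst.
by rewrite Rintegral_prob_cst [mu n i 0]mxE subrr mulr0.
Qed.

Let Ybound n x i : `|Y n x i 0| <= xi * sp * (2 * \sum_j enorm (u j)).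
Proof.
have s0 : 0 <= xi * sp by rewrite mulr_ge0 ?sqrtr_ge0// ltW.
rewrite YE normrM (ger0_norm s0) ler_wpM2l//; apply: (le_trans (ler_normB _ _)).
have : enorm (u i) <= \sum_j enorm (u j).
  by rewrite (bigD1 i)//= lerDl sumr_ge0// => j _; exact: enorm_ge0.
have := mu_le n i; have := dotv_radial_proj_le x (u i); lra.
Qed.

Let Ymeas n : measurable_fun setT (Y n).
Proof.
apply: measurable_scalev; first exact: measurable_cst.
apply: measurable_addv; last exact: measurable_cst.
by apply: measurable_mulmxv; exact: measurable_radial_proj.
Qed.

Let dotu i j : dotv (u i) (u j) = M i j.
Proof.
rewrite -[in RHS](score_proj_idem r theta1) mxE dotvE.
by apply: eq_bigr => k _; rewrite !mxE.
Qed.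

Let Ycov i j : \int[P n]_x (Y n x i 0 * Y n x j 0) @[n --> \oo] -->
  fisher_information r xi theta i j.
Proof.
rewrite fisher_informationE mxE -dotu.
have -> : (fun n => \int[P n]_x (Y n x i 0 * Y n x j 0)) =
  (fun n => xi ^+ 2 * p%:R * (\int[P n]_x (dotv (radial_proj x) (u i) * dotv (radial_proj x) (u j))
    - mu n i 0 * mu n j 0)).
  apply/funext => n; rewrite -sp_sqr.
  pose c := mu n i 0; pose c' := mu n j 0.
  have cE : \int[P n]_x dotv (radial_proj x) (u i) = c by rewrite /c mxE.
  have c'E : \int[P n]_x dotv (radial_proj x) (u j) = c' by rewrite /c' mxE.
  transitivity (\int[P n]_x (xi ^+ 2 * sp ^+ 2 *
    (dotv (radial_proj x) (u i) * dotv (radial_proj x) (u j)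
     - c' * dotv (radial_proj x) (u i) - c * dotv (radial_proj x) (u j) + c * c'))).
    by apply: eq_Rintegral => x _; rewrite !YE -/c -/c'; ring.
  have b1 : bmeas (fun x => dotv (radial_proj x) (u i) * dotv (radial_proj x) (u j))
    by exact: bmeasM.
  have b2 : bmeas (fun x => c' * dotv (radial_proj x) (u i)).
    by apply: bmeasM => //; exact: bmeas_cst.
  have b3 : bmeas (fun x => c * dotv (radial_proj x) (u j)).
    by apply: bmeasM => //; exact: bmeas_cst.
  have b12 := bmeasB b1 b2; have b123 := bmeasB b12 b3.
  rewrite RintegralZl_bm; last by apply: bmeasD => //; exact: bmeas_cst.
  rewrite RintegralD_bm//; last exact: bmeas_cst.
  rewrite Rintegral_prob_cst RintegralB_bm// RintegralB_bm// !RintegralZl_bm// cE c'E -/c -/c'.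
  by congr (_ * _); ring.
have -> : xi ^+ 2 * dotv (u i) (u j) = xi ^+ 2 * p%:R * (dotv (u i) (u j) / p%:R - 0 * 0).
  by field; rewrite pnatr_eq0 -lt0n.
apply: cvgM; first exact: cvg_cst.
apply: cvgB; first exact: mean_dotv_mul_cvg.
by apply: cvgM; under eq_fun do rewrite mxE; exact: mean_dotv_cvg0.
Qed.

(** Beyond contiguity M theta = 0 removes the mean, which is parallel to theta; under contiguity
    sqrt(n) times the mean compensates the shift in the limit; under strict contiguity M = 0. *)
Let delta_cvg0 : norm1 (delta n) @[n --> \oo] --> (0 : R).
Proof.
apply: cvg_sum0 => i; rewrite -(@normr0 _ R); apply: cvg_norm.
have muE : \forall n \near \oo, mu n i 0 = dotv (u i) theta * m n.
  apply: filterS f_kappa_near_gt0 => n fk.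
  by rewrite mxE (rotsym_mean p_gt0 (kappa_ge0 n) fk theta1).
have dE : \forall n \near \oo, dotv (u i) theta * (xi * sp * (Num.sqrt n%:R * m n))
    - score_shift r xi * theta i 0 = delta n i 0.
  apply: filterS muE => n E; rewrite mxE [in RHS]mxE E [X in _ = _ + X]mxE [in RHS]mxE.
  ring.
suff C : dotv (u i) theta * (xi * sp * (Num.sqrt n%:R * m n))
    - score_shift r xi * theta i 0 @[n --> \oo] --> (0 : R).
  exact: (cvg_trans (near_eq_cvg dE) C).
have Mt : dotv (u i) theta = (M *m theta) i 0 by rewrite Mdot dotvC.
rewrite Mt score_proj_mul; case rE : r.
- rewrite enorm1_dotv// scale1r subrr.
  under eq_fun do rewrite mxE mul0r mul0r subr0.
  exact: cvg_cst.
- have -> : (0 : R) = theta i 0 * (xi * sp * (xi / sp)) - xi ^+ 2 * theta i 0.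
    by field; exact: sp_neq0.
  apply: cvgB; last exact: cvg_cst.
  apply: cvgM; first exact: cvg_cst.
  by apply: cvgM; [exact: cvg_cst|exact: sqrt_mean_theta_cvg].
- under eq_fun do rewrite mxE mul0r mul0r subr0.
  exact: cvg_cst.
Qed.

Lemma ae_all_on_sphere n : 0 < f (- kappa n) ->
  {ae joint_law (kappa n) f n theta, forall x, forall i, sphere p (tnth x i)}.
Proof.
move=> fk; have mA := @measurable_all_on_sphere R p n.
exists (~` (@all_on_sphere R p n)); split; first exact: measurableC.
  have H := joint_law_all_on_sphere p_gt0 (kappa_ge0 n) fk n theta1.
  have E := probability_setC (joint_law (kappa n) f n theta) mA.
  by apply: (etrans E); rewrite [X in (_ - X)%E]H subee.
by move=> x /= H; exact: H.
Qed.

Lemma central_sequence_cvg_in_law :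
  cvg_in_law (fun n => joint_law (kappa n) f n theta)
    (fun n => @central_sequence R p r xi theta n)
    (mvnormal 0 (fisher_information r xi theta)).
Proof.
move=> g cg bg; set Gamma := fisher_information r xi theta.
have [C gC] : exists C, forall x, `|g x| <= C.
  have [C0 [_ gC0]] := bg; exists (`|C0| + 1) => x.
  by apply: (gC0 _ _) => //; rewrite (le_lt_trans (ler_norm C0))// ltrDl.
have bmg : bmeas g by split; [exact: continuous_measurable_cV|exists C].
pose A : 'M[R]_p := xget 0 [set A | A *m A^T = Gamma].
have AE : A *m A^T = Gamma.
  (* A square root of Gamma exists because M M' = M; the matrix chosen by [xget] may be another one,
     and only A A' = Gamma is used. *)
  apply: (@xgetPex _ 0 [set A | A *m A^T = Gamma]); exists (xi *: M).
  rewrite /= linearZ/= -scalemxAl -scalemxAr scalerA score_proj_idem//.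
  by rewrite /Gamma fisher_informationE expr2.
pose gaussp : probability (p.-tuple (measurableTypeR R)) R := iid_ (@normal_prob R 0 1) p.
pose X n (t : n.-tuple V) := delta n + (Num.sqrt n%:R)^-1 *: \sum_(i < n) Y n (tnth t i).
have mX n : measurable_fun setT (@X n) by exact: measurable_sum_iid.
have mZ := measurable_linear_gauss A.
have iZ : gaussp.-integrable setT (EFin \o (fun t => norm1 (A *m cV_of_tuple t : V))).
  have := integrable_norm1X mZ (integrable_norm1_gauss A) (isT : (1 <= 3)%N).
  by under eq_fun do rewrite expr1.
have Ycov' i j : \int[P n]_x (Y n x i 0 * Y n x j 0) @[n --> \oo] --> (A *m A^T) i j.
  by rewrite AE; exact: Ycov.
have smooth (F : V -> R) (sF : smooth2 F) :=
  smooth_clt Ymeas Ybound Ymean Ycov' delta_cvg0 sF.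
have H := cvg_continuous_of_smooth (P := fun n => joint_law (kappa n) f n theta)
  mX mZ iZ smooth cg bg.
have -> : (\int[mvnormal 0 Gamma]_x (g x)%:E = \int[gaussp]_t (g (A *m cV_of_tuple t))%:E)%E.
  have bgZ : bmeas (fun t : p.-tuple (measurableTypeR R) => g (affine_cV 0 A t)).
    apply: (bmeas_comp _ bmg); rewrite (_ : affine_cV 0 A = fun t => A *m cV_of_tuple t)//.
    by apply/funext => t; rewrite /affine_cV add0r.
  rewrite integral_distribution.
  - by apply: eq_integral => t _; rewrite /= /affine_cV add0r.
  - by apply/measurable_EFinP; exact: bmg.1.
  - exact: (bmeas_integrable gaussp bgZ).
(* [X n] is written with [radial_proj], so it agrees with the central sequence only almost surely,
   and once n > 0 and f(- kappa n) > 0. *)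
apply: cvg_trans H; apply: near_eq_cvg; near=> n.
have n0 : (0 < n)%N by near: n; exists 1%N.
have fk : 0 < f (- kappa n) by near: n; exact: f_kappa_near_gt0.
apply: ae_eq_integral => //.
- by apply/measurable_EFinP; exact: (bmeas_comp (mX n) bmg).1.
- apply/measurable_EFinP.
  exact: (bmeas_comp (@measurable_central_sequence R p r xi theta n) bmg).1.
apply: filterS (ae_all_on_sphere fk) => x xs _; congr (g _)%:E.
rewrite central_sequenceE// /X /delta /Y addrAC; congr (_ - _).
have s0 : Num.sqrt n%:R != 0 :> R by rewrite gt_eqF// sqrtr_gt0 ltr0n.
rewrite -scaler_sumr scalerA sumrB sumr_const card_ord scalerBr.
rewrite -[mu n *+ n]scaler_nat scalerA.
have -> : (Num.sqrt n%:R)^-1 * (xi * sp) * n%:R = Num.sqrt n%:R * (xi * sp).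
  rewrite -{2}(sqr_sqrtr (ler0n R n)); field; exact: s0.
by rewrite addrC subrK; congr (_ *: _); ring.
Unshelve. all: by end_near. Qed.

End clt.

Section expansion.
Variables (tau : nat -> V) (Mt : R).
Hypothesis tauM : forall n, enorm (tau n) <= Mt.
Hypothesis tau_sphere : forall n, (0 < n)%N -> sphere p (theta + nu n *: tau n).
Notation a n := (Num.sqrt n%:R * (kappa n * nu n)).
Notation L := (rate_limit p xi r).
(** Chosen so that, for n > 0 and on the sphere, tau'Delta - tau'Gamma tau / 2 is the sum of the
    x_i'zeta plus [k n], which holds the nonrandom terms. *)
Let zeta n : V := (xi * sp / Num.sqrt n%:R) *: (M *m tau n).
Let k n : R := - (score_shift r xi * dotv (tau n) theta) -
  2^-1 * dotv (tau n) (fisher_information r xi theta *m tau n).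

Let a_cvg : a n @[n --> \oo] --> L.
Proof. exact: rate_limit_cvg. Qed.

Let Mt0 : 0 <= Mt. Proof. exact: le_trans (enorm_ge0 _) (tauM 0). Qed.

Let tau2_le n : `|dotv (tau n) (tau n)| <= Mt ^+ 2.
Proof.
by rewrite -enorm_sqr ger0_norm ?sqr_ge0// lerXn2r ?nnegrE ?enorm_ge0//.
Qed.

Let dotv_theta_le n : `|dotv theta (tau n)| <= Mt.
Proof. by apply: (le_trans (cauchy_schwarz _ _)); rewrite theta1 mul1r. Qed.

Let bounded_mul_cvg0 (x y : R^nat) (C : R) : (forall n, `|y n| <= C) ->
  x n @[n --> \oo] --> (0 : R) -> x n * y n @[n --> \oo] --> (0 : R).
Proof.
move=> yC x0; apply: (@cvg_dist_le _ _ (fun n => `|x n| * C)).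
  by apply: nearW => n; rewrite subr0 normrM ler_wpM2l.
rewrite -(mul0r C); apply: cvgM; last exact: cvg_cst.
by rewrite -(@normr0 _ R); exact: cvg_norm.
Qed.

Let dotv_theta_cvg0 : r = beyond_contiguity ->
  dotv theta (tau n) @[n --> \oo] --> (0 : R).
Proof.
move=> rb; have etaoo : Num.sqrt n%:R * eta n @[n --> \oo] --> +oo.
  by move: eta_r; rewrite rb.
have nu0 : nu n @[n --> \oo] --> (0 : R).
  apply/cvgrPdist_le => e e0; near=> n; rewrite sub0r normrN ger0_norm ?contiguity_rate_ge0//.
  rewrite rb /= -[leRHS]invrK lef_pV2 ?posrE ?invr_gt0//.
    by near: n; move/cvgryPge : etaoo; exact.
  by near: n; exact: eta_gt0_beyond.
apply: (@cvg_dist_le _ _ (fun n => nu n * (Mt ^+ 2 / 2))).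
  near=> n; rewrite subr0.
  have n0 : (0 < n)%N by near: n; exists 1%N.
  have nup : 0 < nu n by rewrite rb /= invr_gt0; near: n; exact: eta_gt0_beyond.
  rewrite (sphere_shift_dotv theta1 (tau_sphere n0) nup) normrN -mulrA.
  rewrite normrM (gtr0_norm nup) ler_wpM2l ?(ltW nup)// normrM ler_pM//.
  by rewrite ger0_norm.
by rewrite -(mul0r (Mt ^+ 2 / 2)); apply: cvgM => //; exact: cvg_cst.
Unshelve. all: by end_near. Qed.

(** Up to the factor sqrt(n), the difference is (a - L) tau plus, beyond contiguity, the part L
    (theta'tau) theta removed by the projection; both vanish. *)
Let zeta_close : Num.sqrt n%:R * enorm ((kappa n * nu n) *: tau n - zeta n)
  @[n --> \oo] --> (0 : R).
Proof.
pose dev n : R := if r is beyond_contiguity then sp * xi * `|dotv theta (tau n)| else 0.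
apply: (@cvg_dist_le _ _ (fun n => `|a n - L| * Mt + dev n)).
  near=> n; have n0 : (0 < n)%N by near: n; exists 1%N.
  have s0 : Num.sqrt n%:R != 0 :> R by rewrite gt_eqF// sqrtr_gt0 ltr0n.
  rewrite subr0 ger0_norm ?mulr_ge0 ?sqrtr_ge0 ?enorm_ge0//.
  rewrite -[X in X * _](ger0_norm (sqrtr_ge0 n%:R)) -enormZ scalerBr !scalerA.
  have -> : Num.sqrt n%:R * (xi * sp / Num.sqrt n%:R) = sp * xi by field.
  have le1 : enorm ((a n - L) *: tau n) <= `|a n - L| * Mt.
    by rewrite enormZ ler_wpM2l.
  rewrite score_proj_mul /dev /L; move: le1; case: r => /= le1.
  - set c := Num.sqrt n%:R * _ in le1 *; set d := dotv theta (tau n).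
    have -> : c *: tau n - (sp * xi) *: (tau n - d *: theta) =
        (c - sp * xi) *: tau n + (sp * xi * d) *: theta.
      by apply/colP => i; rewrite !mxE; ring.
    apply: (le_trans (enorm_triangle _ _)); apply: lerD => //.
    by rewrite enormZ theta1 mulr1 normrM ger0_norm// mulr_ge0 ?sqrtr_ge0 ?(ltW xi_gt0).
  - by rewrite addr0 -scalerBl.
  - by rewrite addr0 scaler0 subr0; move: le1; rewrite subr0.
rewrite -(addr0 (0 : R)); apply: cvgD.
  rewrite -(mul0r Mt); apply: cvgM; last exact: cvg_cst.
  rewrite -(@normr0 _ R) -(subrr L); apply: cvg_norm.
  by apply: cvgB => //; exact: cvg_cst.
rewrite /dev; case rE : r; [|exact: cvg_cst|exact: cvg_cst].
rewrite -(mulr0 (sp * xi)); apply: cvgM; first exact: cvg_cst.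
by rewrite -(@normr0 _ R); apply: cvg_norm; exact: dotv_theta_cvg0.
Unshelve. all: by end_near. Qed.

(** The drift equals (a^2 - L^2) |tau|^2 / (2 p) plus a term specific to the regime. Beyond
    contiguity M theta = 0 and xi^2 (theta'tau)^2 / 2 remains; under contiguity the centring of the
    linear statistic offsets xi^2 theta'tau; under strict contiguity nothing remains. *)
Let drift_cvg0 : n%:R * (dotv (zeta n) theta * m n) +
  a n ^+ 2 * (dotv (tau n) (tau n) / p%:R) / 2 + k n @[n --> \oo] --> (0 : R).
Proof.
pose t n := dotv (tau n) (tau n).
have sq0 : (a n ^+ 2 - L ^+ 2) / (2 * p%:R) @[n --> \oo] --> (0 : R).
  rewrite -(mul0r (2 * p%:R)^-1); apply: cvgM; last exact: cvg_cst.
  rewrite -(subrr (L ^+ 2)); apply: cvgB; last exact: cvg_cst.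
  by under eq_fun do rewrite expr2; rewrite expr2; exact: cvgM.
have main : (a n ^+ 2 - L ^+ 2) / (2 * p%:R) * t n @[n --> \oo] --> (0 : R).
  exact: (bounded_mul_cvg0 tau2_le sq0).
pose rest n : R := match r with
  | beyond_contiguity => 2^-1 * xi ^+ 2 * (dotv theta (tau n) * dotv theta (tau n))
  | under_contiguity => (xi * sp * (Num.sqrt n%:R * m n) - xi ^+ 2) * dotv theta (tau n)
  | strict_contiguity => 0
  end.
have rest0 : rest n @[n --> \oo] --> (0 : R).
  rewrite /rest; case rE : r; last exact: cvg_cst.
  - have H := dotv_theta_cvg0 rE.
    have -> : (0 : R) = 2^-1 * xi ^+ 2 * (0 * 0) by rewrite !mulr0.
    by apply: cvgM; [exact: cvg_cst|exact: cvgM].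
  - apply: (bounded_mul_cvg0 dotv_theta_le).
    have -> : (0 : R) = xi * sp * (xi / sp) - xi ^+ 2 by field; exact: sp_neq0.
    apply: cvgB; last exact: cvg_cst.
    by apply: cvgM; [exact: cvg_cst|exact: sqrt_mean_theta_cvg].
have pn0 : p%:R != 0 :> R by rewrite pnatr_eq0 -lt0n.
suff -> : (fun n => n%:R * (dotv (zeta n) theta * m n) +
    a n ^+ 2 * (dotv (tau n) (tau n) / p%:R) / 2 + k n) =
    (fun n => (a n ^+ 2 - L ^+ 2) / (2 * p%:R) * t n + rest n).
  by rewrite -(addr0 (0 : R)); exact: cvgD.
apply/funext => n; set mn := m n.
have nS : n%:R * (xi * sp / Num.sqrt n%:R) = xi * sp * Num.sqrt n%:R.
  (* The identity is stated for all n, and at n = 0 both sides are 0. *)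
  have [->|n0] := posnP n; first by rewrite mul0r sqrtr0 mulr0.
  rewrite -{1}(sqr_sqrtr (ler0n R n)); field.
  by rewrite gt_eqF// sqrtr_gt0 ltr0n.
rewrite /k fisher_informationE -scalemxAl /zeta dotvZl dotvZr -/(t n).
rewrite -[X in X + _ + _]/(n%:R * (xi * sp / Num.sqrt n%:R * _ * mn)).
rewrite (_ : n%:R * (xi * sp / Num.sqrt n%:R * dotv (M *m tau n) theta * mn) =
  xi * sp * Num.sqrt n%:R * dotv (M *m tau n) theta * mn); last by rewrite -nS; ring.
rewrite score_proj_mul /rest -/mn (dotvC (tau n) theta).
have L2 : L ^+ 2 = if r is strict_contiguity then 0 else xi ^+ 2 * p%:R.
  by rewrite /rate_limit; case: r; rewrite ?expr0n// exprMn sp_sqr mulrC.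
rewrite L2 /score_shift /t; move: (a n) => an; case: r.
- rewrite dotvBl dotvBr dotvZl dotvZr enorm1_dotv// (dotvC (tau n) theta) mulr1 subrr.
  by field.
- by rewrite (dotvC (tau n) theta); field.
- by rewrite dotv0l dotv0r; field.
Qed.

Lemma loglik_ratio_expansion :
  is_oP1 (fun n => joint_law (kappa n) f n theta) (fun n x =>
    (loglik_ratio (kappa n) f (theta + nu n *: tau n) theta x -
     (dotv (tau n) (@central_sequence R p r xi theta n x) -
      2^-1 * dotv (tau n) (fisher_information r xi theta *m tau n))%:E)%E).
Proof.
have [eps eps0 H] := strict_derivative_rate.
move=> e e0; apply: (loglik_remainder_cvg0 p_gt0 f0 (nu := fun n => nu n)
    (tau := tau) (zeta := zeta) (k := k) (Mt := Mt) kappa_ge0 _ eps0 _ theta1 _ tauM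
    a_cvg zeta_close drift_cvg0) => //.
- by move=> n; exact: contiguity_rate_ge0.
- by apply: filterS H => n [].
- by near=> n; apply: tau_sphere; near: n; exists 1%N.
- near=> n; have n0 : (0 < n)%N by near: n; exists 1%N.
  have fk : 0 < f (- kappa n) by near: n; exact: f_kappa_near_gt0.
  apply: emeasurable_funB.
    exact: (measurable_loglik_ratio p_gt0 (kappa_ge0 n) fk (tau_sphere n0) theta1).
  apply/measurable_EFinP; apply: measurable_funB; last exact: measurable_cst.
  under eq_fun do rewrite dotvC.
  exact: (measurableT_comp (measurable_dotv (tau n)) (@measurable_central_sequence R p r xi
    theta n)).
- near=> n; have n0 : (0 < n)%N by near: n; exists 1%N.
  have fk : 0 < f (- kappa n) by near: n; exact: f_kappa_near_gt0.
  apply: filterS (ae_all_on_sphere fk) => x xs; congr (_ - _%:E)%E.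
  rewrite central_sequenceE// /k dotvBr !dotvZr addrA; congr (_ - _).
  congr (_ - _); rewrite dotvC dotv_suml mulr_sumr; apply: eq_bigr => i _.
  by rewrite /zeta dotvZr dotv_mulmxl score_proj_tr.
Unshelve. all: by end_near. Qed.

End expansion.

End lan.

Theorem theorem5p1 (R : realType) (p : nat) (p_ge2 : (2 <= p)%N)
  (eta : R^nat) (eta_ge0 : forall n, 0 <= eta n)
  (eta_o1 : eta n @[n --> \oo] --> (0 : R))
  (xi : R) (xi_gt0 : 0 < xi)
  (f : angular_function R)
  (f_diff : \forall t \near (0 : R), derivable f t 1)
  (f_diff2 : derivable (derive1 f) 0 1)
  (f0 : f 0 = 1) (f'0 : derive1 f 0 = 1)
  (kappa : R^nat) (kappa_ge0 : forall n, 0 <= kappa n)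
  (kappaE : (fun n => kappa n - Num.sqrt p%:R * eta n * xi) =o_\oo eta)
  (r : regime) (eta_r : in_regime r eta)
  (theta : 'cV[R]_p) (theta_sphere : sphere p theta)
  (tau : nat -> 'cV[R]_p)
  (tau_bounded : exists M : R, forall n, enorm (tau n) <= M)
  (tau_not_o1 : ~ (enorm (tau n) @[n --> \oo] --> (0 : R)))
  (tau_sphere : forall n, (0 < n)%N ->
     sphere p (theta + contiguity_rate r eta n *: tau n)) :
  let P n := joint_law (kappa n) f n theta in
  let Delta n := @central_sequence R p r xi theta n in
  let Gamma := fisher_information r xi theta in
  is_oP1 P (fun n x =>
    (loglik_ratio (kappa n) f (theta + contiguity_rate r eta n *: tau n) theta x
     - (dotv (tau n) (Delta n x) - 2^-1 * dotv (tau n) (Gamma *m tau n))%:E)%E)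
  /\ cvg_in_law P Delta (mvnormal 0 Gamma).
Proof.
move=> P Delta Gamma; have p_gt0 : (0 < p)%N by exact: leq_trans p_ge2.
have [Mt tauM] := tau_bounded; split.
  exact: (loglik_ratio_expansion p_gt0 eta_ge0 eta_o1 xi_gt0 f_diff f_diff2 f0 f'0
    kappa_ge0 kappaE eta_r theta_sphere tauM tau_sphere).
exact: (central_sequence_cvg_in_law p_gt0 eta_ge0 eta_o1 xi_gt0 f_diff f_diff2 f0 f'0
  kappa_ge0 kappaE eta_r theta_sphere).
Qed.
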